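(* Let $d\in\{1,2\}$ and $Q\in L^2_{\mathrm{loc}}(\mathbb{R}^d)$ real-valued. Suppose $H_Q$ is bounded below with ground-state energy $E_0=\inf\sigma(H_Q)$, and that $H_Q$ has a bounded positive ground state, i.e. a bounded function $\psi>0$ (in $W^{1,1}_{\mathrm{loc}}$) which is a distributional solution of $-\nabla^2\psi+Q\psi=E_0\psi$. If $V\in L^2_{\mathrm{loc}}(\mathbb{R}^d)$ is real-valued and both $H_{Q+V}$ and $H_{Q-V}$ are bounded below by $E_0$ (i.e. $\int\|\nabla\phi\|^2+(Q\pm V)|\phi|^2\ge E_0\int|\phi|^2$ for all $\phi\in C_c^\infty(\mathbb{R}^d)$), then $V\equiv0$.
   Context: For a real potential $W$ on $\mathbb{R}^d$, $H_W=-\nabla^2+W$ is the Schrödinger operator on $L^2(\mathbb{R}^d)$, defined through its quadratic form $\int\|\nabla\phi\|^2+W|\phi|^2$. The ground-state energy is the infimum of the spectrum; a ground state is a distributional solution of $-\nabla^2\psi+Q\psi=E_0\psi$ with $E_0$ the ground-state energy. *)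

(* Defs.v *)
From HB Require Import structures.
From mathcomp Require Import all_boot all_order all_algebra.
From mathcomp Require Import all_classical all_reals all_analysis.
From Stdlib Require List.
Set Implicit Arguments. Unset Strict Implicit. Unset Printing Implicit Defensive.
Import Order.TTheory GRing.Theory Num.Theory.
Import numFieldNormedType.Exports.
Local Open Scope classical_set_scope.
Local Open Scope ring_scope.

Section Smooth.
Context {R : realType} {V : normedModType R}.

Definition iter_deriv (s : seq V) (f : V -> R) : V -> R :=
  foldr (fun v g => 'D_v g) f s.

Definition smooth (f : V -> R) : Prop :=
  forall (s : seq V) (x : V), differentiable (iter_deriv s f) x.

Definition compact_support (f : V -> R) : Prop :=
  compact (closure [set x | f x != 0]).

Definition test_fun (f : V -> R) : Prop := smooth f /\ compact_support f.
End Smooth.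

Section Generic.
Context {R : realType} {d : measure_display} {T : measurableType d}.
Variable mu : {measure set T -> \bar R}.
Variable ballN : nat -> set T.
Variable test : set (T -> R).
Variable grad2 : (T -> R) -> T -> R.      (* x |-> ||grad phi (x)||^2 *)
Variable lap : (T -> R) -> T -> R.
Variable partials : seq ((T -> R) -> T -> R).

Local Open Scope ereal_scope.

Definition Lploc (p : nat) (f : T -> R) : Prop :=
  measurable_fun setT f /\
  forall n, mu.-integrable (ballN n) (fun x => (`|f x| ^+ p)%:E).

Definition form_ge (W : T -> R) (E : R) : Prop :=
  forall phi, test phi ->
    E%:E * (\int[mu]_x ((phi x ^+ 2)%:E))
      <= \int[mu]_x ((grad2 phi x + W x * phi x ^+ 2)%R%:E).

(* E0 = inf sigma(H_W): greatest lower bound of the quadratic form *)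
Definition ground_energy (W : T -> R) (E0 : R) : Prop :=
  form_ge W E0 /\ forall E, form_ge W E -> (E <= E0)%R.

Definition W11loc (f : T -> R) : Prop :=
  Lploc 1 f /\
  forall D, Stdlib.Lists.List.In D partials -> exists g, Lploc 1 g /\
    forall phi, test phi ->
      \int[mu]_x ((f x * D phi x)%R%:E) = - \int[mu]_x ((g x * phi x)%R%:E).

Definition dist_solution (W : T -> R) (E : R) (psi : T -> R) : Prop :=
  forall phi, test phi ->
    \int[mu]_x ((psi x * (- lap phi x) + W x * psi x * phi x)%R%:E)
      = E%:E * \int[mu]_x ((psi x * phi x)%R%:E).

Definition bounded_positive_ground_state (W : T -> R) (E0 : R) (psi : T -> R)
  : Prop :=
  (exists M : R, forall x, (`|psi x| <= M)%R) /\ (forall x, (0 < psi x)%R) /\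
  W11loc psi /\ dist_solution W E0 psi.

Definition claim : Prop :=
  forall (Q : T -> R) (E0 : R) (psi : T -> R) (V : T -> R),
    Lploc 2 Q ->
    ground_energy Q E0 ->
    bounded_positive_ground_state Q E0 psi ->
    Lploc 2 V ->
    form_ge (Q \+ V)%R E0 ->
    form_ge (Q \- V)%R E0 ->
    {ae mu, forall x, V x = 0%R}.
End Generic.

Section Dim1.
Context {R : realType}.
Local Notation T1 := (measurableTypeR R).
Definition ballN1 (n : nat) : set T1 := ball (0 : R) n%:R.
Definition test1 (f : T1 -> R) : Prop := test_fun (f : R -> R).
Definition grad2_1 (f : T1 -> R) (x : T1) : R := ('D_1 (f : R -> R) (x : R)) ^+ 2.
Definition lap1 (f : T1 -> R) (x : T1) : R :=
  'D_1 ('D_1 (f : R -> R)) (x : R).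
Definition partials1 : seq ((T1 -> R) -> T1 -> R) :=
  [:: fun f x => 'D_1 (f : R -> R) (x : R)].
Definition claim_d1 : Prop :=
  claim (@lebesgue_measure R) ballN1 test1 grad2_1 lap1 partials1.
End Dim1.

Section Dim2.
Context {R : realType}.
Local Notation T2 := (measurableTypeR R * measurableTypeR R)%type.
Definition e1 : R * R := (1, 0).
Definition e2 : R * R := (0, 1).
Definition leb2 := (@lebesgue_measure R \x @lebesgue_measure R)%E.
Definition ballN2 (n : nat) : set T2 := ball ((0, 0) : R * R) n%:R.
Definition test2 (f : T2 -> R) : Prop := test_fun (f : R * R -> R).
Definition grad2_2 (f : T2 -> R) (x : T2) : R :=
  ('D_e1 (f : R * R -> R) (x : R * R)) ^+ 2 +
  ('D_e2 (f : R * R -> R) (x : R * R)) ^+ 2.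
Definition lap2 (f : T2 -> R) (x : T2) : R :=
  'D_e1 ('D_e1 (f : R * R -> R)) (x : R * R) +
  'D_e2 ('D_e2 (f : R * R -> R)) (x : R * R).
Definition partials2 : seq ((T2 -> R) -> T2 -> R) :=
  [:: fun f x => 'D_e1 (f : R * R -> R) (x : R * R);
      fun f x => 'D_e2 (f : R * R -> R) (x : R * R)].
Definition claim_d2 : Prop :=
  claim leb2 ballN2 test2 grad2_2 lap2 partials2.
End Dim2.

(* Main.v *)
Require Import Defs.
From HB Require Import structures.
From mathcomp Require Import all_boot all_order all_algebra.
From mathcomp Require Import all_classical all_reals all_analysis.
From mathcomp Require Import measurable_realfun.
From mathcomp Require Import ring lra.
Set Implicit Arguments. Unset Strict Implicit. Unset Printing Implicit Defensive.
Import Order.TTheory GRing.Theory Num.Theory.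
Import numFieldNormedType.Exports.
Local Open Scope classical_set_scope.
Local Open Scope ring_scope.

(* In the plane, test the forms of Q + V - E0 and Q - V - E0 on f u, where u is
   a mollification of psi.  Since psi solves the equation, the ground state
   representation turns the Q-part into the integral of u^2 |grad f|^2, up to an
   error that vanishes with the mollification.  Hence v = V psi^2 satisfies
   |int v f^2| <= K D(f) for every test f, where D is the Dirichlet energy and
   K = (sup psi)^2.  Polarisation gives
   4 t int v f g <= 2 K (t^2 D(f) + D(g)) for all t.  Take f equal to j on the
   support of g with D(f) <= C j, which is possible in the plane since its
   capacity vanishes, and t small: letting j grow yields int v g <= 0 for every
   test g, so v = 0 and therefore V = 0.

   On the line, Q, V and psi are extended to the plane so as to be constant in the
   second variable.  The hypotheses pass to the extensions because a test
   function restricts to a test function on each horizontal line, and the second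
   partial derivative only increases the form and integrates to zero against
   functions of the first variable. *)

(** * Smooth functions *)

(** The product of a test function with psi need not be a test function, while the form bounds are
    assumed for test functions only: hence the mollification. The mollified u solves the equation
    only approximately. After Green's formula the convolution is moved onto the test function f^2 u,
    and what remains is the commutator error: the integral of W times f^2 u^2 - psi (rho * (f^2 u)),
    with W = Q - E0. As W is only locally square integrable, this factor has to be small in L2; it
    is small in L1 and uniformly bounded, which suffices. The dimension enters through scaling: in
    the plane a dilation does not change the Dirichlet energy, so j cutoffs at successive scales,
    with gradients on disjoint annuli, reach height j at an energy of order j instead of j^2.
    Polarisation exploits this: the left side and the energy of f are then both linear in j, so a
    fixed small t lets the left side win while D(g) stays fixed. The last step, from test functions
    to v = 0, is again a mollification, of v clipped to [-1, 1] on a box. *)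

Section SmoothCalculus.
Context {R : realType} {V : normedModType R}.
Implicit Types f g : V -> R.

(** Truncating at order [n] allows induction on the order; an induction on the list of directions
    would have to expand iterated derivatives of products and compositions. *)
Definition smooth_upto n f := forall s : seq V, (size s <= n)%N ->
  forall x, differentiable (iter_deriv s f) x.

Lemma iter_deriv_rcons s v f :
  iter_deriv (rcons s v) f = iter_deriv s ('D_v f).
Proof. by rewrite /iter_deriv foldr_rcons. Qed.

Lemma smooth_uptoP f : smooth f <-> forall n, smooth_upto n f.
Proof.
split=> [sf n s _ x|sf s x]; first exact: sf.
exact: (sf (size s)).
Qed.

Lemma smooth_uptoW n f : smooth_upto n.+1 f -> smooth_upto n f.
Proof. by move=> sf s sn; apply: sf; exact: leqW. Qed.

Lemma smooth_upto_diff n f x : smooth_upto n f -> differentiable f x.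
Proof. by move=> sf; apply: (sf [::]). Qed.

(** Peels off the innermost derivative, which is the last entry of the list: the rules for sums,
    products and compositions then rewrite ['D_v f], and the induction hypothesis applies to the
    result. *)
Lemma smooth_uptoS n f : smooth_upto n.+1 f <->
  (forall x, differentiable f x) /\ forall v, smooth_upto n ('D_v f).
Proof.
split=> [sf|[df sf] s].
  split=> [x|v s sn x]; first exact: smooth_upto_diff sf.
  by rewrite -iter_deriv_rcons; apply: sf; rewrite size_rcons.
by case/lastP: s => // s v; rewrite size_rcons ltnS iter_deriv_rcons => /sf.
Qed.

Lemma smooth_upto0 f : smooth_upto 0 f <-> forall x, differentiable f x.
Proof. by split=> [sf x|sf [|//] _]; [exact: smooth_upto_diff sf|exact: sf]. Qed.

Lemma derive_addE f g v : (forall x, differentiable f x) ->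
  (forall x, differentiable g x) ->
  'D_v (fun x => f x + g x) = (fun x => 'D_v f x + 'D_v g x).
Proof.
move=> df dg; apply/funext => x.
by apply: (@deriveD _ _ _ f g); exact: diff_derivable.
Qed.

Lemma derive_mulE f g v : (forall x, differentiable f x) ->
  (forall x, differentiable g x) ->
  'D_v (fun x => f x * g x) = (fun x => f x * 'D_v g x + g x * 'D_v f x).
Proof.
move=> df dg; apply/funext => x.
by apply: (@deriveM _ _ f g); exact: diff_derivable.
Qed.

Lemma derive_scaleE f k v : (forall x, differentiable f x) ->
  'D_v (fun x => k * f x) = (fun x => k * 'D_v f x).
Proof.
move=> df; apply/funext => x.
by apply: (@deriveZ _ _ _ f k); exact: diff_derivable.
Qed.

Lemma smooth_upto_cst n (a : R) : smooth_upto n (fun _ : V => a).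
Proof.
elim: n a => [|n IH] a; first by apply/smooth_upto0 => x; exact: differentiable_cst.
apply/smooth_uptoS; split=> [x|v]; first exact: differentiable_cst.
rewrite (_ : 'D_v _ = fun=> 0); first exact: IH.
by apply/funext => x; exact: derive_cst.
Qed.

Lemma smooth_uptoD n f g : smooth_upto n f -> smooth_upto n g ->
  smooth_upto n (fun x => f x + g x).
Proof.
elim: n f g => [|n IH] f g.
  by move=> /smooth_upto0 df /smooth_upto0 dg; apply/smooth_upto0 => x;
    exact: (differentiableD (df x) (dg x)).
move=> /smooth_uptoS[df sf] /smooth_uptoS[dg sg]; apply/smooth_uptoS.
split=> [x|v]; first exact: (differentiableD (df x) (dg x)).
by rewrite derive_addE//; apply: IH.
Qed.

Lemma smooth_uptoM n f g : smooth_upto n f -> smooth_upto n g ->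
  smooth_upto n (fun x => f x * g x).
Proof.
elim: n f g => [|n IH] f g.
  by move=> /smooth_upto0 df /smooth_upto0 dg; apply/smooth_upto0 => x;
    exact: (differentiableM (df x) (dg x)).
move=> sf sg; have := sf; have := sg.
move=> /smooth_uptoS[dg sdg] /smooth_uptoS[df sdf]; apply/smooth_uptoS.
split=> [x|v]; first exact: (differentiableM (df x) (dg x)).
by rewrite derive_mulE//; apply: smooth_uptoD; apply: IH => //; exact: smooth_uptoW.
Qed.

Lemma smooth_diff f : smooth f -> forall x, differentiable f x.
Proof. by move=> sf x; exact: (sf [::]). Qed.

Lemma smooth_derive f v : smooth f -> smooth ('D_v f).
Proof. by move=> sf s x; rewrite -iter_deriv_rcons; exact: sf. Qed.

Lemma smooth_cst (a : R) : smooth (fun _ : V => a).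
Proof. by apply/smooth_uptoP => n; exact: smooth_upto_cst. Qed.

Lemma smoothD f g : smooth f -> smooth g -> smooth (fun x => f x + g x).
Proof.
by move=> /smooth_uptoP sf /smooth_uptoP sg; apply/smooth_uptoP => n; exact: smooth_uptoD.
Qed.

Lemma smoothM f g : smooth f -> smooth g -> smooth (fun x => f x * g x).
Proof.
by move=> /smooth_uptoP sf /smooth_uptoP sg; apply/smooth_uptoP => n; exact: smooth_uptoM.
Qed.

Lemma smoothZ k f : smooth f -> smooth (fun x => k * f x).
Proof. by move=> sf; apply: smoothM => //; exact: smooth_cst. Qed.

Lemma smooth_lin (f : {linear V -> R}) : continuous f -> smooth f.
Proof.
move=> cf; apply/smooth_uptoP => -[|n].
  by apply/smooth_upto0 => x; exact: linear_differentiable.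
apply/smooth_uptoS; split=> [x|v]; first exact: linear_differentiable.
rewrite (_ : 'D_v _ = fun=> f v); first exact: smooth_upto_cst.
apply/funext => x; rewrite deriveE; last exact: linear_differentiable.
by rewrite diff_lin.
Qed.

Lemma differentiable_dilation c f x : (forall x, differentiable f x) ->
  differentiable (fun x => f (c *: x)) x.
Proof.
move=> df; have [dc _] := is_diff_scaler c x.
exact: (@differentiable_comp _ _ _ _ ( *:%R c) f).
Qed.

Lemma derive_dilationE c f v : (forall x, differentiable f x) ->
  'D_v (fun x => f (c *: x)) = fun x => c * 'D_v f (c *: x).
Proof.
move=> df; apply/funext => x; have [dc Dc] := is_diff_scaler c x.
rewrite deriveE; last exact: differentiable_dilation.
by rewrite (@diff_comp _ _ _ _ ( *:%R c) f)//= Dc linearZ/= deriveE.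
Qed.

Lemma smooth_dilation c f : smooth f -> smooth (fun x => f (c *: x)).
Proof.
move=> /smooth_uptoP sf; apply/smooth_uptoP => n.
elim: n f {sf}(sf n) => [|n IH] g.
  by move=> /smooth_upto0 dg; apply/smooth_upto0 => x; exact: differentiable_dilation.
move=> /smooth_uptoS[dg sg]; apply/smooth_uptoS; split=> [x|v].
  exact: differentiable_dilation.
rewrite derive_dilationE//; apply: smooth_uptoM; first exact: smooth_upto_cst.
exact: (IH _ (sg v)).
Qed.

Lemma smooth_continuous f : smooth f -> continuous f.
Proof. by move=> sf x; apply: differentiable_continuous; exact: smooth_diff. Qed.

End SmoothCalculus.

(** * The flat function exp(-1/t) *)

Section Bump.
Context {R : realType}.

(* The exponent k closes the family under differentiation:
   flat k' = flat k.+2 - k * flat k.+1. *)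
Definition flat (k : nat) (t : R) : R :=
  if 0 < t then t^-1 ^+ k * expR (- t^-1) else 0.

Lemma flat_ge0 k t : 0 <= flat k t.
Proof.
by rewrite /flat; case: ifPn => // t0; rewrite mulr_ge0 ?expR_ge0// exprn_ge0// invr_ge0 ltW.
Qed.

Lemma flat_gt0 k t : 0 < t -> 0 < flat k t.
Proof. by move=> t0; rewrite /flat t0 mulr_gt0 ?expR_gt0// exprn_gt0// invr_gt0. Qed.

Lemma flat_le1 t : flat 0 t <= 1.
Proof.
rewrite /flat; case: ifPn => // t0; rewrite expr0 mul1r -expR0 ler_expR.
by rewrite oppr_le0 invr_ge0 ltW.
Qed.

(** With u = 1/t this is the Taylor term u^(k+2)/(k+2)! <= exp u. The two extra powers of u leave a
    factor t^2, which makes the derivative at 0 vanish. *)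
Lemma flat_small k t : flat k t <= (k.+2)`!%:R * t ^+ 2.
Proof.
rewrite /flat; case: ifPn => [t0|_]; last by rewrite mulr_ge0// sqr_ge0.
have u0 : 0 < t^-1 by rewrite invr_gt0.
have F0 : (0:R) < (k.+2)`!%:R by rewrite ltr0n fact_gt0.
have H : t^-1 ^+ k.+2 <= (k.+2)`!%:R * expR t^-1.
  rewrite mulrC -ler_pdivrMr//; apply: le_trans (expR_ge1Dxn k.+1 (ltW u0)).
  by rewrite lerDr.
have -> : t^-1 ^+ k * expR (- t^-1) = t^-1 ^+ k.+2 * expR (- t^-1) * t ^+ 2.
  rewrite !exprS; move: (t^-1 ^+ k) (expR _) => a b; field.
  by rewrite gt_eqF.
rewrite ler_wpM2r ?sqr_ge0// expRN -ler_pdivlMr ?invr_gt0 ?expR_gt0//.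
by rewrite invrK.
Qed.

Lemma is_derive0_of_sqr_bound (f : R -> R) (C : R) :
  (forall h, `|f h| <= C * h ^+ 2) -> is_derive (0 : R) (1 : R) f (0 : R).
Proof.
move=> fC; have f0 : f 0 = 0.
  by apply/eqP; rewrite -normr_le0 (le_trans (fC 0))// expr0n/= mulr0.
have C0 : 0 <= C.
  by have := fC 1; rewrite expr1n mulr1; apply: le_trans.
have H : h^-1 *: ((f \o shift 0) (h *: (1 : R)) - f 0) @[h --> (0 : R)^'] --> (0 : R).
  apply/cvgrPdist_le => e e0; near=> h.
  have h0 : h != 0 by near: h; exact: nbhs_dnbhs_neq.
  rewrite sub0r normrN /= f0 subr0 addr0 /GRing.scale/= mulr1 normrM normfV.
  rewrite ler_pdivrMl ?normr_gt0//; apply: le_trans (fC _) _.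
  rewrite -real_normK ?num_real// expr2 mulrA mulrC ler_wpM2l//.
  have : `|h| <= e / (C + 1).
    by near: h; apply: dnbhs0_le; rewrite divr_gt0// ltr_wpDl.
  rewrite ler_pdivlMr ?ltr_wpDl//; apply: le_trans.
  by rewrite mulrC ler_wpM2l// lerDl.
by apply: DeriveDef; [apply/cvg_ex; exists 0|exact: cvg_lim].
Unshelve. all: by end_near. Qed.

Lemma is_deriveMR (f g : R -> R) (x df dg : R) :
  is_derive x (1 : R) f df -> is_derive x (1 : R) g dg ->
  is_derive x (1 : R) (fun u : R => f u * g u) (f x * dg + g x * df).
Proof.
move=> [dF <-] [dG <-]; apply: DeriveDef.
  exact: (@derivableM _ _ f g).
exact: (@deriveM _ _ f g).
Qed.

Lemma flat_is_derive k t :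
  is_derive t (1 : R) (flat k) (- k%:R * flat k.+1 t + flat k.+2 t).
Proof.
have [t0|t0|->] := ltgtP t 0.
- apply: (@near_eq_is_derive R R R (cst 0)).
  + near=> u; rewrite /flat ifF//; apply/negbTE; rewrite -leNgt ltW//.
    by near: u; exact: lt_nbhsl.
  + apply: is_derive_eq.
    by rewrite /flat ltNge (ltW t0)/= mulr0 addr0.
- apply: (@near_eq_is_derive R R R (fun u : R => u^-1 ^+ k * expR (- u^-1))).
  + near=> u; rewrite /flat ifT//.
    by near: u; exact: lt_nbhsr.
  + have dV : is_derive t (1 : R) (fun u : R => u^-1) (- t ^- 2).
      apply: is_derive_eq; first by apply: (@is_deriveV _ id); rewrite gt_eqF.
      by rewrite /GRing.scale/= mulr1.
    have dX : is_derive t (1 : R) (fun u : R => u^-1 ^+ k)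
        (k%:R * t^-1 ^+ k.-1 * - t ^- 2).
      rewrite (_ : (fun u : R => u^-1 ^+ k) = (fun u : R => u^-1) ^+ k).
        exact: is_derive_eq.
      by rewrite exprfctE.
    have dE : is_derive t (1 : R) (fun u : R => expR (- u^-1)) (t ^- 2 * expR (- t^-1)).
      have dN : is_derive t (1 : R) (fun u : R => - u^-1) (t ^- 2).
        by apply: (is_derive_eq (is_deriveN dV)); rewrite opprK.
      have := @is_derive1_comp _ expR (fun u : R => - u^-1) t _ _ (is_derive_expR _) dN.
      by rewrite mulrC.
    apply: (is_derive_eq (is_deriveMR dX dE)).
    rewrite /flat t0.
    case: k dX => [|k] _; first by move: (expR _) => a; rewrite /=; field; rewrite gt_eqF.
    rewrite /= !exprS; move: (t^-1 ^+ k) (expR _) => a b; field.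
    by rewrite gt_eqF.
- rewrite /flat ltxx mulr0 addr0.
  apply: (@is_derive0_of_sqr_bound _ (k.+2)`!%:R) => h.
  by rewrite ger0_norm ?flat_ge0// flat_small.
Unshelve. all: by end_near. Qed.

End Bump.

Section BumpSmooth.
Context {R : realType} {V : normedModType R}.

Lemma flat_differentiable k (t : R) : differentiable (flat k) t.
Proof. by apply/derivable1_diffP; have [] := flat_is_derive k t. Qed.

Lemma derive_flat_compE k (f : V -> R) v : (forall x, differentiable f x) ->
  'D_v (fun x => flat k (f x)) =
  fun x => (- k%:R * flat k.+1 (f x) + flat k.+2 (f x)) * 'D_v f x.
Proof.
move=> df; apply/funext => x.
rewrite deriveE; last by apply: (@differentiable_comp _ _ _ _ f (flat k)) => //; exact: flat_differentiable.
rewrite (@diff_comp _ _ _ _ f (flat k))//; last exact: flat_differentiable.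
rewrite /= (diff1E (flat_differentiable _ _)) -deriveE// derive1E mulrC.
by have [_ ->] := flat_is_derive k (f x).
Qed.

Lemma smooth_flat_comp k (f : V -> R) : smooth f -> smooth (fun x => flat k (f x)).
Proof.
move=> /smooth_uptoP sf; apply/smooth_uptoP => n.
have df x : differentiable f x by apply: smooth_upto_diff (sf 0%N).
have dk l x : differentiable (fun x => flat l (f x)) x.
  by apply: (@differentiable_comp _ _ _ _ f (flat l)) => //; exact: flat_differentiable.
elim: n k => [|n IH] k; first by apply/smooth_upto0 => x; exact: dk.
apply/smooth_uptoS; split=> // v; rewrite derive_flat_compE//.
apply: smooth_uptoM; last by have /smooth_uptoS[] := sf n.+1.
by apply: smooth_uptoD => //; apply: smooth_uptoM => //; exact: smooth_upto_cst.
Qed.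

End BumpSmooth.

(** * Test functions on the plane *)

Section Plane.
Context {R : realType}.
Local Notation T1 := (measurableTypeR R).
Local Notation T2 := (T1 * T1)%type.
Implicit Types f g u : R * R -> R.

(** The norm of the product is the sup norm: balls are open squares, and integrals over them split
    into integrals over intervals. *)
Lemma ballN2P n (x : R * R) : ballN2 n x <-> `|x.1| < n%:R /\ `|x.2| < n%:R.
Proof.
rewrite /ballN2; split.
  by move=> [/=]; rewrite /ball/= !sub0r !normrN.
by move=> [? ?]; split; rewrite /ball/= sub0r normrN.
Qed.

Lemma ballN2W m n (x : R * R) : (m <= n)%N -> ballN2 m x -> ballN2 n x.
Proof.
move=> mn /ballN2P[x1 x2]; apply/ballN2P.
by split; apply: lt_le_trans; eassumption || rewrite ler_nat.
Qed.

Lemma measurable_box (n : nat) : measurable (ballN2 n : set T2).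
Proof.
rewrite (_ : ballN2 n = (ball (0:R) n%:R) `*` (ball (0:R) n%:R)).
  by apply: measurableX; apply: open_measurable; exact: ball_open.
by apply/seteqP; split=> x; [move=> [? ?]; split|move=> [? ?]; split].
Qed.

(** Supports are recorded by integer boxes, without closures: the boxes combine by [maxn] under sums
    and by addition under convolution. *)
Definition supp_in n (f : R * R -> R) := forall x, f x != 0 -> ballN2 n x.

Lemma supp_inW m n f : (m <= n)%N -> supp_in m f -> supp_in n f.
Proof.
move=> mn sf x /sf /ballN2P[x1 x2]; apply/ballN2P.
by split; apply: lt_le_trans; eassumption || rewrite ler_nat.
Qed.

Lemma supp_in0 n f x : supp_in n f -> ~ ballN2 n x -> f x = 0.
Proof. by move=> sf nx; apply/eqP; apply: contra_notT nx => /sf. Qed.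

Lemma compact_closed_box (r : R) :
  compact (`[- r, r]%classic `*` `[- r, r]%classic : set (R * R)).
Proof. by apply: compact_setX; exact: segment_compact. Qed.

Lemma compact_supportP f : compact_support f <-> exists n, supp_in n f.
Proof.
split=> [cf|[n sf]].
  have [M [Mr MB]] := compact_bounded cf.
  have [n Mn] : exists n : nat, `|M| + 1 < n%:R.
    by exists (Num.trunc (`|M| + 1)).+1; rewrite truncnS_gt.
  exists n => x fx.
  have : `|x| <= `|M| + 1.
    apply: MB; first by rewrite (le_lt_trans (ler_norm _))// ltrDl.
    exact: subset_closure.
  by rewrite prod_normE ge_max => /andP[x1 x2]; apply/ballN2P; split;
    exact: le_lt_trans Mn.
rewrite /compact_support; have cc := @closed_closure _ [set x : R * R | f x != 0].
apply: (subclosed_compact cc (@compact_closed_box n%:R)).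
have -> : `[- n%:R, n%:R]%classic `*` `[- n%:R, n%:R]%classic =
    closure (`[- n%:R, n%:R]%classic `*` `[- n%:R, n%:R]%classic : set (R * R)).
  apply/closure_id; apply: compact_closed; last exact: compact_closed_box.
  exact: norm_hausdorff.
apply: closure_subset => x /= /sf /ballN2P[x1 x2].
by split; rewrite /= in_itv/= -ler_norml ltW.
Qed.

(** The product sigma-algebra is generated by rectangles, so an open set of the plane has to be
    exhibited as a countable union of squares with rational centre and radius. *)
Lemma continuous_measurable2 f : continuous f -> measurable_fun (setT : set T2) (f : T2 -> R).
Proof.
move=> cf; apply: (measurability (@RGenOInfty.G R)).
  exact: RGenOInfty.measurableE.
move=> _ [_ [r ->] <-]; rewrite setTI.
set U := f @^-1` _.
have oU : open U by apply: open_comp => //; exact: interval_open.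
pose B (a b c : rat) : set (R * R) :=
  ball (ratr a : R) (ratr c : R) `*` ball (ratr b : R) (ratr c : R).
have -> : U = \bigcup_a \bigcup_b \bigcup_c
    (if `[< B a b c `<=` U >] then B a b c else set0).
  apply/seteqP; split=> [x Ux|x [a _ [b _ [c _]]]]; last first.
    by case: asboolP => // h /h.
  have /nbhs_ballP[e /= e0 eU] : nbhs x U by exact: open_nbhs_nbhs.
  (* The centre of the square is within [c] of [x], so every point of the square is within [2 c < e]
     of [x]. *)
  have e20 : 0 < e / 2 by rewrite divr_gt0.
  have [c] := rat_in_itvoo e20; rewrite in_itv/= => /andP[c0 ce].
  have xl (y : R) : y - ratr c < y + ratr c by rewrite ltrD2l; lra.
  have [a] := rat_in_itvoo (xl x.1); rewrite in_itv/= => /andP[a1 a2].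
  have [b] := rat_in_itvoo (xl x.2); rewrite in_itv/= => /andP[b1 b2].
  exists a => //; exists b => //; exists c => //.
  rewrite ifT.
    by split; rewrite /ball/= ltr_norml; lra.
  apply/asboolP => y [/= y1 y2]; apply: eU.
  by move: y1 y2; rewrite /ball/= !ltr_norml => ? ?; split; rewrite /ball/= ltr_norml; lra.
apply: bigcupT_measurable_rat => a; apply: bigcupT_measurable_rat => b.
apply: bigcupT_measurable_rat => c; case: ifP => // _.
by apply: measurableX; apply: open_measurable; exact: ball_open.
Qed.

Lemma test2P f : test2 (f : T2 -> R) <-> smooth f /\ exists n, supp_in n f.
Proof. by split=> -[? /compact_supportP]. Qed.

Lemma test2_smooth f : test2 (f : T2 -> R) -> smooth f.
Proof. by move=> []. Qed.

Lemma test2_mul f u : test2 (f : T2 -> R) -> smooth u ->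
  test2 (fun x : T2 => f x * u x).
Proof.
move=> /test2P[sf [n nf]] su; apply/test2P; split; first exact: smoothM.
by exists n => x; rewrite mulf_eq0 negb_or => /andP[/nf].
Qed.

Lemma test2_add f g : test2 (f : T2 -> R) -> test2 (g : T2 -> R) ->
  test2 (fun x : T2 => f x + g x).
Proof.
move=> /test2P[sf [n nf]] /test2P[sg [m mg]]; apply/test2P; split.
  exact: smoothD.
exists (maxn n m) => x.
have [f0|/nf fx _] := eqVneq (f x) 0.
  rewrite f0 add0r; exact: (supp_inW (leq_maxr n m) mg).
move: fx => /ballN2P[x1 x2]; apply/ballN2P.
by split; apply: lt_le_trans; eassumption || rewrite ler_nat leq_maxl.
Qed.

Lemma test2_scale k f : test2 (f : T2 -> R) -> test2 (fun x : T2 => k * f x).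
Proof.
move=> /test2P[sf [n nf]]; apply/test2P; split; first exact: smoothZ.
by exists n => x; rewrite mulf_eq0 negb_or => /andP[_ /nf].
Qed.

Lemma derivative_out n f v x : supp_in n f -> n%:R < `|x| -> 'D_v f x = 0.
Proof.
move=> nf nx; rewrite (@near_eq_derive _ _ _ f (cst 0)); first exact: derive_cst.
near=> y; apply: (supp_in0 nf) => /ballN2P[y1 y2].
have : n%:R < `|y|.
  by near: y; exact: (cvgr_gt `|x| (@norm_continuous _ _ x)).
by rewrite prod_normE lt_max => /orP[]; rewrite ltNge ltW.
Unshelve. all: by end_near. Qed.

Lemma test2_derive v f : test2 (f : T2 -> R) -> test2 ('D_v f : T2 -> R).
Proof.
move=> /test2P[sf [n nf]]; apply/test2P; split; first exact: smooth_derive.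
(* [derivative_out] controls only the exterior of the closed box of radius [n], and [ballN2] is
   open: hence [n.+1]. *)
exists n.+1 => x fx; apply/ballN2P.
suff : `|x| <= n%:R.
  rewrite prod_normE ge_max => /andP[x1 x2].
  by split; apply: le_lt_trans; eassumption || rewrite ltr_nat.
by rewrite leNgt; apply: contra_neqN fx => /derivative_out; exact.
Qed.

Lemma test2_bounded f : test2 (f : T2 -> R) -> exists B, forall x, `|f x| <= B.
Proof.
move=> /test2P[sf [n nf]].
pose K : set (R * R) := `[- n%:R, n%:R]%classic `*` `[- n%:R, n%:R]%classic.
have cK : compact ((fun x => `|f x|) @` K).
  apply: continuous_compact; last exact: compact_closed_box.
  apply: continuous_subspaceT => x; apply: cvg_norm.
  exact: smooth_continuous sf x.
have [M [Mr MB]] := compact_bounded cK.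
exists (`|M| + 1) => x.
have [fx0|/nf /ballN2P[x1 x2]] := eqVneq (f x) 0.
  by rewrite fx0 normr0 addr_ge0.
rewrite -(normr_id (f x)); apply: MB.
  by rewrite (le_lt_trans (ler_norm _))// ltrDl.
by exists x => //; split; rewrite /= in_itv/= -ler_norml ltW.
Qed.

Lemma derive_partials f x v : differentiable f x ->
  'D_v f x = v.1 * 'D_e1 f x + v.2 * 'D_e2 f x.
Proof.
move=> df; rewrite !deriveE//.
have -> : 'd f x v = 'd f x (v.1 *: e1 + v.2 *: e2).
  congr ('d f x _); rewrite /e1 /e2; case: v => a b /=.
  by apply: injective_projections; rewrite /= /GRing.scale/= !mulr1 !mulr0 ?addr0 ?add0r.
by rewrite linearD !linearZ.
Qed.

Lemma is_derive_line f x z (t : R) : (forall y, differentiable f y) ->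
  is_derive t (1 : R) (fun s : R => f (s *: z + x)) ('D_z f (t *: z + x)).
Proof.
move=> df; pose h := fun t : R => t *: z + x.
have [dht ht] : is_diff t h (fun s => s *: z).
  have -> : h = ( *:%R ^~ z) + cst x by [].
  apply: (is_diff_eq (is_diffD _ _)).
  exact: addr0.
apply: DeriveDef.
  by apply: diff_derivable; exact: (@differentiable_comp _ _ _ _ h f).
rewrite deriveE; last exact: (@differentiable_comp _ _ _ _ h f).
by rewrite (@diff_comp _ _ _ _ h f)//= ht scale1r deriveE.
Qed.

Lemma mean_value2 f x z : (forall y, differentiable f y) ->
  exists c : R, 0 <= c <= 1 /\ f (z + x) - f x =
    z.1 * 'D_e1 f (c *: z + x) + z.2 * 'D_e2 f (c *: z + x).
Proof.
move=> df; have dphi (t : R) := is_derive_line x z t df.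
have [|c c01 H] := @MVT_segment R _ (fun t => 'D_z f (t *: z + x)) 0 1 ler01
   (fun t _ => dphi t).
  apply: continuous_subspaceT => t; apply: differentiable_continuous.
  by apply/derivable1_diffP; have [] := dphi t.
by exists c; split=> //; move: H; rewrite /= scale1r scale0r add0r subr0 mulr1 derive_partials.
Qed.

(** The l1 norm is what bounds on the two partial derivatives produce; [l1_le] compares it with the
    sup norm. *)
Definition l1 (z : R * R) : R := `|z.1| + `|z.2|.

Lemma lipschitz2 f B : (forall y, differentiable f y) ->
  (forall y, `|'D_e1 f y| <= B) -> (forall y, `|'D_e2 f y| <= B) ->
  forall x z, `|f (z + x) - f x| <= B * l1 z.
Proof.
move=> df B1 B2 x z; have [c [_ ->]] := mean_value2 x z df.
apply: (le_trans (ler_normD _ _)); rewrite !normrM /l1 mulrDr ![B * _]mulrC.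
by apply: lerD; rewrite ler_wpM2l.
Qed.

(** The mean value theorem for [f], then the Lipschitz bound for its partial derivatives at the
    intermediate point; this gives [B] instead of the sharp [B / 2]. *)
Lemma taylor2 f B : smooth f -> 0 <= B ->
  (forall v w y, v = e1 \/ v = e2 -> w = e1 \/ w = e2 -> `|'D_v ('D_w f) y| <= B) ->
  forall x z,
  `|f (z + x) - f x - (z.1 * 'D_e1 f x + z.2 * 'D_e2 f x)| <= B * l1 z ^+ 2.
Proof.
move=> sf B0 fB x z.
have df y : differentiable f y by exact: smooth_diff.
have [c [c01 ->]] := mean_value2 x z df.
have L w : w = e1 \/ w = e2 -> `|'D_w f (c *: z + x) - 'D_w f x| <= B * l1 z.
  move=> we.
  have dw y : differentiable ('D_w f) y by apply: smooth_diff; exact: smooth_derive.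
  have w1 y : `|'D_e1 ('D_w f) y| <= B by apply: fB => //; left.
  have w2 y : `|'D_e2 ('D_w f) y| <= B by apply: fB => //; right.
  apply: le_trans (lipschitz2 dw w1 w2 x (c *: z)) _.
  move: c01 => /andP[c0 c1]; rewrite ler_wpM2l// /l1 /= !normrM (ger0_norm c0).
    by apply: lerD; rewrite ler_piMl.
rewrite (_ : _ - _ = z.1 * ('D_e1 f (c *: z + x) - 'D_e1 f x)
  + z.2 * ('D_e2 f (c *: z + x) - 'D_e2 f x)); last by rewrite !mulrBr opprD addrACA.
apply: (le_trans (ler_normD _ _)); rewrite !normrM.
rewrite [leRHS](_ : _ = `|z.1| * (B * l1 z) + `|z.2| * (B * l1 z)); last first.
  by rewrite /l1; ring.
by apply: lerD; rewrite ler_wpM2l//; apply: L; [left|right].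
Qed.

(** The constant does not depend on [x]; this is what allows a convolution to be differentiated
    under the integral by a direct estimate. *)
Lemma test2_taylor f : test2 (f : T2 -> R) -> exists B, forall x z,
  `|f (z + x) - f x - (z.1 * 'D_e1 f x + z.2 * 'D_e2 f x)| <= B * l1 z ^+ 2.
Proof.
move=> tf.
have [B11 h11] := test2_bounded (test2_derive e1 (test2_derive e1 tf)).
have [B12 h12] := test2_bounded (test2_derive e1 (test2_derive e2 tf)).
have [B21 h21] := test2_bounded (test2_derive e2 (test2_derive e1 tf)).
have [B22 h22] := test2_bounded (test2_derive e2 (test2_derive e2 tf)).
have B11p : 0 <= B11 by exact: le_trans (h11 0).
have B12p : 0 <= B12 by exact: le_trans (h12 0).
have B21p : 0 <= B21 by exact: le_trans (h21 0).
have B22p : 0 <= B22 by exact: le_trans (h22 0).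
exists (B11 + B12 + B21 + B22); apply: taylor2; first exact: test2_smooth.
  by lra.
move=> v w y [->|->] [->|->].
- by apply: le_trans (h11 y) _; lra.
- by apply: le_trans (h12 y) _; lra.
- by apply: le_trans (h21 y) _; lra.
- by apply: le_trans (h22 y) _; lra.
Qed.

End Plane.

(** * Locally square integrable functions *)

Section LocallySquareIntegrable.
Context {R : realType} {d : measure_display} {T : measurableType d}.
Variables (mu : {measure set T -> \bar R}) (K : nat -> set T).
Hypothesis mK : forall n, measurable (K n).
Implicit Types f g h : T -> R.

Lemma Lploc2D f g : Lploc mu K 2 f -> Lploc mu K 2 g ->
  Lploc mu K 2 (fun x => f x + g x).
Proof.
move=> [mf Lf] [mg Lg].
have mfg : measurable_fun setT (fun x => f x + g x) by exact: measurable_funD.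
split=> // n.
have i2 := integrableD (mK n) (Lf n) (Lg n).
have i3 := integrableZl (mK n) 2 i2.
apply: le_integrable i3; first exact: mK.
  apply/measurable_EFinP; apply: measurable_funX; apply: measurableT_comp => //.
  exact: measurable_funS mfg.
move=> x _; rewrite /= lee_fin ger0_norm ?exprn_ge0// [leRHS]ger0_norm; last first.
  by rewrite mulr_ge0// addr_ge0// exprn_ge0.
rewrite !real_normK ?num_real//.
by have := sqr_ge0 (f x - g x); nra.
Qed.

Lemma Lploc2M f g B : Lploc mu K 2 f -> measurable_fun setT g ->
  (forall x, `|g x| <= B) -> Lploc mu K 2 (fun x => f x * g x).
Proof.
move=> [mf Lf] mg gB.
have mfg : measurable_fun setT (fun x => f x * g x) by exact: measurable_funM.
split=> // n.
have i3 := integrableZl (mK n) (B ^+ 2) (Lf n).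
apply: le_integrable i3; first exact: mK.
  apply/measurable_EFinP; apply: measurable_funX; apply: measurableT_comp => //.
  exact: measurable_funS mfg.
move=> x _; rewrite /= lee_fin.
have B0 : 0 <= B by exact: le_trans (gB x).
rewrite ger0_norm ?exprn_ge0// [leRHS]ger0_norm ?mulr_ge0 ?exprn_ge0//.
by rewrite normrM exprMn mulrC ler_wpM2r ?exprn_ge0// lerXn2r ?nnegrE.
Qed.

Lemma Lploc2N f : Lploc mu K 2 f -> Lploc mu K 2 (fun x => - f x).
Proof.
move=> Lf; have := @Lploc2M f (fun=> -1) `|-1| Lf (measurable_cst _) (fun=> lexx _).
by under eq_fun do rewrite mulrN1.
Qed.

Hypothesis Koo : forall n, (mu (K n) < +oo)%E.

Lemma Lploc2_cst (c : R) : Lploc mu K 2 (fun=> c).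
Proof.
split; first exact: measurable_cst.
move=> n; apply/integrableP; split; first exact: measurable_cst.
rewrite integral_cst//=.
by rewrite lte_mul_pinfty// ge0_fin_numE// Koo.
Qed.

(** The elementary bound [|f| <= 1 + |f|^2] stands in for Cauchy-Schwarz, since [K n] has finite
    measure. It is stated for general [mu] and [K] to serve both the plane and the line. *)
Lemma integrable_Lploc2M f h n B : Lploc mu K 2 f -> measurable_fun setT h ->
  (forall x, `|h x| <= B) -> (forall x, h x != 0 -> K n x) ->
  mu.-integrable setT (EFin \o (fun x => f x * h x)).
Proof.
move=> [mf Lf] mh hB nh.
have mfh : measurable_fun setT (fun x => f x * h x) by exact: measurable_funM.
have i1 : mu.-integrable (K n) (EFin \o (fun=> 1)).
  have [_ /(_ n)] := Lploc2_cst 1; apply: eq_integrable => //= x _.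
  by rewrite normr1 expr1n.
have i3 := integrableZl (mK n) `|B| (integrableD (mK n) i1 (Lf n)).
have i4 : mu.-integrable (K n) (EFin \o (fun x => f x * h x)).
  apply: le_integrable i3; first exact: mK.
    by apply/measurable_EFinP; exact: measurable_funS mfh.
  move=> x _; rewrite /= lee_fin normrM mulrC [leRHS]ger0_norm; last first.
    by rewrite mulr_ge0// addr_ge0// exprn_ge0.
  apply: ler_pM => //; first exact: le_trans (hB x) (ler_norm _).
  have := sqr_ge0 (`|f x| - 1); rewrite sqrrB; set a := `|f x|.
  have : 0 <= a by exact: normr_ge0.
  by nra.
have /integrable_mkcond := i4.
move=> /(_ (mK n)); apply: eq_integrable => //= x _.
rewrite /patch; case: ifPn => // /negP nx; have [->|/nh hx] := eqVneq (h x) 0.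
  by rewrite mulr0.
by case: nx; exact: mem_set.
Qed.

End LocallySquareIntegrable.

(** * Lebesgue measure on the plane *)

Section PlaneMeasure.
Context {R : realType}.
Local Notation T1 := (measurableTypeR R).
Local Notation T2 := (T1 * T1)%type.

HB.instance Definition _ := Measure.on (@leb2 R).

(** Required by Fubini on [T2 * T2] with [leb2] on each factor, as in [conv_adjoint]. *)
Lemma leb2_sigma_finite : sigma_finite setT (@leb2 R).
Proof.
have /sigma_finiteP[F [TF ndF Foo]] := @sigma_finiteT _ _ _ (@lebesgue_measure R).
exists (fun n => F n `*` F n).
 rewrite -setXTT TF predeqE => -[x y]; split.
    move=> [/= [n _ Fnx] [k _ Gky]]; exists (maxn n k) => //; split.
    - by move: x Fnx; exact/subsetPset/ndF/leq_maxl.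
    - by move: y Gky; exact/subsetPset/ndF/leq_maxr.
  by move=> [n _ []/= ? ?]; split; exists n.
move=> k; have [? ?] := Foo k.
split; first exact: measurableX.
by rewrite /leb2 product_measure1E// lte_mul_pinfty// ge0_fin_numE.
Qed.

HB.instance Definition _ :=
  Measure_isSigmaFinite.Build _ _ _ (@leb2 R) leb2_sigma_finite.

Lemma leb2_box n : (leb2 (ballN2 n : set T2) < +oo)%E.
Proof.
rewrite (_ : ballN2 n = (ball (0:R) n%:R) `*` (ball (0:R) n%:R)); last first.
  by apply/seteqP; split=> x; [move=> [? ?]; split|move=> [? ?]; split].
have mb : measurable (ball (0:R) n%:R : set T1).
  by apply: open_measurable; exact: ball_open.
have -> : leb2 (ball (0:R) n%:R `*` ball (0:R) n%:R) =
    (lebesgue_measure (ball 0%R n%:R) * lebesgue_measure (ball 0%R n%:R))%E.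
  exact: product_measure1E.
have -> : lebesgue_measure (ball (0:R) n%:R) = (n%:R *+ 2)%:E.
  exact: lebesgue_measure_ball.
by rewrite -EFinM ltry.
Qed.

End PlaneMeasure.

(** * Bounded functions with compact support *)

Section Bcs.
Context {R : realType}.
Local Notation T1 := (measurableTypeR R).
Local Notation T2 := (T1 * T1)%type.
Local Notation itg f := (leb2.-integrable setT (EFin \o (f : T2 -> R))).
Implicit Types (f g h : T2 -> R).

Definition bdd f := measurable_fun setT f /\ exists B, forall x, `|f x| <= B.

(** This class contains the test functions and the indicators of boxes, is closed under the
    operations used below, and its members are integrable even against an L2loc weight ([itg_loc2]).
    Integrability conditions thus reduce to membership. *)
Definition bcs f := bdd f /\ exists n, supp_in n f.

Definition loc2 f := Lploc leb2 ballN2 2 f.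

Lemma loc2_cst (c : R) : loc2 (fun=> c).
Proof. exact: (Lploc2_cst measurable_box (@leb2_box R)). Qed.

Lemma itg_loc2 f h : loc2 f -> bcs h -> itg (fun x => f x * h x).
Proof.
move=> Lf [[mh [B hB]] [n nh]].
exact: (integrable_Lploc2M measurable_box (@leb2_box R) Lf mh hB nh).
Qed.

Lemma itg_bcs h : bcs h -> itg h.
Proof.
move=> bh; have := itg_loc2 (loc2_cst 1) bh.
by apply: eq_integrable => //= x _; rewrite mul1r.
Qed.

Lemma bddD f g : bdd f -> bdd g -> bdd (fun x => f x + g x).
Proof.
move=> [mf [A fA]] [mg [B gB]]; split; first exact: measurable_funD.
by exists (A + B) => x; apply: le_trans (ler_normD _ _) _; exact: lerD.
Qed.

Lemma bddM f g : bdd f -> bdd g -> bdd (fun x => f x * g x).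
Proof.
move=> [mf [A fA]] [mg [B gB]]; split; first exact: measurable_funM.
by exists (A * B) => x; rewrite normrM; exact: ler_pM.
Qed.

Lemma bdd_cst (c : R) : bdd (fun=> c).
Proof. by split; [exact: measurable_cst|exists `|c|]. Qed.

Lemma bddN f : bdd f -> bdd (fun x => - f x).
Proof.
move=> [mf [A fA]]; split; first exact: measurableT_comp.
by exists A => x; rewrite normrN.
Qed.

Lemma bddB f g : bdd f -> bdd g -> bdd (fun x => f x - g x).
Proof. by move=> bf bg; apply: bddD => //; exact: bddN. Qed.

Lemma bcs_bdd f : bcs f -> bdd f. Proof. by case. Qed.

Lemma bcsMl f g : bcs f -> bdd g -> bcs (fun x => f x * g x).
Proof.
move=> [bf [n nf]] bg; split; first exact: bddM.
by exists n => x; rewrite mulf_eq0 negb_or => /andP[/nf].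
Qed.

Lemma bcsMr f g : bdd f -> bcs g -> bcs (fun x => f x * g x).
Proof.
move=> bf [bg [n ng]]; split; first exact: bddM.
by exists n => x; rewrite mulf_eq0 negb_or => /andP[_ /ng].
Qed.

Lemma bcsD f g : bcs f -> bcs g -> bcs (fun x => f x + g x).
Proof.
move=> [bf [n nf]] [bg [m mg]]; split; first exact: bddD.
exists (maxn n m) => x; have [f0|fx _] := eqVneq (f x) 0.
  by rewrite f0 add0r; exact: (supp_inW (leq_maxr n m) mg).
exact: (supp_inW (leq_maxl n m) nf).
Qed.

Lemma bcsN f : bcs f -> bcs (fun x => - f x).
Proof.
move=> [bf [n nf]]; split; first exact: bddN.
by exists n => x; rewrite oppr_eq0; exact: nf.
Qed.

Lemma bcsB f g : bcs f -> bcs g -> bcs (fun x => f x - g x).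
Proof. by move=> bf bg; apply: bcsD => //; exact: bcsN. Qed.

Lemma bdd_sqr f : bdd f -> bdd (fun x => f x ^+ 2).
Proof. exact: (fun b => bddM b b). Qed.

Lemma bcs_sqr f : bcs f -> bcs (fun x => f x ^+ 2).
Proof. by move=> b; apply: (bcsMl b); exact: bcs_bdd. Qed.

Lemma test2_bcs f : test2 f -> bcs f.
Proof.
move=> tf; have [sf sn] := (iffLR (test2P f)) tf; split => //; split.
  by apply: continuous_measurable2; exact: smooth_continuous.
exact: test2_bounded.
Qed.

Lemma bcs_norm f : bcs f -> bcs (fun x => `|f x|).
Proof.
move=> [[mf [B fB]] [n nf]]; split; last first.
  by exists n => x; rewrite normr_eq0; exact: nf.
split; first exact: measurableT_comp.
by exists B => x; rewrite normr_id.
Qed.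

Lemma bcs_indic n : bcs (\1_(ballN2 n : set T2) : T2 -> R).
Proof.
split; last first.
  by exists n => x; rewrite indicE pnatr_eq0 eqb0 negbK => /set_mem.
split; first by apply: measurable_indic; exact: measurable_box.
by exists 1 => x; rewrite indicE normr_nat; case: (_ \in _).
Qed.

Lemma loc2D f g : loc2 f -> loc2 g -> loc2 (fun x => f x + g x).
Proof. exact: (Lploc2D measurable_box). Qed.

Lemma loc2M f g : loc2 f -> bdd g -> loc2 (fun x => f x * g x).
Proof. by move=> Lf [mg [B gB]]; exact: (Lploc2M measurable_box Lf mg gB). Qed.

Lemma loc2N f : loc2 f -> loc2 (fun x => - f x).
Proof. exact: (Lploc2N measurable_box). Qed.

End Bcs.

(** * Real integrals over the plane and Green's formula *)

Section PlaneIntegral.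
#[local] Opaque derive.
Context {R : realType}.
Local Notation T1 := (measurableTypeR R).
Local Notation T2 := (T1 * T1)%type.
Local Notation itg f := (leb2.-integrable setT (EFin \o (f : T2 -> R))).
Implicit Types (f g h : T2 -> R).

Definition int2 f : R := \int[leb2]_x f x.

Lemma int2E f : itg f -> (\int[leb2]_x (f x)%:E)%E = (int2 f)%:E.
Proof. by move=> fi; rewrite /int2 /Rintegral fineK//; exact: integrable_fin_num. Qed.

Lemma eq_int2 f g : f =1 g -> int2 f = int2 g.
Proof. by move=> fg; congr int2; exact/funext. Qed.

Lemma int2D f g : itg f -> itg g -> int2 (fun x => f x + g x) = int2 f + int2 g.
Proof. by move=> fi gi; exact: RintegralD. Qed.

Lemma int2B f g : itg f -> itg g -> int2 (fun x => f x - g x) = int2 f - int2 g.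
Proof. by move=> fi gi; exact: RintegralB. Qed.

Lemma int2Z c f : itg f -> int2 (fun x => c * f x) = c * int2 f.
Proof. by move=> fi; exact: RintegralZl. Qed.

Lemma int2N f : itg f -> int2 (fun x => - f x) = - int2 f.
Proof.
by move=> fi; rewrite -mulN1r -int2Z//; apply: eq_int2 => x; rewrite mulN1r.
Qed.

Lemma le_int2 f g : itg f -> itg g -> (forall x, f x <= g x) -> int2 f <= int2 g.
Proof. by move=> fi gi fg; apply: le_Rintegral. Qed.

Lemma int2_ge0 f : (forall x, 0 <= f x) -> 0 <= int2 f.
Proof. by move=> f0; apply: Rintegral_ge0. Qed.

Lemma le_norm_int2 f : itg f -> `|int2 f| <= int2 (fun x => `|f x|).
Proof. by move=> fi; exact: le_normr_Rintegral. Qed.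

Lemma int2_indic n : int2 \1_(ballN2 n : set T2) = fine (leb2 (ballN2 n : set T2)).
Proof.
rewrite /int2 /Rintegral integral_indic//; last exact: measurable_box.
by rewrite setIT.
Qed.

Lemma integral_derive_eq0 (f df : R -> R) (r : R) : 0 < r ->
  (forall x, is_derive x (1 : R) f (df x)) -> continuous df ->
  (forall x, r <= `|x| -> f x = 0 /\ df x = 0) ->
  (\int[lebesgue_measure]_x (df x)%:E = 0)%E.
Proof.
move=> r0 fdf cdf f0.
have cf : continuous f.
  move=> x; apply: differentiable_continuous; apply/derivable1_diffP.
  by have [] := fdf x.
transitivity (\int[lebesgue_measure]_(x in `[(- r)%R, r]) (df x)%:E)%E.
  rewrite [RHS]integral_mkcond; apply: eq_integral => x _.
  rewrite /patch; case: ifPn => //; rewrite notin_setE/= in_itv/= -ler_norml => /negP.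
  by rewrite -ltNge => /ltW /f0[_ ->].
rewrite (@continuous_FTC2 _ df f).
- have [-> _] : f r = 0 /\ df r = 0 by apply: f0; exact: ler_norm.
  have [-> _] : f (- r) = 0 /\ df (- r) = 0 by apply: f0; rewrite normrN; exact: ler_norm.
  by rewrite subee.
- lra.
- exact: continuous_subspaceT.
- split.
  + by move=> x _; have [] := fdf x.
  + by apply: cvg_at_right_filter; exact: cf.
  + by apply: cvg_at_left_filter; exact: cf.
- by move=> x _; rewrite derive1E; have [_ ->] := fdf x.
Qed.

Lemma supp_out n f x : supp_in n f -> n%:R <= `|x.1| \/ n%:R <= `|x.2| -> f x = 0.
Proof.
move=> nf h; apply: (supp_in0 nf) => /ballN2P[x1 x2].
by case: h; rewrite leNgt ?x1 ?x2.
Qed.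

Lemma line1E (t y : R) : t *: e1 + (0, y) = (t, y).
Proof.
by apply: injective_projections; rewrite /= /GRing.scale/= ?mulr1 ?mulr0 ?addr0 ?add0r.
Qed.

Lemma line2E (t x : R) : t *: e2 + (x, 0) = (x, t).
Proof.
by apply: injective_projections; rewrite /= /GRing.scale/= ?mulr1 ?mulr0 ?addr0 ?add0r.
Qed.

Lemma int2_derive1 w : test2 w -> int2 ('D_e1 (w : R * R -> R)) = 0.
Proof.
move=> tw; have td := test2_derive e1 tw.
have [sw [n nw]] := (iffLR (test2P w)) tw.
have [sd [m md]] := (iffLR (test2P _)) td.
have i1 := itg_bcs (test2_bcs td).
rewrite /int2 /Rintegral -(integral21_prod_meas1 i1).
rewrite [X in fine X](_ : _ = 0)//; apply: integral0_eq => y _.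
apply: (@integral_derive_eq0 (fun x => w (x, y)) _ (maxn n m).+1%:R) => //.
- move=> x; have := is_derive_line (0, y) e1 x (smooth_diff sw).
  by under eq_fun do rewrite line1E; rewrite line1E.
- move=> x; have := is_derive_line (0, y) e1 x (smooth_diff sd).
  under eq_fun do rewrite line1E.
  by move=> [dx _]; move/derivable1_diffP/differentiable_continuous: dx.
- move=> x nmx; split.
    by apply: (supp_out nw); left; apply: le_trans nmx; rewrite ler_nat leqW// leq_maxl.
  by apply: (supp_out md); left; apply: le_trans nmx; rewrite ler_nat leqW// leq_maxr.
Qed.

Lemma int2_derive2 w : test2 w -> int2 ('D_e2 (w : R * R -> R)) = 0.
Proof.
move=> tw; have td := test2_derive e2 tw.
have [sw [n nw]] := (iffLR (test2P w)) tw.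
have [sd [m md]] := (iffLR (test2P _)) td.
have i1 := itg_bcs (test2_bcs td).
rewrite /int2 /Rintegral -(integral12_prod_meas1 i1).
rewrite [X in fine X](_ : _ = 0)//; apply: integral0_eq => x _.
apply: (@integral_derive_eq0 (fun y => w (x, y)) _ (maxn n m).+1%:R) => //.
- move=> y; have := is_derive_line (x, 0) e2 y (smooth_diff sw).
  by under eq_fun do rewrite line2E; rewrite line2E.
- move=> y; have := is_derive_line (x, 0) e2 y (smooth_diff sd).
  under eq_fun do rewrite line2E.
  by move=> [dx _]; move/derivable1_diffP/differentiable_continuous: dx.
- move=> y nmy; split.
    by apply: (supp_out nw); right; apply: le_trans nmy; rewrite ler_nat leqW// leq_maxl.
  by apply: (supp_out md); right; apply: le_trans nmy; rewrite ler_nat leqW// leq_maxr.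
Qed.

Definition lap (f : R * R -> R) (x : R * R) := 'D_e1 ('D_e1 f) x + 'D_e2 ('D_e2 f) x.

Definition grad_dot (f g : R * R -> R) x := 'D_e1 f x * 'D_e1 g x + 'D_e2 f x * 'D_e2 g x.

Lemma smooth_bcs f u : test2 f -> smooth (u : R * R -> R) ->
  bcs (fun x => f x * u x).
Proof. by move=> tf su; exact/test2_bcs/test2_mul. Qed.

(** The divergence of the field [w grad u], which is compactly supported because [w] is, has
    integral zero. In the application [u] is the mollified psi, which is positive everywhere. *)
Lemma green w u : test2 w -> smooth (u : R * R -> R) ->
  int2 (grad_dot w u) = - int2 (fun x => w x * lap u x).
Proof.
move=> tw su.
have sw := test2_smooth tw.
have s1 := smooth_derive e1 su; have s2 := smooth_derive e2 su.
have H1 := int2_derive1 (test2_mul tw s1).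
have H2 := int2_derive2 (test2_mul tw s2).
rewrite derive_mulE in H1; [|exact: smooth_diff|exact: smooth_diff].
rewrite derive_mulE in H2; [|exact: smooth_diff|exact: smooth_diff].
have t1 := test2_derive e1 tw; have t2 := test2_derive e2 tw.
have A1 := itg_bcs (smooth_bcs tw (smooth_derive e1 s1)).
have A2 := itg_bcs (smooth_bcs tw (smooth_derive e2 s2)).
have B1 := itg_bcs (smooth_bcs t1 s1).
have B2 := itg_bcs (smooth_bcs t2 s2).
have C1 := itg_bcs (bcsD (smooth_bcs t1 s1) (smooth_bcs t2 s2)).
have C2 := itg_bcs (smooth_bcs tw (smoothD (smooth_derive e1 s1) (smooth_derive e2 s2))).
apply/eqP; rewrite -subr_eq0 opprK -int2D//; apply/eqP.
transitivity (int2 (fun x => (w x * 'D_e1 ('D_e1 u) x + 'D_e1 u x * 'D_e1 w x) +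
  (w x * 'D_e2 ('D_e2 u) x + 'D_e2 u x * 'D_e2 w x))).
  apply: eq_int2 => x; rewrite /grad_dot /lap mulrDr addrACA.
  rewrite [X in X + _]addrC [X in _ + X]addrC [_ * 'D_e1 u x]mulrC.
  by rewrite [_ * 'D_e2 u x]mulrC.
rewrite int2D ?H1 ?H2 ?addr0//.
- have -> : (fun x => w x * 'D_e1 ('D_e1 u) x + 'D_e1 u x * 'D_e1 w x) =
    (fun x => w x * 'D_e1 ('D_e1 u) x + 'D_e1 w x * 'D_e1 u x).
    by apply/funext => x; congr (_ + _); rewrite mulrC.
  exact: (itg_bcs (bcsD (smooth_bcs tw (smooth_derive e1 s1)) (smooth_bcs t1 s1))).
- have -> : (fun x => w x * 'D_e2 ('D_e2 u) x + 'D_e2 u x * 'D_e2 w x) =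
    (fun x => w x * 'D_e2 ('D_e2 u) x + 'D_e2 w x * 'D_e2 u x).
    by apply/funext => x; congr (_ + _); rewrite mulrC.
  exact: (itg_bcs (bcsD (smooth_bcs tw (smooth_derive e2 s2)) (smooth_bcs t2 s2))).
Qed.

End PlaneIntegral.

(** * Convolution *)

Section Lin2.
#[local] Opaque derive.
Context {R : realType}.

Definition lin2 (a b : R) (z : R * R) : R := z.1 * a + z.2 * b.

Lemma lin2_is_linear a b : linear (lin2 a b).
Proof. by move=> c [u1 u2] [v1 v2]; rewrite /lin2 /= /GRing.scale/=; ring. Qed.

HB.instance Definition _ (a b : R) :=
  GRing.isLinear.Build R (R * R)%type R *:%R (lin2 a b) (lin2_is_linear a b).

Lemma lin2_continuous (a b : R) : continuous (lin2 a b).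
Proof.
move=> x; apply: cvgD; apply: cvgMl.
  exact: cvg_fst.
exact: cvg_snd.
Qed.

Lemma l1_le (z : R * R) : l1 z <= 2 * `|z|.
Proof.
rewrite /l1 prod_normE mulrDl mul1r.
by apply: lerD; rewrite le_max lexx ?orbT.
Qed.

Lemma l1_ge0 (z : R * R) : 0 <= l1 z.
Proof. by rewrite addr_ge0. Qed.

Lemma l1_e1 : l1 (e1 : R * R) = 1.
Proof. by rewrite /l1 /= normr1 normr0 addr0. Qed.

(** Only increments of norm at most 1 are constrained, so that in the application a single box
    contains all the supports involved. *)
Lemma differentiable_of_taylor (f : R * R -> R) (x : R * R) (a b C : R) :
  (forall z : R * R, `|z| <= 1 -> `|f (z + x) - f x - lin2 a b z| <= C * l1 z ^+ 2) ->
  differentiable f x /\ forall v, 'D_v f x = lin2 a b v.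
Proof.
move=> fC.
have C0 : 0 <= C.
  have n1 : `|e1 : R * R| <= 1 by rewrite prod_normE /= normr1 normr0 ge_max lexx ler01.
  have := fC _ n1; rewrite l1_e1 expr1n mulr1.
  exact: le_trans.
have H : f \o shift (x : (R * R)%type) = cst (f x) + lin2 a b +o_ (0 : (R * R)%type) id.
  apply/eqaddoP => e e0.
  have n1 : \forall z \near (0 : (R * R)%type), `|z| <= 1 by apply: nbhs0_le.
  (* From [l1 z <= 2 * |z|] the remainder is at most [4 * C * |z|^2], hence at most [e * |z|] in
     this range; the [+ 1] covers [C = 0]. *)
  have n2 : \forall z \near (0 : (R * R)%type), `|z| <= e / (4 * C + 1).
    by apply: nbhs0_le; rewrite divr_gt0// ltr_wpDl// mulr_ge0.
  near=> z.
  have z1 : `|z| <= 1 by near: z.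
  have ze : `|z| <= e / (4 * C + 1) by near: z.
  rewrite [X in `|X|](_ : _ = f (z + x) - f x - lin2 a b z); last first.
    by rewrite /= opprD addrA.
  apply: le_trans (fC z z1) _.
  have := l1_le z; have := l1_ge0 z; have := normr_ge0 z.
  move: ze; rewrite ler_pdivlMr ?ltr_wpDl// ?mulr_ge0//.
  move: (`|z|) (l1 z) => s t sC s0 t0 ts.
  have : t ^+ 2 <= (2 * s) ^+ 2 by rewrite lerXn2r// nnegrE// mulr_ge0.
  move=> /(ler_wpM2l C0) /le_trans; apply.
  have : s * (4 * C + 1) * s <= e * s by rewrite ler_wpM2r.
  by apply: le_trans; nra.
have dE := diff_unique (@lin2_continuous a b) H.
have df : differentiable f x.
  by apply/diff_locallyP; rewrite dE; split => //; exact: lin2_continuous.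
by split=> // v; rewrite deriveE// dE.
Unshelve. all: by end_near. Qed.

End Lin2.

Section Convolution.
#[local] Opaque derive.
Context {R : realType}.
Local Notation T1 := (measurableTypeR R).
Local Notation T2 := (T1 * T1)%type.
Local Notation itg f := (leb2.-integrable setT (EFin \o (f : T2 -> R))).
Implicit Types (f g h k : T2 -> R).

Definition tsub (x y : T2) : T2 := (x.1 - y.1, x.2 - y.2).

Lemma measurable_tsub : measurable_fun setT (fun p : T2 * T2 => tsub p.1 p.2).
Proof.
apply: measurable_fun_pair.
  apply: measurable_funB.
    by apply: measurableT_comp; [exact: measurable_fst|exact: measurable_fst].
  by apply: measurableT_comp; [exact: measurable_fst|exact: measurable_snd].
apply: measurable_funB.
  by apply: measurableT_comp; [exact: measurable_snd|exact: measurable_fst].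
by apply: measurableT_comp; [exact: measurable_snd|exact: measurable_snd].
Qed.

Lemma measurable_tsubl x : measurable_fun setT (tsub x).
Proof.
have := measurableT_comp measurable_tsub (measurable_pair1 x).
exact.
Qed.

Lemma bdd_tsub k x : bdd k -> bdd (fun y => k (tsub x y)).
Proof.
move=> [mk [B kB]]; split; last by exists B.
by apply: measurableT_comp; [exact: mk|exact: measurable_tsubl].
Qed.

Lemma box_tsub m n (x y : T2) : ballN2 m (x : R * R) -> ballN2 n (tsub x y : R * R) ->
  ballN2 (m + n) (y : R * R).
Proof.
move=> /ballN2P[a1 a2] /ballN2P[b1 b2]; apply/ballN2P; move: b1 b2 => /= b1 b2.
rewrite natrD; split.
  rewrite -[y.1](subKr x.1); apply: le_lt_trans (ler_normB _ _) _; exact: ltrD.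
rewrite -[y.2](subKr x.2); apply: le_lt_trans (ler_normB _ _) _; exact: ltrD.
Qed.

Lemma box_exists (x : T2) : exists n, ballN2 n (x : R * R).
Proof.
exists (Num.trunc (Num.max `|x.1| `|x.2|)).+1; apply/ballN2P.
by split; apply: le_lt_trans (truncnS_gt _); rewrite le_max lexx ?orbT.
Qed.

Lemma bcs_tsub k x : bcs k -> bcs (fun y => k (tsub x y)).
Proof.
move=> [bk [n nk]]; split; first exact: bdd_tsub.
have [m mx] := box_exists x; exists (m + n)%N => y /nk; exact: box_tsub.
Qed.

(** The translation acts on the kernel [k]: derivatives fall on [k], and boundedness of [h] is
    enough. *)
Definition convol h k (x : T2) : R := int2 (fun y => h y * k (tsub x y)).

Lemma conv_itg h k x : bdd h -> bcs k -> itg (fun y => h y * k (tsub x y)).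
Proof. by move=> bh bk; apply: itg_bcs; apply: bcsMr => //; exact: bcs_tsub. Qed.

Lemma convD h k l x : bdd h -> bcs k -> bcs l ->
  convol h (fun z => k z + l z) x = convol h k x + convol h l x.
Proof.
move=> bh bk bl; rewrite /convol -int2D; [|exact: conv_itg|exact: conv_itg].
by apply: eq_int2 => y; rewrite mulrDr.
Qed.

Lemma convZ h k c x : bdd h -> bcs k ->
  convol h (fun z => c * k z) x = c * convol h k x.
Proof.
move=> bh bk; rewrite /convol -int2Z; last exact: conv_itg.
by apply: eq_int2 => y; rewrite mulrCA.
Qed.

Lemma conv_supp h k n m : supp_in n h -> supp_in m k -> supp_in (n + m) (convol h k).
Proof.
move=> nh mk x; apply: contra_neqP => nx.
rewrite /convol (_ : (fun _ => _) = cst 0); first by rewrite /int2 Rintegral_cst// mul0r.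
apply/funext => y /=; have [->|/nh hy] := eqVneq (h y) 0; first by rewrite mul0r.
have [->|/mk ky] := eqVneq (k (tsub x y)) 0; first by rewrite mulr0.
exfalso; apply: nx; move: hy ky => /ballN2P[a1 a2] /ballN2P[/= b1 b2].
apply/ballN2P; rewrite natrD; split.
  rewrite -[x.1](subrK y.1) addrC; apply: le_lt_trans (ler_normD _ _) _; exact: ltrD.
rewrite -[x.2](subrK y.2) addrC; apply: le_lt_trans (ler_normD _ _) _; exact: ltrD.
Qed.

(** Fubini on a product of boxes; the symmetry of the kernel exchanges the two variables. It
    transfers a mollification from psi to the test function, where the equation can be used. *)
Lemma conv_adjoint a h k : bcs a -> bdd h -> bcs k -> (forall x y, k (tsub x y) = k (tsub y x)) ->
  int2 (fun x => a x * convol h k x) = int2 (fun y => h y * convol a k y).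
Proof.
move=> [ba [n na]] bh bk kE.
have [bk' [m mk]] := bk.
pose F (p : T2 * T2) : R := a p.1 * (h p.2 * k (tsub p.1 p.2)).
have mF : measurable_fun setT F.
  have [ma _] := ba; have [mh _] := bh; have [mk' _] := bk'.
  apply: measurable_funM.
    by apply: measurableT_comp; [exact: ma|exact: measurable_fst].
  apply: measurable_funM.
    by apply: measurableT_comp; [exact: mh|exact: measurable_snd].
  by apply: measurableT_comp; [exact: mk'|exact: measurable_tsub].
have iF : (leb2 \x leb2)%E.-integrable setT (EFin \o F).
  pose D : set (T2 * T2) := (ballN2 n : set T2) `*` (ballN2 (n + m) : set T2).
  have mD : measurable D by apply: measurableX; exact: measurable_box.
  have DF : ((leb2 \x leb2)%E D < +oo)%E.
    rewrite /D product_measure1E; [|exact: measurable_box|exact: measurable_box].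
    by rewrite lte_mul_pinfty// ?ge0_fin_numE ?leb2_box.
  have [_ [A aA]] := ba; have [_ [B hB]] := bh; have [_ [C kC]] := bk'.
  have iD : (leb2 \x leb2)%E.-integrable D (EFin \o F).
    apply: (@le_integrable _ _ _ _ _ mD _ (cst (A * (B * C))%:E)).
    - by apply/measurable_EFinP; exact: measurable_funS mF.
    - move=> p _; rewrite /= lee_fin; apply: le_trans (ler_norm _).
      rewrite !normrM; apply: ler_pM => //.
      exact: ler_pM.
    - apply/integrableP; split; first exact: measurable_cst.
      by rewrite integral_cst//= lte_mul_pinfty.
  have /integrable_mkcond := iD => /(_ mD); apply: eq_integrable => //= p _.
  rewrite /patch; case: ifPn => // /negP nD; rewrite /F.
  have [->|/na ax] := eqVneq (a p.1) 0; first by rewrite mul0r.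
  have [->|/mk kx] := eqVneq (k (tsub p.1 p.2)) 0; first by rewrite !mulr0.
  by exfalso; apply: nD; apply: mem_set; split => //=; exact: box_tsub kx.
have := Fubini iF; rewrite /F /= => FF.
rewrite /int2 /Rintegral; congr fine.
under eq_integral.
  move=> x _; rewrite /convol -int2Z; last exact: conv_itg.
  rewrite -int2E; last first.
    exact: (itg_bcs (bcsMr (bdd_cst (a x)) (bcsMr bh (bcs_tsub x bk)))).
  over.
rewrite /= FF; apply: eq_integral => y _.
rewrite /convol -int2Z; last by apply: conv_itg.
rewrite -int2E; last first.
  exact: (itg_bcs (bcsMr (bdd_cst (h y)) (bcsMr ba (bcs_tsub y bk)))).
by apply: eq_integral => x _; rewrite mulrCA (kE y x).
Qed.

(** The Taylor remainder of [g] at [tsub x y] is quadratic in [z], uniformly in [y], and vanishes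
    outside one box of values of [y]; integrated against the bounded [h] it is still quadratic in
    [z]. *)
Lemma conv_derivable h g x : bdd h -> test2 g ->
  differentiable (convol h g) x /\ forall v, 'D_v (convol h g) x = convol h ('D_v g) x.
Proof.
move=> bh tg.
have [sg [n ng]] := (iffLR (test2P g)) tg.
have [B gB] := test2_taylor tg.
have t1 := test2_derive e1 tg; have t2 := test2_derive e2 tg.
have [_ [n1 ng1]] := (iffLR (test2P _)) t1.
have [_ [n2 ng2]] := (iffLR (test2P _)) t2.
have [bh1 [A hA]] := bh.
have [m mx] := box_exists x.
(* In the variable [y] this box contains the supports of [g] and of its two partial derivatives
   translated to [x]; the extra 1 allows for [z + x] with [|z| <= 1]. *)
pose N := (m + (n + n1 + n2)).+1.
have mN : measurable (ballN2 N : set T2) by exact: measurable_box.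
have A0 : 0 <= A by exact: le_trans (hA 0).
have B0 : 0 <= B.
  have := gB 0 e1; rewrite l1_e1 expr1n mulr1.
  exact: le_trans.
pose rem z y : R := h y * (g (tsub (z + x) y) - g (tsub x y) -
  lin2 ('D_e1 g (tsub x y)) ('D_e2 g (tsub x y)) z).
have remE z y : rem z y = h y * g (tsub (z + x) y) - h y * g (tsub x y) -
    (z.1 * (h y * 'D_e1 g (tsub x y)) + z.2 * (h y * 'D_e2 g (tsub x y))).
  rewrite /rem /lin2; move: (g _) (g _) ('D_e1 g _) ('D_e2 g _) (h y) => a b c d e; ring.
have [|df Df] := @differentiable_of_taylor R (convol h g) x (convol h ('D_e1 g) x) (convol h ('D_e2 g) x)
  (A * B * fine (leb2 (ballN2 N : set T2))) _.
  move=> z z1.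
  have brem : bcs (rem z).
    have bb k (y : T2) : test2 k -> bcs (fun w => h w * k (tsub y w)) :=
      fun tk => bcsMr bh (bcs_tsub y (test2_bcs tk)).
    rewrite (_ : rem z = fun y => h y * g (tsub (z + x) y) - h y * g (tsub x y) -
      (z.1 * (h y * 'D_e1 g (tsub x y)) + z.2 * (h y * 'D_e2 g (tsub x y)))); last first.
      by apply/funext => y; exact: remE.
    exact: (bcsB (bcsB (bb _ _ tg) (bb _ _ tg))
      (bcsD (bcsMr (bdd_cst z.1) (bb _ _ t1)) (bcsMr (bdd_cst z.2) (bb _ _ t2)))).
  have -> : convol h g (z + x) - convol h g x - lin2 (convol h ('D_e1 g) x) (convol h ('D_e2 g) x) z
      = int2 (rem z).
    have bg y := conv_itg y bh (test2_bcs tg).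
    have b1 := conv_itg x bh (test2_bcs t1).
    have b2 := conv_itg x bh (test2_bcs t2).
    have bb k (y : T2) : test2 k -> bcs (fun w => h w * k (tsub y w)) :=
      fun tk => bcsMr bh (bcs_tsub y (test2_bcs tk)).
    have c1 := bcsMr (bdd_cst z.1) (bb _ x t1).
    have c2 := bcsMr (bdd_cst z.2) (bb _ x t2).
    rewrite (eq_int2 (remE z)).
    rewrite (int2B (itg_bcs (bcsB (bb _ (z + x) tg) (bb _ x tg))) (itg_bcs (bcsD c1 c2))).
    rewrite (int2B (itg_bcs (bb _ (z + x) tg)) (itg_bcs (bb _ x tg))).
    by rewrite (int2D (itg_bcs c1) (itg_bcs c2)) (int2Z _ b1) (int2Z _ b2).
  apply: le_trans (le_norm_int2 (itg_bcs brem)) _.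
  have bi := bcs_indic (R := R) N.
  rewrite mulrAC -int2_indic -int2Z; last exact: itg_bcs.
  apply: le_int2.
  - exact/itg_bcs/bcs_norm.
  - exact: (itg_bcs (bcsMr (bdd_cst _) bi)).
  move=> y; have [yN|yN] := pselect (ballN2 N (y : R * R)).
    rewrite indicE mem_set//= mulr1 /rem normrM -mulrA; apply: ler_pM => //.
    have -> : tsub (z + x) y = z + tsub x y.
      by rewrite /tsub; apply: injective_projections; rewrite /= addrA.
    exact: gB.
  rewrite indicE memNset//= mulr0 /rem.
  have out l M k : supp_in M k -> (M <= n + n1 + n2)%N -> (l <= m.+1)%N ->
      forall w : T2, ballN2 l (w : R * R) -> k (tsub w y) = 0.
    move=> Mk Mn lm w lw; apply: (supp_in0 Mk) => ky; apply: yN.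
    have := box_tsub lw ky; apply: ballN2W.
    by rewrite /N -addSn; apply: leq_add.
  have zx : ballN2 m.+1 (z + x).
    move: z1 mx; rewrite prod_normE ge_max => /andP[z1 z2] /ballN2P[x1 x2].
    apply/ballN2P; rewrite -natr1; split;
    apply: le_lt_trans (ler_normD _ _) _; rewrite addrC; exact: ltr_leD.
  rewrite (out _ _ _ ng _ _ _ zx)//; last by rewrite -addnA leq_addr.
  rewrite (out _ _ _ ng _ _ _ mx)//; last by rewrite -addnA leq_addr.
  rewrite (out _ _ _ ng1 _ _ _ mx)//; last by rewrite addnAC leq_addl.
  rewrite (out _ _ _ ng2 _ _ _ mx)//; last by rewrite leq_addl.
  by rewrite /lin2 !mulr0 addr0 !subr0 mulr0 normr0.
split=> // v; rewrite Df /lin2.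
rewrite (_ : 'D_v g = fun y => v.1 * 'D_e1 g y + v.2 * 'D_e2 g y); last first.
  by apply/funext => y; rewrite derive_partials//; exact: smooth_diff.
have b1 := test2_bcs t1; have b2 := test2_bcs t2.
by rewrite (convD x bh (bcsMr (bdd_cst v.1) b1) (bcsMr (bdd_cst v.2) b2)) !convZ.
Qed.

Lemma conv_deriveE h g v : bdd h -> test2 g -> 'D_v (convol h g) = convol h ('D_v g).
Proof. by move=> bh tg; apply/funext => x; have [_ ->] := conv_derivable x bh tg. Qed.

Lemma conv_smooth h g : bdd h -> test2 g -> smooth (convol h g).
Proof.
move=> bh tg.
have H s : iter_deriv s (convol h g) = convol h (iter_deriv s g) /\ test2 (iter_deriv s g).
  elim: s => [//|v s [IH ts]]; split; last exact: (test2_derive v ts).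
  by rewrite /= IH conv_deriveE.
by move=> s x; have [-> ts] := H s; have [] := conv_derivable x bh ts.
Qed.

Lemma conv_test2 h g : bcs h -> test2 g -> test2 (convol h g).
Proof.
move=> [bh [n nh]] tg; have [_ [m mg]] := (iffLR (test2P g)) tg.
by apply/test2P; split; [exact: conv_smooth|exists (n + m)%N; exact: conv_supp].
Qed.

Lemma conv_lap h g x : bdd h -> test2 g -> lap (convol h g) x = convol h (lap g) x.
Proof.
move=> bh tg; have t1 := test2_derive e1 tg; have t2 := test2_derive e2 tg.
have E1 : 'D_e1 ('D_e1 (convol h g)) = convol h ('D_e1 ('D_e1 g)).
  by rewrite -(conv_deriveE e1 bh t1) -(conv_deriveE e1 bh tg).
have E2 : 'D_e2 ('D_e2 (convol h g)) = convol h ('D_e2 ('D_e2 g)).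
  by rewrite -(conv_deriveE e2 bh t2) -(conv_deriveE e2 bh tg).
have b1 := test2_bcs (test2_derive e1 t1).
have b2 := test2_bcs (test2_derive e2 t2).
rewrite /lap [X in X + _](congr1 (fun f => f x) E1) [X in _ + X](congr1 (fun f => f x) E2).
by rewrite -(convD x bh b1 b2).
Qed.

Lemma test2_lap g : test2 g -> test2 (lap g).
Proof. by move=> tg; apply: test2_add; apply: test2_derive; exact: test2_derive. Qed.

Lemma even_derive g v : (forall x, differentiable g x) ->
  (forall x, g (- x) = g x) -> forall x, 'D_v g (- x) = - 'D_v g x.
Proof.
move=> dg ge x; have := derive_dilationE (-1) v dg.
rewrite (_ : (fun x => g (-1 *: x)) = g); last first.
  by apply/funext => y; rewrite scaleN1r.
by move=> /(congr1 (fun f => f x)) ->; rewrite scaleN1r mulN1r opprK.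
Qed.

Lemma odd_derive g v : (forall x, differentiable g x) ->
  (forall x, g (- x) = - g x) -> forall x, 'D_v g (- x) = 'D_v g x.
Proof.
move=> dg ge x; have := derive_dilationE (-1) v dg.
rewrite (_ : (fun x => g (-1 *: x)) = fun x => -1 * g x); last first.
  by apply/funext => y; rewrite scaleN1r ge mulN1r.
rewrite derive_scaleE// => /(congr1 (fun f => f x)).
by rewrite scaleN1r !mulN1r => /oppr_inj.
Qed.

(** Makes [lap (rho m)] an admissible kernel for [conv_adjoint]. *)
Lemma even_lap g : smooth g -> (forall x, g (- x) = g x) ->
  forall x, lap g (- x) = lap g x.
Proof.
move=> sg ge x; have dg := smooth_diff sg.
have d1 y : differentiable ('D_e1 g) y by apply: smooth_diff; exact: smooth_derive.
have d2 y : differentiable ('D_e2 g) y by apply: smooth_diff; exact: smooth_derive.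
have o1 := even_derive e1 dg ge; have o2 := even_derive e2 dg ge.
by rewrite /lap (odd_derive e1 d1 o1) (odd_derive e2 d2 o2).
Qed.

Lemma tsub_even g : (forall x : R * R, g (- x) = g x) ->
  forall x y, g (tsub x y) = g (tsub y x).
Proof.
move=> ge x y; rewrite -ge; congr g.
by apply: injective_projections; rewrite /= opprB.
Qed.

End Convolution.

(** * Mollifiers *)

Section Mollifier1.
#[local] Opaque derive.
Context {R : realType}.
Local Notation T1 := (measurableTypeR R).
Local Notation mu := (@lebesgue_measure R).

(** The standard mollifier profile exp(-1/(1 - s^2)) at s = (m+1) x, which vanishes for
    [|x| >= 1/(m+1)]. *)
Definition bump (m : nat) (x : R) : R := flat 0 (1 - (m.+1%:R * x) ^+ 2).

Lemma bump_ge0 m x : 0 <= bump m x. Proof. exact: flat_ge0. Qed.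

Lemma bump_le1 m x : bump m x <= 1. Proof. exact: flat_le1. Qed.

Lemma bumpN m x : bump m (- x) = bump m x.
Proof. by rewrite /bump mulrN sqrrN. Qed.

Lemma bump_out m x : m.+1%:R^-1 <= `|x| -> bump m x = 0.
Proof.
move=> mx; rewrite /bump /flat ifF//; apply/negbTE; rewrite -leNgt subr_le0.
rewrite -real_normK ?num_real// -[leLHS](expr1n _ 2) lerXn2r ?nnegrE//.
by rewrite normrM ger0_norm// mulrC -ler_pdivrMr// mul1r.
Qed.

Lemma bump_out1 m x : 1 <= `|x| -> bump m x = 0.
Proof.
by move=> x1; apply: bump_out; apply: le_trans x1; rewrite invf_le1// ler1n.
Qed.

Lemma smooth_bump (m : nat) (V : normedModType R) (f : V -> R) :
  smooth f -> smooth (fun x => bump m (f x)).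
Proof.
move=> sf; apply: smooth_flat_comp.
rewrite (_ : (fun x => _) = (fun x => 1 + (-1) * ((m.+1%:R * f x) * (m.+1%:R * f x)))).
  apply: smoothD; first exact: smooth_cst.
  by apply: smoothZ; apply: smoothM; exact: smoothZ.
by apply/funext => x; rewrite mulN1r expr2.
Qed.

Lemma smooth_id : smooth (fun x : R => x).
Proof.
apply/smooth_uptoP => -[|n]; first by apply/smooth_upto0 => x.
apply/smooth_uptoS; split=> [x|v] //.
rewrite (_ : 'D_v _ = fun=> v); first exact: smooth_upto_cst.
by apply/funext => x; rewrite derive_id.
Qed.

Lemma continuous_bump m : continuous (bump m).
Proof. by apply: smooth_continuous; exact: smooth_bump smooth_id. Qed.

Lemma measurable_bump m : measurable_fun setT (bump m : T1 -> R).
Proof. by apply: continuous_measurable_fun; exact: continuous_bump. Qed.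

Lemma measurable_ball1 (x r : R) : measurable (ball x r : set T1).
Proof. by apply: open_measurable; exact: ball_open. Qed.

Lemma integrable_cst_ball (c r : R) : 0 <= r ->
  mu.-integrable setT (EFin \o (fun x => c * \1_(ball (0 : R) r) x)).
Proof.
move=> r0.
have mb := measurable_ball1 0 r.
have H : mu.-integrable (ball (0 : R) r) (fun=> c%:E).
  apply/integrableP; split; first exact: measurable_cst.
  rewrite integral_cst//= lte_mul_pinfty//.
  by rewrite [X in (X < _)%E](_ : _ = (r *+ 2)%:E) ?ltry//; exact: lebesgue_measure_ball.
have /integrable_mkcond := H => /(_ mb); apply: eq_integrable => //= x _.
rewrite /patch indicE; case: ifPn => _; first by rewrite mulr1.
by rewrite mulr0.
Qed.

Lemma integral_cst_ball (c r : R) : 0 <= r ->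
  \int[mu]_x (c * \1_(ball (0 : R) r) x) = c * (r *+ 2).
Proof.
move=> r0; have mb := measurable_ball1 0 r.
have i1 : mu.-integrable setT (EFin \o (\1_(ball (0 : R) r) : R -> R)).
  by have := integrable_cst_ball 1 r0; apply: eq_integrable => //= x _; rewrite mul1r.
rewrite RintegralZl//; congr (_ * _).
rewrite /Rintegral integral_indic// setIT.
by transitivity (fine (r *+ 2)%:E) => //; congr fine; exact: lebesgue_measure_ball.
Qed.

Lemma integrable_bump m : mu.-integrable setT (EFin \o bump m).
Proof.
apply: le_integrable (integrable_cst_ball 1 ler01) => //.
  by apply/measurable_EFinP; exact: measurable_bump.
move=> x _ /=; rewrite lee_fin mul1r ger0_norm ?bump_ge0// indicE.
have [x1|x1] := ltP `|x| 1.
  by rewrite mem_set ?normr1 ?bump_le1// /ball/= sub0r normrN.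
by rewrite bump_out1.
Qed.

Definition bump_mass m : R := \int[mu]_x (bump m x).

(** Value of the bump at half its radius, 3/4 = 1 - (1/2)^2. The bump is at least [kappa] on the
    inner half of its support, an interval of length 1/(m+1). *)
Definition kappa : R := flat 0 (3 / 4).

Lemma kappa_gt0 : 0 < kappa.
Proof. by apply: flat_gt0; rewrite divr_gt0. Qed.

Lemma bump_mass_ge m : kappa / m.+1%:R <= bump_mass m.
Proof.
have r0 : 0 <= (2 * m.+1%:R)^-1 :> R by rewrite invr_ge0 mulr_ge0.
have -> : kappa / m.+1%:R = \int[mu]_x (kappa * \1_(ball (0 : R) (2 * m.+1%:R)^-1) x).
  rewrite integral_cst_ball// -mulr_natr.
  have : m.+1%:R != 0 :> R by rewrite pnatr_eq0.
  by move: (m.+1%:R : R) => M M0; field.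
apply: le_Rintegral => //.
- exact: integrable_cst_ball.
- exact: integrable_bump.
move=> x _; rewrite indicE; have [xb|xb] := pselect (ball (0 : R) (2 * m.+1%:R)^-1 x); last first.
  by rewrite memNset// mulr0 bump_ge0.
rewrite mem_set// mulr1 /bump /kappa /flat.
move: xb; rewrite /ball/= sub0r normrN => xb.
have H : (m.+1%:R * x) ^+ 2 <= 1 / 4.
  have : `|m.+1%:R * x| <= 1 / 2.
    rewrite normrM ger0_norm// -ler_pdivlMl//.
    by apply: ltW; apply: lt_le_trans xb _; rewrite invfM mul1r mulrC.
  rewrite -real_normK ?num_real//; have := normr_ge0 (m.+1%:R * x).
  move: `|_| => t t0 t1; nra.
have H34 : 3 / 4 <= 1 - (m.+1%:R * x) ^+ 2 by lra.
rewrite ifT; last lra. rewrite ifT; last lra.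
rewrite !expr0 !mul1r ler_expR lerN2 lef_pV2// posrE; lra.
Qed.

Lemma bump_mass_gt0 m : 0 < bump_mass m.
Proof. by apply: lt_le_trans (bump_mass_ge m); rewrite divr_gt0 ?kappa_gt0. Qed.

Definition moll m x : R := bump m x / bump_mass m.

Lemma moll_ge0 m x : 0 <= moll m x.
Proof. by rewrite divr_ge0 ?bump_ge0// ltW// bump_mass_gt0. Qed.

Lemma mollN m x : moll m (- x) = moll m x. Proof. by rewrite /moll bumpN. Qed.

Lemma moll_sym m x y : moll m (x - y) = moll m (y - x).
Proof. by rewrite -mollN opprB. Qed.

Lemma moll_out m x : m.+1%:R^-1 <= `|x| -> moll m x = 0.
Proof. by move=> mx; rewrite /moll bump_out// mul0r. Qed.

Lemma moll_out1 m x : 1 <= `|x| -> moll m x = 0.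
Proof. by move=> mx; rewrite /moll bump_out1// mul0r. Qed.

Lemma moll_le m x : moll m x <= m.+1%:R / kappa.
Proof.
rewrite /moll ler_pdivrMr ?bump_mass_gt0//; apply: le_trans (bump_le1 _ _) _.
apply: (@le_trans _ _ (m.+1%:R / kappa * (kappa / m.+1%:R))).
  by rewrite mulrA divfK ?gt_eqF ?kappa_gt0// mulfV.
by rewrite ler_wpM2l ?bump_mass_ge// divr_ge0// ltW// kappa_gt0.
Qed.

Lemma continuous_moll m : continuous (moll m).
Proof. by move=> x; apply: cvgMl; exact: continuous_bump. Qed.

Lemma measurable_moll m : measurable_fun setT (moll m : T1 -> R).
Proof. by apply: continuous_measurable_fun; exact: continuous_moll. Qed.

Lemma integral_moll m : (\int[mu]_x (moll m x)%:E = 1)%E.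
Proof.
have := RintegralZr (bump_mass m)^-1 measurableT (integrable_bump m).
rewrite -/(bump_mass m) mulfV ?gt_eqF ?bump_mass_gt0// => H.
have ie : mu.-integrable setT (EFin \o moll m).
  have := integrableZl measurableT (bump_mass m)^-1 (integrable_bump m).
  by apply: eq_integrable => // x _; rewrite /= -EFinM mulrC.
by rewrite -[LHS]fineK ?(integrable_fin_num _ ie)// -/(Rintegral _ _ _) H.
Qed.

Lemma integral_moll_shift m y : (\int[mu]_x (moll m (x - y))%:E = 1)%E.
Proof.
have D1 x : is_derive x (1 : R) (fun x : R => x - y) 1.
  by apply: is_derive_eq; rewrite subr0.
have dF : (fun x : R => x - y)^`()%classic = cst 1.
  by apply/funext => x; rewrite derive1E; have [_ ->] := D1 x.
rewrite -(integral_moll m).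
rewrite (@increasing_ge0_integration_by_substitutionT R (fun x => x - y) (moll m)).
- by apply: eq_integral => x _; rewrite dF /= fctE /= mulr1.
- by move=> a b ab; rewrite ltrD2r.
- by rewrite dF => x; exact: cvg_cst.
- by rewrite dF; apply: is_cvg_cst.
- by rewrite dF; apply: is_cvg_cst.
- by move=> x; have [] := D1 x.
- apply/cvgrNyPle => A; near=> x.
  rewrite lerBlDr; near: x; apply: nbhs_ninfty_le; exact: num_real.
- apply/cvgryPge => A; near=> x.
  rewrite lerBrDr; near: x; apply: nbhs_pinfty_ge; exact: num_real.
- exact: continuous_moll.
- by move=> x; exact: moll_ge0.
Unshelve. all: by end_near. Qed.

Lemma integral_moll_conv m x : (\int[mu]_y (moll m (x - y))%:E = 1)%E.
Proof.
by rewrite -(integral_moll_shift m x); apply: eq_integral => y _; rewrite moll_sym.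
Qed.

End Mollifier1.

(** * One-dimensional mollification error and Lebesgue points *)

Section Deviation.
#[local] Opaque derive.
Context {R : realType}.
Local Notation T1 := (measurableTypeR R).
Local Notation T2 := (T1 * T1)%type.
Local Notation mu := (@lebesgue_measure R).
Local Notation D n := (ball (0 : R) n%:R : set T1).

Implicit Types (m n : nat) (u : T1 -> R).

(** Mollification error with the absolute value inside the integral, kept in the extended reals so
    that Tonelli applies directly. *)
Definition dev m u (x : T1) : \bar R :=
  (\int[mu]_s (`|u s - u x| * moll m (x - s))%:E)%E.

Lemma dev_ge0 m u x : (0 <= dev m u x)%E.
Proof. by apply: integral_ge0 => s _; rewrite lee_fin mulr_ge0// moll_ge0. Qed.

Lemma measurable_sub1 (x : T1) : measurable_fun setT (fun s : T1 => x - s).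
Proof. by apply: measurable_funB => //; exact: measurable_cst. Qed.

Lemma measurable_dev_integrand m u x : measurable_fun setT u ->
  measurable_fun setT (fun s : T1 => (`|u s - u x| * moll m (x - s))%:E).
Proof.
move=> mu_; apply/measurable_EFinP; apply: measurable_funM.
  apply: measurableT_comp => //; apply: measurable_funB => //.
apply: measurableT_comp; [exact: measurable_moll|exact: measurable_sub1].
Qed.

Lemma dev_le m u B x : measurable_fun setT u -> (forall y, `|u y| <= B) ->
  (dev m u x <= (2 * B)%:E)%E.
Proof.
move=> mu_ uB.
have B0 : 0 <= B by exact: le_trans (uB 0).
have me : measurable_fun setT (fun s : T1 => (moll m (x - s))%:E).
  apply/measurable_EFinP; apply: measurableT_comp; [exact: measurable_moll|exact: measurable_sub1].
apply: (@le_trans _ _ (\int[mu]_s ((2 * B)%:E * (moll m (x - s))%:E))%E).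
  apply: ge0_le_integral => //.
  - by move=> s _; rewrite lee_fin mulr_ge0// moll_ge0.
  - exact: measurable_dev_integrand.
  - by apply: emeasurable_funM => //; exact: measurable_cst.
  move=> s _; rewrite -EFinM lee_fin ler_wpM2r ?moll_ge0//.
  by apply: le_trans (ler_normB _ _) _; rewrite mulrDl mul1r; exact: lerD.
rewrite ge0_integralZl//.
- by rewrite integral_moll_conv mule1.
- by move=> s _; rewrite lee_fin moll_ge0.
- by rewrite lee_fin mulr_ge0.
Qed.

Lemma measurable_dev m u : measurable_fun setT u -> measurable_fun setT (dev m u).
Proof.
move=> mu_.
pose F (p : T1 * T1) : \bar R := (`|u p.2 - u p.1| * moll m (p.1 - p.2))%:E.
have mF : measurable_fun setT F.
  apply/measurable_EFinP; apply: measurable_funM.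
    apply: measurableT_comp => //; apply: measurable_funB.
      by apply: measurableT_comp => //; exact: measurable_snd.
    by apply: measurableT_comp => //; exact: measurable_fst.
  apply: measurableT_comp; first exact: measurable_moll.
  by apply: measurable_funB; [exact: measurable_fst|exact: measurable_snd].
apply: (measurable_fun_fubini_tonelli_F (m2 := mu) F) => //.
by move=> p; rewrite lee_fin mulr_ge0// moll_ge0.
Qed.

(** [moll m] is at most (m+1)/kappa and lives on an interval of length 2/(m+1), so integrating
    against it costs at most 2/kappa times the average over that interval. *)
Lemma dev_davg m u x : measurable_fun setT u ->
  (dev m u x <= (2 / kappa)%:E * davg u x m.+1%:R^-1)%E.
Proof.
move=> mu_; have r0 : 0 <= m.+1%:R^-1 :> R by [].
have k0 := @kappa_gt0 R.
have mb := measurable_ball1 x (m.+1%:R^-1 : R).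
rewrite /davg /iavg.
have -> : mu (ball x (m.+1%:R^-1 : R)) = (m.+1%:R^-1 *+ 2)%:E by exact: lebesgue_measure_ball.
rewrite inver ifF; last by apply/negbTE; rewrite mulrn_eq0/= invr_eq0 pnatr_eq0.
rewrite muleA -EFinM.
have -> : 2 / kappa * (m.+1%:R^-1 *+ 2)^-1 = m.+1%:R / kappa :> R.
  have M0 : m.+1%:R != 0 :> R by rewrite pnatr_eq0.
  rewrite -mulr_natr; move: (m.+1%:R : R) M0 => M M0.
  by field; rewrite M0 gt_eqF.
rewrite -ge0_integralZl//; last 2 first.
- apply: measurableT_comp => //; apply/measurable_EFinP.
  apply: measurable_funTS; exact: measurable_funB.
- by rewrite lee_fin divr_ge0// ltW.
rewrite [leRHS]integral_mkcond; apply: ge0_le_integral => //.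
- by move=> s _; rewrite lee_fin mulr_ge0// moll_ge0.
- exact: measurable_dev_integrand.
- apply/(measurable_restrictT _ mb)/emeasurable_funM; first exact: measurable_cst.
  apply: measurableT_comp => //; apply/measurable_EFinP.
  apply: measurable_funTS; exact: measurable_funB.
move=> s _; rewrite /patch; case: ifPn => [_|].
  rewrite [leRHS]/= -EFinM lee_fin mulrC; apply: ler_wpM2r => //; exact: moll_le.
rewrite notin_setE /ball/= => /negP; rewrite -leNgt => h.
by rewrite moll_out// mulr0.
Qed.

Lemma cvg_inv_succ : (m.+1%:R^-1 : R) @[m --> \oo] --> (0 : R)^'+.
Proof.
move=> A [e /= e0 eA]; near_simpl; near=> m; have := eA (m.+1%:R^-1); apply; last by rewrite /= invr_gt0.
rewrite /ball_ /= sub0r normrN ger0_norm//; near: m.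
exact: (near_infty_natSinv_lt (PosNum e0)).
Unshelve. all: by end_near. Qed.

(** A bounded measurable function is locally integrable, so almost every point is a Lebesgue point;
    there the averages in [dev_davg] tend to 0. *)
Lemma dev_cvg u B : measurable_fun setT u -> (forall y, `|u y| <= B) ->
  {ae mu, forall x, dev m u x @[m --> \oo] --> (0 : \bar R)%E}.
Proof.
move=> mu_ uB.
have lu : locally_integrable [set: R] u.
  split => //; first exact: openT.
  move=> K _ cK; have mK := compact_measurable cK.
  have Koo := compact_finite_measure cK.
  apply: (@le_lt_trans _ _ (\int[mu]_(x in K) (cst B%:E x))%E).
    apply: ge0_le_integral => //.
    - have mn : measurable_fun (K : set T1) (fun x : T1 => `|u x|).
        by apply: measurableT_comp => //; exact: measurable_funTS.
      exact/measurable_EFinP.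
    - by move=> x _; rewrite lee_fin.
  rewrite integral_cst// lte_mul_pinfty//.
  by rewrite lee_fin; exact: le_trans (uB 0).
have H : {ae mu, forall x : T1, lebesgue_pt u x} := lebesgue_differentiation lu.
apply: (@filterS _ _ (ae_filter_ringOfSetsType mu) _ _ _ H) => x ux.
have k0 : 0 < 2 / @kappa R by rewrite divr_gt0// kappa_gt0.
apply: (@squeeze_cvge _ _ _ _ (fun=> 0%E) _ (fun m => ((2 / kappa)%:E * davg u x m.+1%:R^-1)%E)).
- by near=> m; rewrite dev_ge0 dev_davg.
- exact: cvg_cst.
- rewrite -(mule0 (2 / kappa)%:E); apply: cvgeZl => //.
  exact: (cvg_comp _ _ cvg_inv_succ ux).
Unshelve. all: by end_near. Qed.

Lemma integral_dev_cvg u B n : measurable_fun setT u -> (forall y, `|u y| <= B) ->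
  (\int[mu]_(x in D n) dev m u x)%E @[m --> \oo] --> (0 : \bar R)%E.
Proof.
move=> mu_ uB; have mD : measurable (D n) by exact: measurable_ball1.
have [|||||_ _] := @dominated_convergence _ _ _ mu (D n) mD (dev ^~ u) (cst 0%E) (cst (2 * B)%:E).
- by move=> m; apply: measurable_funTS; exact: measurable_dev.
- exact: measurable_cst.
- by have := dev_cvg mu_ uB; apply: filterS => x + _.
- apply/integrableP; split; first exact: measurable_cst.
  rewrite integral_cst//= lte_mul_pinfty//.
  by rewrite [X in (X < _)%E](_ : _ = (n%:R *+ 2)%:E) ?ltry//; exact: lebesgue_measure_ball.
- apply: aeW => x m _; rewrite gee0_abs ?dev_ge0//; exact: dev_le.
by rewrite integral0.
Qed.

Lemma integral_ball_finite (r : R) n : (\int[mu]_(x in D n) (cst r%:E x) = (r * (n%:R *+ 2))%:E)%E.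
Proof.
rewrite integral_cst; last exact: measurable_ball1.
by rewrite EFinM; congr (_ * _)%E; exact: lebesgue_measure_ball.
Qed.

Lemma measurable_slice1 (h : T2 -> R) (t : T1) : measurable_fun setT h ->
  measurable_fun setT (fun s : T1 => h (s, t)).
Proof. by move=> mh; exact: (measurableT_comp mh (measurable_pair2 t)). Qed.

Lemma measurable_dev2 m (h : T2 -> R) : measurable_fun setT h ->
  measurable_fun setT (fun x : T2 => dev m (fun s => h (s, x.2)) x.1).
Proof.
move=> mh.
pose F (p : T2 * T1) : \bar R :=
  (`|h (p.2, p.1.2) - h p.1| * moll m (p.1.1 - p.2))%:E.
have mF : measurable_fun setT F.
  apply/measurable_EFinP; apply: measurable_funM.
    apply: measurableT_comp => //; apply: measurable_funB.
      apply: measurableT_comp => //; apply: measurable_fun_pair.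
        exact: measurable_snd.
      by apply: measurableT_comp; [exact: measurable_snd|exact: measurable_fst].
    by apply: measurableT_comp => //; exact: measurable_fst.
  apply: measurableT_comp; first exact: measurable_moll.
  apply: measurable_funB; last exact: measurable_snd.
  by apply: measurableT_comp; [exact: measurable_fst|exact: measurable_fst].
have H : measurable_fun setT (fun x : T2 => \int[mu]_s F (x, s))%E.
  apply: (measurable_fun_fubini_tonelli_F (m2 := mu) F) => //.
  by move=> p; rewrite lee_fin mulr_ge0// moll_ge0.
apply: eq_measurable_fun H => x _; rewrite /dev; apply: eq_integral => s _.
by rewrite /F /= -surjective_pairing.
Qed.

Lemma box_setX n : (ballN2 n : set T2) = D n `*` D n.
Proof. by apply/seteqP; split=> x; [move=> [? ?]; split|move=> [? ?]; split]. Qed.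

Lemma patch_box n (P : T2 -> \bar R) x1 x2 :
  (P \_ (ballN2 n)) (x1, x2) = ((fun x => ((fun y => P (x, y)) \_ (D n)) x2) \_ (D n)) x1.
Proof.
rewrite box_setX /patch.
have [h1|h1] := boolP (x1 \in D n); have [h2|h2] := boolP (x2 \in D n).
- by rewrite mem_set//; split=> /=; exact: set_mem.
- by rewrite memNset// => -[/= _ h]; move/negP: h2; apply; exact: mem_set.
- by rewrite memNset// => -[/= h _]; move/negP: h1; apply; exact: mem_set.
- by rewrite memNset// => -[/= h _]; move/negP: h1; apply; exact: mem_set.
Qed.

Lemma measurable_patch_box n (P : T2 -> \bar R) : measurable_fun setT P ->
  measurable_fun setT (P \_ (ballN2 n)).
Proof.
move=> mP; apply/(measurable_restrictT _ (measurable_box n)).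
exact: measurable_funTS.
Qed.

Lemma box_tonelli1 n (P : T2 -> \bar R) : measurable_fun setT P ->
  (forall x, 0 <= P x)%E ->
  (\int[leb2]_(x in ballN2 n) P x =
   \int[mu]_(x1 in D n) \int[mu]_(x2 in D n) P (x1, x2))%E.
Proof.
move=> mP P0; rewrite integral_mkcond.
rewrite (fubini_tonelli1 (P \_ (ballN2 n)))//; last 2 first.
- exact: measurable_patch_box.
- by move=> x; rewrite /patch; case: ifP.
rewrite [RHS]integral_mkcond; apply: eq_integral => x1 _.
rewrite /fubini_F; under eq_integral do rewrite patch_box.
rewrite /patch; case: ifPn => _; last by rewrite integral0.
by rewrite [RHS]integral_mkcond.
Qed.

Lemma box_tonelli2 n (P : T2 -> \bar R) : measurable_fun setT P ->
  (forall x, 0 <= P x)%E ->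
  (\int[leb2]_(x in ballN2 n) P x =
   \int[mu]_(x2 in D n) \int[mu]_(x1 in D n) P (x1, x2))%E.
Proof.
move=> mP P0; rewrite integral_mkcond.
rewrite (fubini_tonelli2 (P \_ (ballN2 n)))//; last 2 first.
- exact: measurable_patch_box.
- by move=> x; rewrite /patch; case: ifP.
rewrite [RHS]integral_mkcond; apply: eq_integral => x2 _.
rewrite /fubini_G; under eq_integral do rewrite patch_box.
rewrite /patch; case: ifPn => h2.
  by rewrite [RHS]integral_mkcond.
by under eq_integral do rewrite if_same; rewrite integral0.
Qed.

Lemma measurable_box_G n (P : T2 -> \bar R) : measurable_fun setT P ->
  (forall x, 0 <= P x)%E ->
  measurable_fun (D n) (fun x2 => \int[mu]_(x1 in D n) P (x1, x2))%E.
Proof.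
move=> mP P0; apply/(measurable_restrictT _ (measurable_ball1 _ _)).
have H : measurable_fun setT (fun x2 : T1 => \int[mu]_x1 (P \_ (ballN2 n)) (x1, x2))%E.
  apply: (measurable_fun_fubini_tonelli_G (m1 := mu) (P \_ (ballN2 n))).
    exact: measurable_patch_box.
  by move=> x; rewrite /patch; case: ifP.
apply: eq_measurable_fun H => x2 _.
under eq_integral do rewrite patch_box.
rewrite /patch; case: ifPn => h2.
  by rewrite [RHS]integral_mkcond.
by under eq_integral do rewrite if_same; rewrite integral0.
Qed.

(** Dominated convergence once more, in the height [t]: each inner integral is at most [2 * B] times
    the length of the interval. *)
Lemma iterated_dev_cvg (h : T2 -> R) B n : measurable_fun setT h ->
  (forall x, `|h x| <= B) ->
  (\int[mu]_(t in D n) \int[mu]_(x in D n) dev m (fun s => h (s, t)) x)%E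
    @[m --> \oo] --> (0 : \bar R)%E.
Proof.
move=> mh hB; have mD : measurable (D n) by exact: measurable_ball1.
have B0 : 0 <= B by exact: le_trans (hB (0, 0)).
have ms t := measurable_slice1 t mh.
pose f m t := (\int[mu]_(x in D n) dev m (fun s => h (s, t)) x)%E.
have f0 m t : (0 <= f m t)%E by apply: integral_ge0 => x _; exact: dev_ge0.
have fB m t : (f m t <= (2 * B * (n%:R *+ 2))%:E)%E.
  rewrite -integral_ball_finite; apply: ge0_le_integral => //.
  - by move=> x _; exact: dev_ge0.
  - by apply: measurable_funTS; exact: measurable_dev.
  - by move=> x _; exact: dev_le.
have [|||||_ _] := @dominated_convergence _ _ _ mu (D n) mD f (cst 0%E)
  (cst (2 * B * (n%:R *+ 2))%:E).
- move=> m; apply: (measurable_box_G (P := fun x => dev m (fun s => h (s, x.2)) x.1)).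
    exact: measurable_dev2.
  by move=> x; exact: dev_ge0.
- exact: measurable_cst.
- by apply: aeW => t _; apply: integral_dev_cvg => // y; exact: hB.
- apply/integrableP; split; first exact: measurable_cst.
  rewrite integral_cst//= lte_mul_pinfty//.
  by rewrite [X in (X < _)%E](_ : _ = (n%:R *+ 2)%:E) ?ltry//; exact: lebesgue_measure_ball.
- by apply: aeW => t m _; rewrite gee0_abs.
by rewrite integral0.
Qed.

End Deviation.

(** * Mollification in the plane *)

Section Mollifier2.
#[local] Opaque derive.
Context {R : realType}.
Local Notation T1 := (measurableTypeR R).
Local Notation T2 := (T1 * T1)%type.
Local Notation mu := (@lebesgue_measure R).
Local Notation D n := (ball (0 : R) n%:R : set T1).
Local Notation itg f := (leb2.-integrable setT (EFin \o (f : T2 -> R))).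
Implicit Types (m n : nat) (h : T2 -> R).

(** A product kernel instead of a radial one, so that planar averages split into averages along
    lines. *)
Definition rho m (z : R * R) : R := moll m z.1 * moll m z.2.

Lemma rho_ge0 m z : 0 <= rho m z.
Proof. by rewrite mulr_ge0// moll_ge0. Qed.

Lemma rho_even m z : rho m (- z) = rho m z.
Proof. by rewrite /rho /= !mollN. Qed.

(** The box is the same for all [m], which keeps the mollifications of a compactly supported
    function in a fixed box as [m] grows. *)
Lemma rho_supp m : supp_in 1 (rho m).
Proof.
move=> z; rewrite mulf_eq0 negb_or => /andP[z1 z2]; apply/ballN2P; split.
  by rewrite ltNge; apply: contra_neqN z1; exact: moll_out1.
by rewrite ltNge; apply: contra_neqN z2; exact: moll_out1.
Qed.

Lemma rho_test2 m : test2 (rho m : T2 -> R).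
Proof.
apply/test2P; split; last by exists 1; exact: rho_supp.
have s1 : smooth (fun z : R * R => z.1).
  have := smooth_lin (@lin2_continuous R 1 0); congr smooth.
  by apply/funext => z; rewrite /= /lin2 mulr1 mulr0 addr0.
have s2 : smooth (fun z : R * R => z.2).
  have := smooth_lin (@lin2_continuous R 0 1); congr smooth.
  by apply/funext => z; rewrite /= /lin2 mulr1 mulr0 add0r.
have b1 := smoothZ (bump_mass m)^-1 (smooth_bump m s1).
have b2 := smoothZ (bump_mass m)^-1 (smooth_bump m s2).
have := smoothM b1 b2; congr smooth.
by apply/funext => z; rewrite /rho /moll ![_^-1 * _]mulrC.
Qed.

Lemma rho_bcs m : bcs (rho m : T2 -> R).
Proof. exact/test2_bcs/rho_test2. Qed.

Lemma measurable_moll_sub m (x : T1) : measurable_fun setT (fun s : T1 => moll m (x - s)).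
Proof. apply: measurableT_comp; [exact: measurable_moll|exact: measurable_sub1]. Qed.

Lemma integral_rho m x : (\int[leb2]_y (rho m (tsub x y))%:E = 1)%E.
Proof.
rewrite (fubini_tonelli1 (fun y => (rho m (tsub x y))%:E)).
- rewrite /fubini_F -[RHS](integral_moll_conv m x.1); apply: eq_integral => s _.
  rewrite -[RHS]mule1 -[in RHS](integral_moll_conv m x.2) -ge0_integralZl//.
  + by apply/measurable_EFinP; exact: measurable_moll_sub.
  + by move=> t _; rewrite lee_fin moll_ge0.
  + by rewrite lee_fin moll_ge0.
- apply/measurable_EFinP; have [[mr _] _] := rho_bcs m.
  by apply: measurableT_comp; [exact: mr|exact: measurable_tsubl].
- by move=> y; rewrite lee_fin rho_ge0.
Qed.

Lemma int2_rho m x : int2 (fun y => rho m (tsub x y)) = 1.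
Proof. by rewrite /int2 /Rintegral integral_rho. Qed.

Lemma conv_rho_le h m B x : bdd h -> (forall y, `|h y| <= B) -> `|convol h (rho m) x| <= B.
Proof.
move=> bh hB; have b0 := bcs_tsub x (rho_bcs m).
apply: le_trans (le_norm_int2 (conv_itg x bh (rho_bcs m))) _.
rewrite -[leRHS]mulr1 -(int2_rho m x) -int2Z; last exact: itg_bcs.
apply: le_int2.
- exact/itg_bcs/bcs_norm/(bcsMr bh).
- exact: (itg_bcs (bcsMr (bdd_cst B) b0)).
- by move=> y; rewrite normrM (ger0_norm (rho_ge0 _ _)) ler_wpM2r ?rho_ge0.
Qed.

Lemma conv_rho_sub h m x : bdd h ->
  convol h (rho m) x - h x = int2 (fun y => (h y - h x) * rho m (tsub x y)).
Proof.
move=> bh; have b0 := bcs_tsub x (rho_bcs m).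
have E : int2 (fun y => h x * rho m (tsub x y)) = h x.
  by rewrite int2Z ?int2_rho ?mulr1//; exact: itg_bcs.
rewrite -[X in _ - X]E /convol -int2B.
- by apply: eq_int2 => y; rewrite mulrBl.
- exact: (itg_bcs (bcsMr bh b0)).
- exact: (itg_bcs (bcsMr (bdd_cst (h x)) b0)).
Qed.

Lemma measurable_dev_slice m h (x1 : T1) : measurable_fun setT h ->
  measurable_fun setT (fun t : T1 => dev m (fun s => h (s, t)) x1).
Proof. by move=> mh; exact: (measurableT_comp (measurable_dev2 m mh) (measurable_pair1 x1)). Qed.

(** The path from (s, t) to [x] passes through (x.1, t). The first leg gives the deviation in the
    first variable on the line at height t, averaged over t; the second gives the deviation in the
    second variable at [x]. The planar error is thus reduced to one-dimensional Lebesgue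
    differentiation. *)
Lemma conv_rho_sub_le h m x : bdd h ->
  ((`|convol h (rho m) x - h x|)%:E <=
   \int[mu]_t ((moll m (x.2 - t))%:E * dev m (fun s => h (s, t)) x.1) +
   dev m (fun t => h (x.1, t)) x.2)%E.
Proof.
move=> bh; have [mh [B hB]] := bh; have b0 := bcs_tsub x (rho_bcs m).
have bF : bcs (fun y => (h y - h x) * rho m (tsub x y)).
  exact: (bcsMr (bddB bh (bdd_cst (h x))) b0).
rewrite conv_rho_sub//.
apply: (@le_trans _ _ (int2 (fun y => `|(h y - h x) * rho m (tsub x y)|))%:E).
  by rewrite lee_fin; apply: le_norm_int2; exact: itg_bcs.
rewrite -int2E; last exact/itg_bcs/bcs_norm.
have mF : measurable_fun setT (fun y => (`|(h y - h x) * rho m (tsub x y)|)%:E).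
  by apply/measurable_EFinP; have [[? _] _] := bcs_norm bF.
rewrite (fubini_tonelli2 (fun y => (`|(h y - h x) * rho m (tsub x y)|)%:E))//.
have md := measurable_dev_slice m x.1 mh.
have mm2 : measurable_fun setT (fun t : T1 => (moll m (x.2 - t))%:E).
  by apply/measurable_EFinP; exact: measurable_moll_sub.
have mm1 : measurable_fun setT (fun t : T1 => (moll m (x.1 - t))%:E).
  by apply/measurable_EFinP; exact: measurable_moll_sub.
have mh1 : measurable_fun setT (fun t : T1 => h (x.1, t)).
  exact: (measurableT_comp mh (measurable_pair1 x.1)).
have mg := measurable_dev_integrand m x.2 mh1.
rewrite /dev -/(dev m _ _) -ge0_integralD//; last 3 first.
- move=> t _; apply: mule_ge0; first by rewrite lee_fin moll_ge0.
  by apply: integral_ge0 => s _; rewrite lee_fin mulr_ge0// moll_ge0.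
- exact: (emeasurable_funM mm2 md).
- by move=> t _; rewrite lee_fin mulr_ge0// moll_ge0.
apply: ge0_le_integral => //.
- by move=> t _; apply: integral_ge0.
- by apply: (measurable_fun_fubini_tonelli_G (m1 := mu)) => //.
- apply: emeasurable_funD => //; exact: emeasurable_funM.
move=> t _.
have ms := measurable_dev_integrand m x.1 (measurable_slice1 t mh).
rewrite /fubini_G /dev -ge0_integralZl//; last 2 first.
- by move=> s _; rewrite lee_fin mulr_ge0// moll_ge0.
- by rewrite lee_fin moll_ge0.
(* The second leg does not involve [s]; multiplying it by the unit mass of the mollifier in [s] puts
   both terms under one integral. *)
rewrite -[X in (_ + X)%E]mule1 -(integral_moll_conv m x.1) -ge0_integralZl//; last 2 first.
- by move=> s _; rewrite lee_fin moll_ge0.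
- by rewrite lee_fin mulr_ge0// moll_ge0.
rewrite -ge0_integralD//; last 4 first.
- move=> s _; rewrite -EFinM lee_fin; apply: mulr_ge0; [|apply: mulr_ge0 => //]; exact: moll_ge0.
- by apply: emeasurable_funM => //; exact: measurable_cst.
- move=> s _; rewrite -EFinM lee_fin; apply: mulr_ge0; [apply: mulr_ge0 => //|]; exact: moll_ge0.
- by apply: emeasurable_funM => //; exact: measurable_cst.
apply: ge0_le_integral => //.
- exact: (measurableT_comp mF (measurable_pair2 t)).
- by apply: emeasurable_funD; apply: emeasurable_funM => //; exact: measurable_cst.
move=> s _; rewrite -!EFinM -EFinD lee_fin normrM (ger0_norm (rho_ge0 _ _)) /rho /=.
have a0 := moll_ge0 m (x.1 - s); have b1 := moll_ge0 m (x.2 - t).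
have := ler_distD (h (x.1, t)) (h (s, t)) (h (x.1, x.2)).
rewrite -surjective_pairing; move: `|_ - h x| `|_ - _| `|_ - _| => p q r pqr.
have : 0 <= moll m (x.1 - s) * moll m (x.2 - t) by rewrite mulr_ge0.
move: (moll m _) (moll m _) a0 b1 => a b a0 b0' ab0.
apply: le_trans (ler_wpM2r ab0 pqr) _.
by rewrite [leLHS](_ : _ = a * (q * b) + p * a * b)//; ring.
Qed.

Lemma measurable_strip k (P : T2 -> \bar R) : measurable_fun setT P ->
  (forall x, 0 <= P x)%E ->
  measurable_fun setT (fun x1 : T1 => \int[mu]_(x2 in D k) P (x1, x2))%E.
Proof.
move=> mP P0; have mD : measurable (D k) by exact: measurable_ball1.
have H : measurable_fun setT (fun x1 : T1 => \int[mu]_x2 (P \_ (setT `*` D k)) (x1, x2))%E.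
  apply: (measurable_fun_fubini_tonelli_F (m2 := mu) (P \_ (setT `*` D k))).
    apply/(measurable_restrictT _ (measurableX measurableT mD)).
    exact: measurable_funTS.
  by move=> x; rewrite /patch; case: ifP.
apply: eq_measurable_fun H => x1 _; rewrite [RHS]integral_mkcond.
apply: eq_integral => x2 _; rewrite /patch; congr (if _ then _ else _).
by apply/idP/idP => /set_mem h; apply: mem_set; move: h => //= -[].
Qed.

(** By Tonelli the weight of [p t] is the mollifier mass in [x], at most 1; it is zero once
    [|t| >= n + 1], as the mollifier moves mass by less than 1. *)
Lemma integral_smear1_le m n (p : T1 -> \bar R) : measurable_fun setT p ->
  (forall t, 0 <= p t)%E ->
  (\int[mu]_(x in D n) \int[mu]_t ((moll m (x - t))%:E * p t) <=
   \int[mu]_(t in D n.+1) p t)%E.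
Proof.
move=> mp p0; have mD k : measurable (D k) by exact: measurable_ball1.
pose K (z : T1 * T1) : \bar R := ((moll m (z.1 - z.2))%:E * p z.2)%E.
have K0 z : (0 <= K z)%E by rewrite mule_ge0// lee_fin moll_ge0.
have mK : measurable_fun setT K.
  apply: emeasurable_funM.
    apply/measurable_EFinP; apply: measurableT_comp; first exact: measurable_moll.
    by apply: measurable_funB; [exact: measurable_fst|exact: measurable_snd].
  by apply: measurableT_comp => //; exact: measurable_snd.
pose S : set T2 := D n `*` setT.
have mS : measurable S by exact: measurableX.
have mKS : measurable_fun setT (K \_ S).
  by apply/(measurable_restrictT _ mS); exact: measurable_funTS.
have KS0 z : (0 <= (K \_ S) z)%E by rewrite /patch; case: ifP.
have inS x t : ((x, t) \in S) = (x \in D n).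
  by apply/idP/idP => /set_mem h; apply: mem_set; move: h => //= -[].
have -> : (\int[mu]_(x in D n) \int[mu]_t ((moll m (x - t))%:E * p t) =
    \int[mu]_t \int[mu]_x (K \_ S) (x, t))%E.
  rewrite -(fubini_tonelli (K \_ S))// [LHS]integral_mkcond; apply: eq_integral => x _.
  rewrite /fubini_F /patch; under [in RHS]eq_integral do rewrite inS.
  by case: ifPn => // _; rewrite integral0.
rewrite [leRHS]integral_mkcond; apply: ge0_le_integral => //.
- by move=> t _; exact: integral_ge0.
- exact: (measurable_fun_fubini_tonelli_G (m1 := mu) (K \_ S)).
- by apply/(measurable_restrictT _ (mD _)); exact: measurable_funTS.
move=> t _; rewrite [leRHS]/patch; case: ifPn => ht.
  apply: (@le_trans _ _ (\int[mu]_x ((moll m (x - t))%:E * p t))%E).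
    apply: ge0_le_integral => //.
    - exact: (measurableT_comp mKS (measurable_pair2 t)).
    - exact: (measurableT_comp mK (measurable_pair2 t)).
    - by move=> x _; rewrite /patch; case: ifP => // _; exact: (K0 (x, t)).
  rewrite ge0_integralZr//.
  - by rewrite integral_moll_shift mul1e.
  - by apply/measurable_EFinP; apply: measurableT_comp; [exact: measurable_moll|
      apply: measurable_funB => //; exact: measurable_cst].
  - by move=> x _; rewrite lee_fin moll_ge0.
rewrite integral0_eq// => x _; rewrite /patch inS; case: ifPn => // /set_mem.
move: ht; rewrite notin_setE /ball /= !sub0r !normrN => /negP; rewrite -leNgt => ht hx.
rewrite /K moll_out1 ?mul0e//=.
have := ler_normB x (x - t); rewrite subKr => h.
move: ht; rewrite -natr1 => ht; lra.
Qed.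

Lemma integral_smear_le m n (P : T2 -> \bar R) : measurable_fun setT P ->
  (forall x, 0 <= P x)%E ->
  (\int[leb2]_(x in ballN2 n) \int[mu]_t ((moll m (x.2 - t))%:E * P (x.1, t)) <=
   \int[leb2]_(x in ballN2 n.+1) P x)%E.
Proof.
move=> mP P0.
have mD k : measurable (D k) by exact: measurable_ball1.
pose F (p : T2 * T1) : \bar R := ((moll m (p.1.2 - p.2))%:E * P (p.1.1, p.2))%E.
have F0 p : (0 <= F p)%E by rewrite mule_ge0// lee_fin moll_ge0.
have mF : measurable_fun setT F.
  apply: emeasurable_funM.
    apply/measurable_EFinP; apply: measurableT_comp; first exact: measurable_moll.
    apply: measurable_funB; last exact: measurable_snd.
    by apply: measurableT_comp; [exact: measurable_snd|exact: measurable_fst].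
  apply: measurableT_comp => //; apply: measurable_fun_pair; last exact: measurable_snd.
  by apply: measurableT_comp; [exact: measurable_fst|exact: measurable_fst].
have mG : measurable_fun setT (fun x : T2 => \int[mu]_t F (x, t))%E.
  exact: (measurable_fun_fubini_tonelli_F (m2 := mu) F).
rewrite (@box_tonelli1 R n (fun x => \int[mu]_t F (x, t))%E)//; last first.
  by move=> x; exact: integral_ge0.
rewrite box_tonelli1//.
(* Smearing acts on the second variable only; the first interval is enlarged merely to recover a
   box. *)
apply: (@le_trans _ _ (\int[mu]_(x1 in D n) \int[mu]_(x2 in D n.+1) P (x1, x2))%E); last first.
  apply: ge0_subset_integral => //.
  - by apply: measurable_funTS; exact: measurable_strip.
  - by move=> x _; exact: integral_ge0.
  - by apply: le_ball; rewrite ler_nat.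
apply: ge0_le_integral => //.
- by move=> x _; apply: integral_ge0 => y _; exact: integral_ge0.
- apply: measurable_funTS; apply: (@measurable_strip n (fun x => \int[mu]_t F (x, t))%E) => //.
  by move=> x; exact: integral_ge0.
- by apply: measurable_funTS; exact: measurable_strip.
move=> x1 _; apply: (@integral_smear1_le m n (fun t => P (x1, t))) => //.
exact: (measurableT_comp mP (measurable_pair1 x1)).
Qed.

Lemma measurable_dev2' m h : measurable_fun setT h ->
  measurable_fun setT (fun x : T2 => dev m (fun t => h (x.1, t)) x.2).
Proof.
move=> mh; pose sw (x : T2) : T2 := (x.2, x.1).
have msw : measurable_fun setT sw.
  by apply: measurable_fun_pair; [exact: measurable_snd|exact: measurable_fst].
exact: (measurableT_comp (measurable_dev2 m (measurableT_comp mh msw)) msw).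
Qed.

Lemma mollify_cvg_ereal h n : bdd h ->
  (\int[leb2]_(x in ballN2 n) (`|convol h (rho m) x - h x|)%:E)%E
   @[m --> \oo] --> (0 : \bar R)%E.
Proof.
move=> bh; have [mh [B hB]] := bh.
pose sw (x : T2) : T2 := (x.2, x.1).
have msw : measurable_fun setT sw.
  by apply: measurable_fun_pair; [exact: measurable_snd|exact: measurable_fst].
pose P m (x : T2) := dev m (fun s => h (s, x.2)) x.1.
pose S m (x : T2) := dev m (fun t => h (x.1, t)) x.2.
have mP m : measurable_fun setT (P m) by exact: measurable_dev2.
have mS m : measurable_fun setT (S m) by exact: measurable_dev2'.
have P0 m x : (0 <= P m x)%E by exact: dev_ge0.
have S0 m x : (0 <= S m x)%E by exact: dev_ge0.
have cP : (\int[leb2]_(x in ballN2 n.+1) P m x)%E @[m --> \oo] --> (0 : \bar R)%E.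
  under eq_fun do rewrite box_tonelli2//.
  exact: iterated_dev_cvg mh hB.
have cS : (\int[leb2]_(x in ballN2 n) S m x)%E @[m --> \oo] --> (0 : \bar R)%E.
  under eq_fun do rewrite box_tonelli1//.
  (* Exchanging the coordinates turns the deviation in the second variable into one in the first. *)
  exact: (@iterated_dev_cvg R (h \o sw) B n (measurableT_comp mh msw) (fun x => hB (sw x))).
pose Q m (x : T2) := (\int[mu]_t ((moll m (x.2 - t))%:E * P m (x.1, t)))%E.
have Q0 m x : (0 <= Q m x)%E.
  by apply: integral_ge0 => t _; rewrite mule_ge0// lee_fin moll_ge0.
have mQ m : measurable_fun setT (Q m).
  pose F (p : T2 * T1) : \bar R := ((moll m (p.1.2 - p.2))%:E * P m (p.1.1, p.2))%E.
  have mF : measurable_fun setT F.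
    apply: emeasurable_funM.
      apply/measurable_EFinP; apply: measurableT_comp; first exact: measurable_moll.
      apply: measurable_funB; last exact: measurable_snd.
      by apply: measurableT_comp; [exact: measurable_snd|exact: measurable_fst].
    apply: measurableT_comp => //; apply: measurable_fun_pair; last exact: measurable_snd.
    by apply: measurableT_comp; [exact: measurable_fst|exact: measurable_fst].
  apply: (measurable_fun_fubini_tonelli_F (m2 := mu) F) => //.
  by move=> p; rewrite mule_ge0// lee_fin moll_ge0.
have mbox := @measurable_box R n.
apply: (@squeeze_cvge _ _ _ _ (fun=> 0%E) _
  (fun m => \int[leb2]_(x in ballN2 n.+1) P m x + \int[leb2]_(x in ballN2 n) S m x)%E).
- near=> m; apply/andP; split; first by apply: integral_ge0 => x _; rewrite lee_fin.
  apply: (@le_trans _ _ (\int[leb2]_(x in ballN2 n) (Q m x + S m x))%E).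
    apply: ge0_le_integral => //.
    + apply/measurable_EFinP; apply: measurable_funTS; apply: measurableT_comp => //.
      apply: measurable_funB => //; apply: continuous_measurable2.
      by apply: smooth_continuous; apply: conv_smooth => //; exact: rho_test2.
    + by apply: measurable_funTS; exact: emeasurable_funD.
    + by move=> x _; exact: conv_rho_sub_le.
  rewrite ge0_integralD//; last 2 first.
  + exact: measurable_funTS.
  + exact: measurable_funTS.
  by rewrite leeD2r//; exact: integral_smear_le.
- exact: cvg_cst.
- have cPS := cvgeD (isT : ((0 : \bar R) +? 0)%E) cP cS.
  by rewrite add0e in cPS; exact: cPS.
Unshelve. all: by end_near. Qed.

Lemma mollify_cvg h n : bdd h ->
  int2 (fun x => \1_(ballN2 n : set T2) x * `|convol h (rho m) x - h x|)
   @[m --> \oo] --> (0 : R).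
Proof.
move=> bh; have H := mollify_cvg_ereal n bh.
have E m : int2 (fun x => \1_(ballN2 n : set T2) x * `|convol h (rho m) x - h x|) =
    fine (\int[leb2]_(x in ballN2 n) (`|convol h (rho m) x - h x|)%:E)%E.
  rewrite /int2 /Rintegral [in RHS]integral_mkcond; congr fine.
  apply: eq_integral => x _; rewrite /patch indicE.
  by case: (_ \in _); rewrite ?mul1r ?mul0r.
under eq_fun do rewrite E.
exact: fine_cvg H.
Qed.

(** Young's inequality in L1, by duality: the convolution of [|h|] is paired with the indicator of a
    large box, and moved onto that indicator, whose mollification is at most 1. *)
Lemma convol_contract h m : bcs h ->
  int2 (fun x => `|convol h (rho m) x|) <= int2 (fun x => `|h x|).
Proof.
move=> hb; have [bh [n nh]] := hb; have hn := bcs_norm hb.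
have tc := test2_bcs (conv_test2 hb (rho_test2 m)).
have bN := bcs_indic (R := R) n.+1.
have cs := conv_supp nh (rho_supp (m := m)).
have sc := test2_bcs (conv_test2 hn (rho_test2 m)).
apply: (@le_trans _ _ (int2 (fun x => \1_(ballN2 n.+1 : set T2) x *
    convol (fun y => `|h y|) (rho m) x))).
  apply: le_int2.
  - exact/itg_bcs/bcs_norm.
  - exact: (itg_bcs (bcsMl bN (bcs_bdd sc))).
  move=> x; rewrite indicE; have [xn|xn] := pselect (ballN2 n.+1 (x : R * R)); last first.
    rewrite (supp_in0 cs) ?normr0 ?memNset ?mul0r//.
    by rewrite addn1.
  rewrite mem_set//= mul1r; apply: le_trans (le_norm_int2 (conv_itg x bh (rho_bcs m))) _.
  rewrite le_eqVlt; apply/orP; left; apply/eqP; apply: eq_int2 => y.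
  by rewrite normrM (ger0_norm (rho_ge0 _ _)).
rewrite (conv_adjoint bN (bcs_bdd hn) (rho_bcs m)); last exact: (tsub_even (rho_even m)).
have tN := test2_bcs (conv_test2 bN (rho_test2 m)).
apply: le_int2.
- exact: (itg_bcs (bcsMl hn (bcs_bdd tN))).
- exact: itg_bcs.
move=> x; rewrite ler_piMr//.
apply: le_trans (ler_norm _) _; apply: conv_rho_le (bcs_bdd bN) _ => y.
by rewrite indicE; case: (_ \in _); rewrite ?normr1 ?normr0.
Qed.

End Mollifier2.

(** * The energy identity *)

Section Limits.
#[local] Opaque derive.
Context {R : realType}.
Local Notation T1 := (measurableTypeR R).
Local Notation T2 := (T1 * T1)%type.
Local Notation itg f := (leb2.-integrable setT (EFin \o (f : T2 -> R))).
Implicit Types (m n : nat) (h f g A : T2 -> R).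

Lemma cvg0_le (a b : nat -> R) : (forall m, `|a m| <= b m) ->
  b @ \oo --> (0 : R) -> a @ \oo --> (0 : R).
Proof.
move=> ab b0; apply/cvgrPdist_le => e e0.
have /cvgrPdist_le/(_ _ e0) := b0; apply: filterS => m.
by rewrite !sub0r !normrN => /(le_trans (ler_norm _)); apply: le_trans.
Qed.

Lemma le_norm_of_cvg0 (a b : R) (x y : nat -> R) :
  (forall m, `|a + x m| <= b + y m) ->
  x @ \oo --> (0 : R) -> y @ \oo --> (0 : R) -> `|a| <= b.
Proof.
move=> ab x0 y0; apply/ler_addgt0Pr => e e0.
have e20 : 0 < e / 2 by rewrite divr_gt0.
have /cvgrPdist_le/(_ _ e20) xe := x0.
have /cvgrPdist_le/(_ _ e20) ye := y0.
have [m [mx my]] := filter_ex (filterI xe ye).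
move: mx my (ab m); rewrite !sub0r !normrN => mx my.
have := ler_normB (a + x m) (x m); rewrite addrK => h1.
have := ler_norm (y m); lra.
Qed.

Lemma itg_loc2_sqr A n : loc2 A -> itg (fun x => \1_(ballN2 n : set T2) x * A x ^+ 2).
Proof.
move=> [mA LA]; have /integrable_mkcond := LA n.
move=> /(_ (measurable_box n)); apply: eq_integrable => //= x _.
rewrite /patch indicE; case: ifPn => _; rewrite ?mul0r// mul1r.
by rewrite real_normK ?num_real.
Qed.

(** The uniform bound upgrades L1 convergence to L2 convergence, since [g^2 <= B |g|].
    Cauchy-Schwarz appears as [|A g| <= d A^2 + g^2 / d], with [d] fixed before [m]. *)
Lemma loc2_cvg0 A (g : nat -> T2 -> R) (B : R) n : loc2 A ->
  (forall m, bcs (g m)) -> (forall m x, `|g m x| <= B) -> (forall m, supp_in n (g m)) ->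
  int2 (fun x => `|g m x|) @[m --> \oo] --> (0 : R) ->
  int2 (fun x => A x * g m x) @[m --> \oo] --> (0 : R).
Proof.
move=> LA bg gB gn g0; apply/cvgrPdist_le => e e0.
have B0 : 0 <= B by exact: le_trans (gB 0%N (0, 0)).
pose K := int2 (fun x => \1_(ballN2 n : set T2) x * A x ^+ 2).
have K0 : 0 <= K by apply: int2_ge0 => x; rewrite mulr_ge0// ?sqr_ge0// indicE.
(* With this [d] the term in [A^2] is at most [e / 2]; the threshold [ed0] on the L1 norm does the
   same for the other term. The added ones keep the denominators positive. *)
pose d := e / (2 * (K + 1)).
have d0 : 0 < d by rewrite divr_gt0// mulr_gt0// ltr_wpDl.
have ed0 : 0 < e * d / (2 * (B + 1)) by apply: divr_gt0; [exact: mulr_gt0|rewrite mulr_gt0// ltr_wpDl].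
have /cvgrPdist_le/(_ _ ed0) := g0; apply: filterS => m.
rewrite !sub0r !normrN => gm.
have iA := itg_loc2_sqr n LA.
have ng := bcs_norm (bg m).
have i1 : itg (fun x => d * (\1_(ballN2 n : set T2) x * A x ^+ 2)).
  exact: (integrableZl measurableT d iA).
have i2 : itg (fun x => (B / d) * `|g m x|) := itg_bcs (bcsMr (bdd_cst (B / d)) ng).
have iAg := itg_loc2 LA (bg m).
apply: le_trans (le_norm_int2 iAg) _.
apply: (@le_trans _ _ (d * K + (B / d) * int2 (fun x => `|g m x|))).
  rewrite /K -(int2Z d iA) -(int2Z (B / d) (itg_bcs ng)) -(int2D i1 i2).
  apply: le_int2; first exact: integrable_norm iAg.
    exact: (integrableD measurableT i1 i2).
  move=> x; have [xn|xn] := pselect (ballN2 n (x : R * R)); last first.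
    rewrite (supp_in0 (gn m) xn) mulr0 !normr0 mulr0 addr0.
    apply: mulr_ge0; first exact: ltW.
    by apply: mulr_ge0; [rewrite indicE|exact: sqr_ge0].
  rewrite indicE mem_set//= mul1r normrM -[A x ^+ 2]real_normK ?num_real//.
  have := gB m x; have := normr_ge0 (g m x); have := normr_ge0 (A x).
  move: `|A x| `|g m x| => a b a0 b0 bB.
  have H : b ^+ 2 / d <= B / d * b.
    rewrite [leRHS]mulrAC; apply: ler_wpM2r; first by rewrite invr_ge0 ltW.
    by rewrite expr2; exact: ler_wpM2r.
  apply: le_trans (lerD (lexx _) H).
  rewrite -subr_ge0 (_ : _ - _ = d * ((a - b / (2 * d)) ^+ 2 + 3 / 4 * (b / d) ^+ 2)).
    apply: mulr_ge0; first exact: ltW.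
    apply: addr_ge0; first exact: sqr_ge0.
    by apply: mulr_ge0; [rewrite divr_ge0|exact: sqr_ge0].
  by field; rewrite gt_eqF.
have H1 : d * K <= e / 2.
  rewrite /d mulrAC ler_pdivrMr ?mulr_gt0 ?ltr_wpDl//.
  rewrite [leRHS](_ : _ = e * (K + 1)); last by field.
  by apply: ler_wpM2l; [exact: ltW|rewrite lerDl].
have H2 : B / d * int2 (fun x => `|g m x|) <= e / 2.
  apply: (@le_trans _ _ (B / d * (e * d / (2 * (B + 1))))).
    apply: ler_wpM2l; first by apply: divr_ge0 => //; exact: ltW.
    by apply: le_trans gm; exact: ler_norm.
  rewrite [leLHS](_ : _ = (e / 2) * (B / (B + 1))); last by field; rewrite !gt_eqF// ltr_wpDl.
  apply: ler_piMr; first by apply: divr_ge0 => //; exact: ltW.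
  by rewrite ler_pdivrMr ?ltr_wpDl// mul1r lerDl.
by lra.
Qed.

Lemma convolBl h f k x : bdd h -> bdd f -> bcs k ->
  convol (fun y => h y - f y) k x = convol h k x - convol f k x.
Proof.
move=> bh bf bk; rewrite /convol -(int2B (conv_itg x bh bk) (conv_itg x bf bk)).
by apply: eq_int2 => y; rewrite mulrBl.
Qed.

End Limits.

Section Energy.
#[local] Opaque derive int2 convol.
Context {R : realType}.
Local Notation T1 := (measurableTypeR R).
Local Notation T2 := (T1 * T1)%type.
Local Notation itg f := (leb2.-integrable setT (EFin \o (f : T2 -> R))).
Implicit Types (m n : nat) (h f g : T2 -> R).

Definition dirichlet f : R := int2 (grad_dot f f).

Lemma grad_dot_bcs f : test2 f -> bcs (grad_dot f f).
Proof.
move=> tf; have b1 := test2_bcs (test2_derive e1 tf).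
have b2 := test2_bcs (test2_derive e2 tf).
exact: (bcsD (bcsMl b1 (bcs_bdd b1)) (bcsMl b2 (bcs_bdd b2))).
Qed.

(** [W] will be [Q - E0]: the form bounds become nonnegativity, and the equation reads lap psi = W
    psi in the weak sense. *)
Variables (W V psi : T2 -> R) (M : R).
Hypotheses (LW : loc2 W) (LV : loc2 V) (bpsi : bdd psi).
Hypothesis psiM : forall x, `|psi x| <= M.
Hypothesis Hplus : forall f, test2 f ->
  0 <= int2 (fun x => grad_dot f f x + (W x + V x) * f x ^+ 2).
Hypothesis Hminus : forall f, test2 f ->
  0 <= int2 (fun x => grad_dot f f x + (W x - V x) * f x ^+ 2).
Hypothesis Hdist : forall f, test2 f ->
  int2 (fun x => psi x * lap f x) = int2 (fun x => W x * (psi x * f x)).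

Let u m : T2 -> R := convol psi (rho m).

Let su m : smooth (u m).
Proof. exact: conv_smooth bpsi (rho_test2 m). Qed.

Let uM m x : `|u m x| <= M.
Proof. exact: conv_rho_le bpsi psiM. Qed.

Let bu m : bdd (u m).
Proof.
split; last by exists M.
by apply: continuous_measurable2; exact: smooth_continuous.
Qed.

Let w f m : T2 -> R := fun x => f x * (f x * u m x).

Let tw f m : test2 f -> test2 (w f m).
Proof. by move=> tf; exact: (test2_mul tf (smoothM (test2_smooth tf) (su m))). Qed.

(* psi solves the equation and its mollification u only approximately does:
   W * defect is the resulting error in the ground state representation. *)
Let defect f m : T2 -> R := fun x =>
  w f m x * u m x - psi x * convol (w f m) (rho m) x.

Let defect_bcs f m : test2 f -> bcs (defect f m).
Proof.
move=> tf; have bw := test2_bcs (tw m tf).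
have bc := test2_bcs (conv_test2 bw (rho_test2 m)).
exact: (bcsB (bcsMl bw (bu m)) (bcsMr bpsi bc)).
Qed.

(** Jacobi's identity behind the ground state representation: |grad(f v)|^2 = v^2 |grad f|^2 +
    grad(f^2 v) . grad v. The last term is the weak Laplacian of [v] tested against f^2 v. *)
Lemma grad_dot_mul (f v : R * R -> R) x : smooth f -> smooth v ->
  grad_dot (fun x => f x * v x) (fun x => f x * v x) x =
  v x ^+ 2 * grad_dot f f x + grad_dot (fun x => f x * (f x * v x)) v x.
Proof.
move=> sf sv; have sfv := smoothM sf sv.
have df := smooth_diff sf; have dv := smooth_diff sv; have dfv := smooth_diff sfv.
have E1 z : 'D_z (fun y => f y * v y) x = f x * 'D_z v x + v x * 'D_z f x.
  exact: (congr1 (fun k => k x) (derive_mulE z df dv)).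
have E2 z : 'D_z (fun y => f y * (f y * v y)) x =
    f x * (f x * 'D_z v x + v x * 'D_z f x) + (f x * v x) * 'D_z f x.
  by rewrite -E1; exact: (congr1 (fun k => k x) (derive_mulE z df dfv)).
rewrite /grad_dot !E1 !E2.
move: (f x) (v x) ('D_e1 f x) ('D_e2 f x) ('D_e1 v x) ('D_e2 v x) => a b c d p q.
by ring.
Qed.

(** Green's formula turns the last term of [grad_dot_mul] into the pairing of [w f m] with
    [lap (u m)]. As the latter is psi convolved with [lap (rho m)], adjointness tests the equation
    of psi with the mollification of [w f m]. The result contains psi times that mollification where
    [w f m] times [u m] would be needed to cancel the potential; the difference is [defect]. *)
Lemma energy_identity f m : test2 f ->
  int2 (fun x => grad_dot (fun y => f y * u m y) (fun y => f y * u m y) x +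
    W x * (f x * u m x) ^+ 2) =
  int2 (fun x => u m x ^+ 2 * grad_dot f f x) + int2 (fun x => W x * defect f m x).
Proof.
move=> tf; have tW := tw m tf; have bw := test2_bcs tW.
have tc := conv_test2 bw (rho_test2 m); have bc := test2_bcs tc.
have b1 : bcs (fun x => u m x ^+ 2 * grad_dot f f x) :=
  bcsMr (bdd_sqr (bu m)) (grad_dot_bcs tf).
have s1 := smooth_derive e1 (su m); have s2 := smooth_derive e2 (su m).
have b2 : bcs (grad_dot (w f m) (u m)) :=
  bcsD (smooth_bcs (test2_derive e1 tW) s1) (smooth_bcs (test2_derive e2 tW) s2).
have b3 : bcs (fun x => w f m x * u m x) := bcsMl bw (bu m).
have b4 : bcs (fun x => psi x * convol (w f m) (rho m) x) := bcsMr bpsi bc.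
have i3 := itg_loc2 LW b3; have i4 := itg_loc2 LW b4.
have E : int2 (grad_dot (w f m) (u m)) =
    - int2 (fun x => W x * (psi x * convol (w f m) (rho m) x)).
  apply: (etrans (green tW (su m))); apply: (congr1 -%R); apply: (etrans _ (Hdist tc)).
  have H := conv_adjoint bw bpsi (test2_bcs (test2_lap (rho_test2 m))).
  have E1 x : w f m x * lap (u m) x = w f m x * convol psi (lap (rho m)) x.
    exact: (congr1 (fun t => w f m x * t) (conv_lap x bpsi (rho_test2 m))).
  have E2 x : psi x * convol (w f m) (lap (rho m)) x = psi x * lap (convol (w f m) (rho m)) x.
    exact: (congr1 (fun t => psi x * t) (esym (conv_lap x (bcs_bdd bw) (rho_test2 m)))).
  apply: (etrans (eq_int2 E1)); apply: etrans (eq_int2 E2); apply: H.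
  apply: tsub_even; apply: even_lap; last exact: rho_even.
  exact: test2_smooth (rho_test2 m).
have E3 x : grad_dot (fun y => f y * u m y) (fun y => f y * u m y) x +
    W x * (f x * u m x) ^+ 2 =
    (u m x ^+ 2 * grad_dot f f x + grad_dot (w f m) (u m) x) + W x * (w f m x * u m x).
  rewrite (grad_dot_mul x (test2_smooth tf) (su m)); congr (_ + W x * _).
  by rewrite /w exprMn !expr2 !mulrA.
apply: (etrans (eq_int2 E3)).
rewrite (int2D (itg_bcs (bcsD b1 b2)) i3) (int2D (itg_bcs b1) (itg_bcs b2)) E.
rewrite -addrA; congr (_ + _); rewrite addrC -(int2B i3 i4).
by apply: eq_int2 => x; rewrite -mulrBr.
Qed.

Lemma dirichlet_weight_le f m : test2 f ->
  int2 (fun x => u m x ^+ 2 * grad_dot f f x) <= M ^+ 2 * dirichlet f.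
Proof.
move=> tf; have bg := grad_dot_bcs tf.
rewrite /dirichlet -(int2Z _ (itg_bcs bg)); apply: le_int2.
- exact: (itg_bcs (bcsMr (bdd_sqr (bu m)) bg)).
- exact: (itg_bcs (bcsMr (bdd_cst _) bg)).
move=> x; apply: ler_wpM2r; first by rewrite addr_ge0// -expr2 sqr_ge0.
rewrite -[leLHS]real_normK ?num_real// lerXn2r ?nnegrE//.
exact: le_trans (uM m x).
Qed.

Lemma potential_bound_approx f m : test2 f ->
  `|int2 (fun x => V x * (f x * u m x) ^+ 2)| <=
  M ^+ 2 * dirichlet f + int2 (fun x => W x * defect f m x).
Proof.
move=> tf; have tphi := test2_mul tf (su m).
have bphi := bcs_sqr (test2_bcs tphi); have bg := grad_dot_bcs tphi.
have iW := itg_loc2 LW bphi; have iV := itg_loc2 LV bphi.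
have iGW : itg (fun x => grad_dot (fun y => f y * u m y) (fun y => f y * u m y) x +
    W x * (f x * u m x) ^+ 2) := integrableD measurableT (itg_bcs bg) iW.
apply: le_trans (lerD (dirichlet_weight_le m tf) (lexx _)).
rewrite -(energy_identity m tf) ler_norml; apply/andP; split.
  rewrite -subr_ge0 opprK addrC -(int2D iGW iV).
  rewrite (eq_int2 (g := fun x => grad_dot (fun y => f y * u m y) (fun y => f y * u m y) x +
     (W x + V x) * (f x * u m x) ^+ 2)); first exact: Hplus.
  by move=> x; rewrite mulrDl addrA.
rewrite -subr_ge0 -(int2B iGW iV).
rewrite (eq_int2 (g := fun x => grad_dot (fun y => f y * u m y) (fun y => f y * u m y) x +
   (W x - V x) * (f x * u m x) ^+ 2)); first exact: Hminus.
by move=> x; rewrite mulrBl addrA.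
Qed.

Let conv_uu n : int2 (fun x => \1_(ballN2 n : set T2) x * `|u m x - psi x|)
  @[m --> \oo] --> (0 : R).
Proof. exact: mollify_cvg. Qed.

Let bcs_loc n (h : T2 -> R) : bdd h -> bcs (fun x => \1_(ballN2 n : set T2) x * `|h x|).
Proof.
move=> [mh [B hB]]; apply: (bcsMl (bcs_indic n)); split.
  exact: measurableT_comp.
by exists B => x; rewrite normr_id.
Qed.

(** Since [w f m] changes with [m], convergence of mollifications is applied to the fixed function k
    = f^2 psi. The difference l = k - w is bounded by a multiple of |u - psi|, and its mollification
    is controlled by [convol_contract]. *)
Lemma defect_cvg f : test2 f -> int2 (fun x => `|defect f m x|) @[m --> \oo] --> (0 : R).
Proof.
move=> tf; have bf := test2_bcs tf.
have [[_ [F fF]] [n nf]] := bf.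
have F0 : 0 <= F by exact: le_trans (fF (0, 0)).
have M0 : 0 <= M by exact: le_trans (psiM (0, 0)).
pose k x := f x * (f x * psi x).
have bk : bcs k := bcsMl bf (bddM (bcs_bdd bf) bpsi).
pose one : T2 -> R := \1_(ballN2 n.+1 : set T2).
pose d m := int2 (fun x => one x * `|u m x - psi x|).
pose e m := int2 (fun x => one x * `|convol k (rho m) x - k x|).
have d0 : d @ \oo --> (0 : R) by exact: conv_uu.
have e0 : e @ \oo --> (0 : R) by apply: mollify_cvg; exact: bcs_bdd.
(* One multiple of [F ^+ 2 * M] comes from each of w (u - psi), psi l, and psi times the
   mollification of l. *)
pose c1 := 3 * F ^+ 2 * M.
apply: (@cvg0_le _ _ (fun m => c1 * d m + M * e m)); last first.
  rewrite -[X in _ --> X](_ : c1 * 0 + M * 0 = 0); last by rewrite !mulr0 addr0.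
  by apply: cvgD; apply: cvgMr.
move=> m; rewrite ger0_norm; last by apply: int2_ge0 => x.
have bw := test2_bcs (tw m tf).
pose l x := k x - w f m x.
have bl : bcs l := bcsB bk bw.
have tl := conv_test2 bl (rho_test2 m).
have b1 := bcs_loc n.+1 (bddB (bu m) bpsi).
have bck := bcs_bdd (test2_bcs (conv_test2 bk (rho_test2 m))).
have b2 := bcs_loc n.+1 (bddB bck (bcs_bdd bk)).
have b3 := bcs_norm (test2_bcs tl).
have P1 := bcsMr (bdd_cst (2 * F ^+ 2 * M)) b1.
have P2 := bcsMr (bdd_cst M) b2.
have P3 := bcsMr (bdd_cst M) b3.
have wF x : `|w f m x| <= F ^+ 2 * M.
  by rewrite /w !normrM mulrA expr2; apply: ler_pM => //; exact: ler_pM.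
have lF x : `|l x| <= F ^+ 2 * (one x * `|u m x - psi x|).
  rewrite /l /k /w -!mulrBr !normrM distrC mulrA.
  have [xn|xn] := pselect (ballN2 n.+1 (x : R * R)).
    rewrite /one indicE mem_set//= mul1r; apply: ler_wpM2r => //.
    by rewrite expr2; exact: ler_pM.
  rewrite (supp_in0 nf) ?normr0 ?mul0r; first by rewrite mulr_ge0 ?sqr_ge0// mulr_ge0// /one indicE.
  by move=> xn'; apply: xn; apply: ballN2W xn'.
have H : int2 (fun x => `|convol l (rho m) x|) <= F ^+ 2 * d m.
  apply: le_trans (convol_contract m bl) _.
  rewrite /d -(int2Z _ (itg_bcs b1)); apply: le_int2 => //.
    exact: (itg_bcs (bcs_norm bl)).
  exact: (itg_bcs (bcsMr (bdd_cst (F ^+ 2)) b1)).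
apply: (@le_trans _ _ (2 * F ^+ 2 * M * d m + M * e m + M * int2 (fun x => `|convol l (rho m) x|))).
  rewrite /d /e -(int2Z _ (itg_bcs b1)) -(int2Z M (itg_bcs b2)) -(int2Z M (itg_bcs b3)).
  rewrite -(int2D (itg_bcs P1) (itg_bcs P2)) -(int2D (itg_bcs (bcsD P1 P2)) (itg_bcs P3)).
  apply: le_int2.
  - exact: (itg_bcs (bcs_norm (defect_bcs m tf))).
  - exact: (itg_bcs (bcsD (bcsD P1 P2) P3)).
  move=> x; have E : defect f m x =
      w f m x * (u m x - psi x) + psi x * ((k x - convol k (rho m) x) - l x + convol l (rho m) x).
    have := convolBl x (bcs_bdd bk) (bcs_bdd bw) (rho_bcs m) => ->.
    rewrite /defect /l; move: (w f m x) (u m x) (psi x) (k x) (convol _ _ _) (convol _ _ _).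
    by move=> a1 a2 a3 a4 a5 a6; ring.
  have [xn|xn] := pselect (ballN2 n.+1 (x : R * R)); last first.
    have wn : supp_in n (w f m) by move=> y; rewrite mulf_eq0 negb_or => /andP[/nf].
    have cw : convol (w f m) (rho m) x = 0.
      by apply: (supp_in0 (conv_supp wn (rho_supp (m := m)))); rewrite addn1.
    have w0 : w f m x = 0.
      by apply: (supp_in0 wn) => xn'; apply: xn; apply: ballN2W xn'.
    rewrite /defect cw w0 mul0r mulr0 subr0 normr0.
    by rewrite !addr_ge0// !mulr_ge0// ?sqr_ge0// /one indicE.
  have one1 : one x = 1 by rewrite /one indicE mem_set.
  have := lF x; rewrite E one1 !mul1r => lFx.
  have -> : \1_(ballN2 n.+1 : set T2) x = 1 :> R by exact: one1.
  rewrite !mul1r; apply: le_trans (ler_normD _ _) _.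
  rewrite (normrM (w f m x)) (normrM (psi x)).
  have A1 : `|w f m x| * `|u m x - psi x| <= F ^+ 2 * M * `|u m x - psi x| by exact: ler_wpM2r.
  have A2 : `|psi x| * `|k x - convol k (rho m) x - l x + convol l (rho m) x| <=
     M * (`|convol k (rho m) x - k x| + `|l x| + `|convol l (rho m) x|).
    apply: ler_pM => //; apply: le_trans (ler_normD _ _) _; rewrite lerD2r.
    by apply: le_trans (ler_normB _ _) _; rewrite lerD2r distrC.
  have A3 := ler_wpM2l M0 lFx.
  move: A1 A2 A3; move: (`|_ - psi x|) (`|convol k _ x - k x|) (`|convol l _ x|) => r1 r2 r3.
  rewrite !mulrDr => A1 A2 A3.
  apply: le_trans (lerD A1 A2) _; rewrite -!addrA -subr_ge0.
  rewrite (_ : _ - _ = M * (F ^+ 2 * r1) - M * `|l x|); last by ring.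
  by rewrite subr_ge0.
apply: le_trans (lerD (lexx _) (ler_wpM2l M0 H)) _.
by rewrite le_eqVlt; apply/orP; left; apply/eqP; rewrite /c1; ring.
Qed.

(** Limit of [potential_bound_approx]: the errors multiplying [V] and [W] are uniformly bounded,
    stay in a fixed box and vanish in L1, so [loc2_cvg0] disposes of both. *)
Lemma potential_bound f : test2 f ->
  `|int2 (fun x => V x * (f x * psi x) ^+ 2)| <= M ^+ 2 * dirichlet f.
Proof.
move=> tf; have bf := test2_bcs tf.
have [[_ [F fF]] [n nf]] := bf.
have F0 : 0 <= F by exact: le_trans (fF (0, 0)).
have M0 : 0 <= M by exact: le_trans (psiM (0, 0)).
pose g m x := (f x * u m x) ^+ 2 - (f x * psi x) ^+ 2.
have b1 m : bcs (fun x => (f x * u m x) ^+ 2) := bcs_sqr (bcsMl bf (bu m)).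
have b2 : bcs (fun x => (f x * psi x) ^+ 2) := bcs_sqr (bcsMl bf bpsi).
have bg m : bcs (g m) := bcsB (b1 m) b2.
have bnd x y : `|y| <= M -> `|f x * y| <= F * M by move=> yM; rewrite normrM; exact: ler_pM.
have gE m x : `|g m x| = `|f x| ^+ 2 * (`|u m x - psi x| * `|u m x + psi x|).
  by rewrite /g !exprMn -mulrBr subr_sqr !normrM.
have gB m x : `|g m x| <= (F * M) ^+ 2 + (F * M) ^+ 2.
  apply: le_trans (ler_normB _ _) _; rewrite !normrX.
  by apply: lerD; rewrite lerXn2r ?nnegrE ?mulr_ge0// bnd.
have gn m : supp_in n (g m).
  move=> x h; apply: nf; apply: contra_neq h => f0.
  by rewrite /g f0 !mul0r subrr.
have g0 : int2 (fun x => `|g m x|) @[m --> \oo] --> (0 : R).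
  apply: (@cvg0_le _ _ (fun m => F ^+ 2 * (2 * M) *
     int2 (fun x => \1_(ballN2 n : set T2) x * `|u m x - psi x|))); last first.
    rewrite -[X in _ --> X](mulr0 (F ^+ 2 * (2 * M))); apply: cvgMr; exact: conv_uu.
  move=> m; rewrite ger0_norm; last by apply: int2_ge0 => x.
  have c1 := bcs_loc n (bddB (bu m) bpsi).
  rewrite -(int2Z _ (itg_bcs c1)); apply: le_int2.
  - exact: (itg_bcs (bcs_norm (bg m))).
  - exact: (itg_bcs (bcsMr (bdd_cst _) c1)).
  move=> x; have [xn|xn] := pselect (ballN2 n (x : R * R)); last first.
    rewrite (supp_in0 (gn m) xn) normr0.
    by rewrite !mulr_ge0// ?sqr_ge0// indicE.
  rewrite indicE mem_set//= mul1r gE.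
  rewrite [leRHS](_ : _ = F ^+ 2 * (`|u m x - psi x| * (2 * M))); last by ring.
  apply: ler_pM; [exact: sqr_ge0|exact: mulr_ge0|by rewrite lerXn2r ?nnegrE|].
  apply: ler_wpM2l => //; apply: le_trans (ler_normD _ _) _.
  by rewrite mulrDl mul1r; exact: lerD.
have iV := itg_loc2 LV b2.
apply: (@le_norm_of_cvg0 _ _ _ (fun m => int2 (fun x => V x * g m x))
    (fun m => int2 (fun x => W x * defect f m x))).
- move=> m; have iVg := itg_loc2 LV (bg m).
  rewrite -(int2D iV iVg).
  rewrite [X in `|X|](_ : _ = int2 (fun x => V x * (f x * u m x) ^+ 2)).
    exact: potential_bound_approx.
  by apply: eq_int2 => x; rewrite -mulrDr /g addrCA subrr addr0.
- exact: (loc2_cvg0 LV bg gB gn g0).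
- have wn m : supp_in n (w f m) by move=> y; rewrite mulf_eq0 negb_or => /andP[/nf].
  apply: (@loc2_cvg0 _ W (defect f) (F ^+ 2 * M * M + M * (F ^+ 2 * M)) n.+1 LW).
  + by move=> m; exact: defect_bcs.
  + move=> m x; apply: le_trans (ler_normB _ _) _.
    rewrite (normrM (w f m x)) (normrM (psi x)).
    have wF y : `|w f m y| <= F ^+ 2 * M.
      by rewrite /w !normrM mulrA expr2; apply: ler_pM => //; exact: ler_pM.
    apply: lerD; first by apply: ler_pM.
    have wC := @conv_rho_le R (w f m) m (F ^+ 2 * M) x (bcs_bdd (test2_bcs (tw m tf))) wF.
    exact: (ler_pM (normr_ge0 _) (normr_ge0 _) (psiM x) wC).
  + move=> m x h; apply: contrapT => xn; move/eqP: h; apply.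
    have cw : convol (w f m) (rho m) x = 0.
      by apply: (supp_in0 (conv_supp (wn m) (rho_supp (m := m)))); rewrite addn1.
    have w0 : w f m x = 0.
      by apply: (supp_in0 (wn m)) => xn'; apply: xn; apply: ballN2W xn'.
    by rewrite /defect cw w0 mul0r mulr0 subr0.
  + exact: defect_cvg.
Qed.

End Energy.

(** * Logarithmic cutoffs *)

Section Cutoff.
#[local] Opaque derive.
Context {R : realType}.
Local Notation T1 := (measurableTypeR R).
Local Notation T2 := (T1 * T1)%type.
Local Notation itg f := (leb2.-integrable setT (EFin \o (f : T2 -> R))).
Implicit Types (k m n : nat) (h f g : T2 -> R).

(** The kernel has radius 1, so [chi] equals 1 on the unit box (1 = 2 - 1) and vanishes off box 3 (3
    = 2 + 1). Because 3 < 4, its dilations by powers of 4 have gradients on disjoint annuli. *)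
Definition chi : T2 -> R := convol (\1_(ballN2 2 : set T2)) (rho 0).

Lemma chi_test2 : test2 chi.
Proof. by apply: conv_test2; [exact: bcs_indic|exact: rho_test2]. Qed.

Lemma chi_supp : supp_in 3 chi.
Proof.
apply: (@conv_supp _ _ _ 2 1); last exact: rho_supp.
by move=> x; rewrite indicE pnatr_eq0 eqb0 negbK => /set_mem.
Qed.

Lemma chi1 (x : R * R) : `|x| < 1 -> chi x = 1.
Proof.
rewrite prod_normE gt_max => /andP[x1 x2].
rewrite -(int2_rho 0 x) /chi /convol; apply: eq_int2 => y.
have [->|/(@rho_supp _ 0) ry] := eqVneq (rho 0 (tsub x y)) 0; first by rewrite mulr0.
rewrite indicE mem_set ?mul1r//; apply: (@box_tsub _ 1 1 x) => //.
by apply/ballN2P.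
Qed.

Definition cutoff k (x : T2) : R := chi ((4%:R ^+ k)^-1 *: (x : R * R)).

Lemma cutoff_smooth k : smooth (cutoff k : R * R -> R).
Proof. exact: (smooth_dilation _ (test2_smooth chi_test2)). Qed.

Lemma pow4_gt0 k : 0 < 4%:R ^+ k :> R. Proof. by rewrite exprn_gt0. Qed.

Lemma cutoff_test2 k : test2 (cutoff k).
Proof.
apply/test2P; split; first exact: cutoff_smooth.
exists (3 * 4 ^ k)%N => x /chi_supp /ballN2P[/= x1 x2]; apply/ballN2P.
move: x1 x2; rewrite /GRing.scale/= !normrM ger0_norm ?invr_ge0 ?ltW ?pow4_gt0//.
by rewrite !ltr_pdivrMl ?pow4_gt0// natrM natrX mulrC.
Qed.

Lemma cutoff1 k (x : R * R) : `|x| < 4%:R ^+ k -> cutoff k x = 1.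
Proof.
move=> xk; apply: chi1; rewrite normrZ ger0_norm ?invr_ge0 ?ltW ?pow4_gt0//.
by rewrite ltr_pdivrMl ?pow4_gt0// mulr1.
Qed.

Lemma cutoff_derive0 k v (x : R * R) : `|x| < 4%:R ^+ k -> 'D_v (cutoff k) x = 0.
Proof.
move=> xk; rewrite (@near_eq_derive _ _ _ (cutoff k : R * R -> R) (cst 1)).
  exact: derive_cst.
near=> y; apply: cutoff1; near: y.
exact: (cvgr_lt `|x| (@norm_continuous _ _ x)).
Unshelve. all: by end_near. Qed.

Lemma cutoff_derive_out k v (x : R * R) : 3 * 4%:R ^+ k < `|x| -> 'D_v (cutoff k) x = 0.
Proof.
move=> xk; apply: (@derivative_out _ (3 * 4 ^ k)%N); last by rewrite natrM natrX.
by have /test2P[_ _] := cutoff_test2 k; move=> y /chi_supp /ballN2P[/= x1 x2];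
  apply/ballN2P; move: x1 x2; rewrite /GRing.scale/= !normrM ger0_norm ?invr_ge0 ?ltW ?pow4_gt0//;
  rewrite !ltr_pdivrMl ?pow4_gt0// natrM natrX mulrC.
Qed.

Lemma leb2_boxE n : fine (leb2 (ballN2 n : set T2)) = (n%:R *+ 2) ^+ 2.
Proof.
rewrite box_setX.
have -> : leb2 (ball (0:R) n%:R `*` ball (0:R) n%:R) =
    (lebesgue_measure (ball 0%R n%:R : set R) * lebesgue_measure (ball 0%R n%:R : set R))%E.
  by apply: product_measure1E; exact: measurable_ball1.
have -> : lebesgue_measure (ball (0:R) n%:R) = (n%:R *+ 2)%:E.
  exact: lebesgue_measure_ball.
by [].
Qed.

(** Scale invariance in the plane: under dilation by 4^k the squared gradient shrinks by 16^k and
    the area grows by 16^k. *)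
Lemma cutoff_dirichlet : exists C : R, 0 <= C /\ forall k, dirichlet (cutoff k) <= C.
Proof.
have [B1 hB1] := test2_bounded (test2_derive e1 chi_test2).
have [B2 hB2] := test2_bounded (test2_derive e2 chi_test2).
(* 64 * 16^k is the area of the open box of radius 4 * 4^k; radius 4 leaves room beyond 3, outside
   of which the derivatives are known to vanish. *)
exists ((B1 ^+ 2 + B2 ^+ 2) * 64); split; first by rewrite mulr_ge0// addr_ge0// sqr_ge0.
move=> k.
have bg := grad_dot_bcs (cutoff_test2 k).
pose r := (4%:R ^+ k)^-1 : R.
have r0 : 0 < r by rewrite invr_gt0 pow4_gt0.
pose n := (4 * 4 ^ k)%N.
have bn := bcs_indic (R := R) n.
have -> : (B1 ^+ 2 + B2 ^+ 2) * 64 = int2 (fun x => (r ^+ 2 * (B1 ^+ 2 + B2 ^+ 2)) * \1_(ballN2 n : set T2) x).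
  rewrite (int2Z _ (itg_bcs bn)) int2_indic leb2_boxE /n natrM natrX /r.
  rewrite -mulr_natr; have := gt_eqF (pow4_gt0 k); move: (4%:R ^+ k) => q q0.
  by field; rewrite q0.
apply: le_int2.
- exact: (itg_bcs bg).
- exact: (itg_bcs (bcsMr (bdd_cst _) bn)).
move=> x; have DE v : 'D_v (cutoff k) x = r * 'D_v chi (r *: (x : R * R)).
  exact: (congr1 (fun t => t x) (derive_dilationE r v (smooth_diff (test2_smooth chi_test2)))).
have [xn|xn] := pselect (ballN2 n (x : R * R)).
  rewrite indicE mem_set//= mulr1 /grad_dot (DE e1) (DE e2).
  have := hB1 (r *: (x : R * R)); have := hB2 (r *: (x : R * R)).
  move: ('D_e1 chi _) ('D_e2 chi _) => a b hb ha.
  have A : a ^+ 2 <= B1 ^+ 2.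
    by rewrite -real_normK ?num_real// lerXn2r ?nnegrE//; exact: le_trans ha.
  have B : b ^+ 2 <= B2 ^+ 2.
    by rewrite -real_normK ?num_real// lerXn2r ?nnegrE//; exact: le_trans hb.
  rewrite (_ : _ + _ = r ^+ 2 * (a ^+ 2 + b ^+ 2)); last by ring.
  by apply: ler_wpM2l; [exact: sqr_ge0|exact: lerD].
rewrite indicE memNset//= mulr0 /grad_dot.
have xo : 3 * 4%:R ^+ k < `|x : R * R|.
  rewrite ltNge; apply/negP => xl; apply: xn; apply/ballN2P.
  move: xl; rewrite prod_normE ge_max => /andP[x1 x2].
  have p4 := pow4_gt0 k; rewrite /n natrM natrX.
  by split; [apply: le_lt_trans x1 _|apply: le_lt_trans x2 _]; rewrite ltr_pM2r// ltr_nat.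
by rewrite (cutoff_derive_out e1 xo) (cutoff_derive_out e2 xo) mulr0 addr0.
Qed.

#[local] Opaque chi cutoff.

(* The gradients of the cutoffs at scales 4^k, ..., 4^(k+j-1) have disjoint
   supports, so the energy of the sum grows like j, while its value near the
   origin is j: this is the vanishing capacity of the plane. *)
Fixpoint plateau k j : T2 -> R :=
  if j is j'.+1 then fun x => plateau k j' x + cutoff (k + j') x else fun=> 0.

Lemma plateau0 k : plateau k 0 = cst 0. Proof. by []. Qed.

Lemma plateau_smooth k j : smooth (plateau k j : R * R -> R).
Proof.
elim: j => [|j IH] /=; first exact: smooth_cst.
exact: (smoothD IH (cutoff_smooth (k + j))).
Qed.

Lemma plateau_test2 k j : test2 (plateau k j).
Proof.
elim: j => [|j IH] /=; last exact: (test2_add IH (cutoff_test2 (k + j))).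
by apply/test2P; split; [exact: smooth_cst|exists 0%N => x; rewrite eqxx].
Qed.

Lemma plateauE k j (x : R * R) : `|x| < 4%:R ^+ k -> plateau k j x = j%:R.
Proof.
move=> xk; elim: j => [//|j IH] /=; rewrite IH -natr1 cutoff1//.
by apply: lt_le_trans xk _; rewrite ler_eXn2l ?leq_addr// ltr1n.
Qed.

Lemma plateau_deriveE k j v (x : R * R) :
  'D_v (plateau k j.+1) x = 'D_v (plateau k j) x + 'D_v (cutoff (k + j)) x.
Proof.
exact: (congr1 (fun t => t x) (derive_addE v (smooth_diff (plateau_smooth k j))
  (smooth_diff (cutoff_smooth (k + j))))).
Qed.

Lemma plateau_derive_out k j v (x : R * R) : 4%:R ^+ (k + j) <= `|x| ->
  'D_v (plateau k j) x = 0.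
Proof.
elim: j => [|j IH] xk.
  by rewrite [plateau k 0]/=; exact: derive_cst.
rewrite plateau_deriveE IH ?add0r; last first.
  by apply: le_trans xk; rewrite ler_eXn2l ?ltr1n// addnS.
apply: cutoff_derive_out; apply: lt_le_trans xk.
by rewrite addnS exprS ltr_pM2r ?pow4_gt0// ltr_nat.
Qed.

#[local] Opaque plateau.

Lemma plateau_dirichlet C k j : (forall i, dirichlet (cutoff i) <= C) ->
  dirichlet (plateau k j) <= j%:R * C.
Proof.
move=> hC; elim: j => [|j IH].
  rewrite mul0r /dirichlet (eq_int2 (g := fun=> 0)); last first.
    move=> x; rewrite /grad_dot (plateau0 k).
    by rewrite !derive_cst mulr0 addr0.
  by rewrite /int2 Rintegral_cst// mul0r.
rewrite -natr1 mulrDl mul1r; apply: le_trans (lerD IH (hC (k + j)%N)).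
rewrite /dirichlet -(int2D (itg_bcs (grad_dot_bcs (plateau_test2 k j)))
  (itg_bcs (grad_dot_bcs (cutoff_test2 (k + j))))).
rewrite le_eqVlt; apply/orP; left; apply/eqP; apply: eq_int2 => x.
rewrite /grad_dot (plateau_deriveE k j e1) (plateau_deriveE k j e2).
have [xk|xk] := ltP `|x : R * R| (4%:R ^+ (k + j)).
  by rewrite (cutoff_derive0 e1 xk) (cutoff_derive0 e2 xk) !mulr0 !addr0.
have G (a b c d : R) : a = 0 -> b = 0 ->
    (a + c) * (a + c) + (b + d) * (b + d) = a * a + b * b + (c * c + d * d).
  by move=> -> ->; rewrite !mulr0 !add0r.
exact: (G _ _ _ _ (plateau_derive_out e1 xk) (plateau_derive_out e2 xk)).
Qed.

Lemma dirichletE f : dirichlet f = int2 (grad_dot f f). Proof. by []. Qed.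

Lemma dirichlet_ge0 f : 0 <= dirichlet f.
Proof. by apply: int2_ge0 => x; rewrite addr_ge0// -expr2 sqr_ge0. Qed.

#[local] Opaque dirichlet int2.

(** Parallelogram law for the Dirichlet form. *)
Lemma dirichlet_comb (f g : R * R -> R) (t : R) : test2 f -> test2 g ->
  dirichlet (fun x => t * f x + g x) + dirichlet (fun x => t * f x - g x) =
  2 * (t ^+ 2 * dirichlet f + dirichlet g).
Proof.
move=> tf tg.
have df := smooth_diff (test2_smooth tf); have dg := smooth_diff (test2_smooth tg).
have tt := test2_scale t tf; have tn := test2_scale (-1) tg.
have dt := smooth_diff (test2_smooth tt); have dn := smooth_diff (test2_smooth tn).
have E1 (v x : R * R) : 'D_v (fun x => t * f x + g x) x = t * 'D_v f x + 'D_v g x.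
  have F1 : 'D_v (fun x => t * f x) x = t * 'D_v f x.
    exact: (@deriveZ _ _ _ (f : R * R -> R) t x v (diff_derivable (df x))).
  by rewrite -F1; exact: (@deriveD _ _ _ (fun x : R * R => t * f x) g x v (diff_derivable (dt x)) (diff_derivable (dg x))).
have nE : (fun x => t * f x - g x) = (fun x => t * f x + -1 * g x).
  by apply/funext => x; rewrite mulN1r.
have E2 (v x : R * R) : 'D_v (fun x => t * f x - g x) x = t * 'D_v f x - 'D_v g x.
  have F1 : 'D_v (fun x => t * f x) x = t * 'D_v f x.
    exact: (@deriveZ _ _ _ (f : R * R -> R) t x v (diff_derivable (df x))).
  have F2 : 'D_v (fun x => -1 * g x) x = - 'D_v g x.
    by rewrite -[RHS]mulN1r; exact: (@deriveZ _ _ _ (g : R * R -> R) (-1) x v (diff_derivable (dg x))).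
  by rewrite -F1 -F2 nE; exact: (@deriveD _ _ _ (fun x : R * R => t * f x) (fun x => -1 * g x) x v (diff_derivable (dt x)) (diff_derivable (dn x))).
have bf := grad_dot_bcs tf; have bg := grad_dot_bcs tg.
have b1 := grad_dot_bcs (test2_add tt tg).
have b2 : bcs (grad_dot (fun x => t * f x - g x) (fun x => t * f x - g x)).
  by rewrite nE; exact: (grad_dot_bcs (test2_add tt tn)).
have c1 := bcsMr (bdd_cst (t ^+ 2)) bf.
rewrite !dirichletE -(int2D (itg_bcs b1) (itg_bcs b2)) -(int2Z _ (itg_bcs bf)).
rewrite -(int2D (itg_bcs c1) (itg_bcs bg)) -(int2Z _ (itg_bcs (bcsD c1 bg))).
apply: eq_int2 => x; rewrite /grad_dot !E1 !E2.
by move: ('D_e1 f x) ('D_e2 f x) ('D_e1 g x) ('D_e2 g x) => a b c d; ring.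
Qed.

(** * From the energy bound to vanishing against test functions *)

Section Vanish.
Variables (v : T2 -> R) (K : R).
Hypotheses (Lv : loc2 v) (K0 : 0 <= K).
Hypothesis Hv : forall f, test2 f -> `|int2 (fun x => v x * f x ^+ 2)| <= K * dirichlet f.

Lemma polarized_bound f g (t : R) : test2 f -> test2 g ->
  4 * t * int2 (fun x => v x * (f x * g x)) <= 2 * K * (t ^+ 2 * dirichlet f + dirichlet g).
Proof.
move=> tf tg; have tt := test2_scale t tf.
have t1 := test2_add tt tg.
have t2 : test2 (fun x => t * f x - g x).
  have := test2_add tt (test2_scale (-1) tg); congr test2.
  by apply/funext => x; rewrite mulN1r.
have i1 := itg_loc2 Lv (bcs_sqr (test2_bcs t1)).
have i2 := itg_loc2 Lv (bcs_sqr (test2_bcs t2)).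
have bfg := bcsMl (test2_bcs tf) (bcs_bdd (test2_bcs tg)).
rewrite -(int2Z _ (itg_loc2 Lv bfg)).
have -> : int2 (fun x => 4 * t * (v x * (f x * g x))) =
    int2 (fun x => v x * (t * f x + g x) ^+ 2) - int2 (fun x => v x * (t * f x - g x) ^+ 2).
  rewrite -(int2B i1 i2); apply: eq_int2 => x.
  by move: (v x) (f x) (g x) => a b c; ring.
have G (a b d1 d2 S : R) : `|a| <= K * d1 -> `|b| <= K * d2 -> d1 + d2 = 2 * S ->
    a - b <= 2 * K * S.
  move=> h1 h2 dS; rewrite (_ : 2 * K * S = K * d1 + K * d2).
    by apply: le_trans (lerD h1 h2); apply: le_trans (ler_norm _) _; exact: ler_normB.
  by rewrite -mulrDr dS; ring.
exact: (G _ _ _ _ _ (Hv t1) (Hv t2) (dirichlet_comb t tf tg)).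
Qed.

Lemma int2_test_le0 g : test2 g -> int2 (fun x => v x * g x) <= 0.
Proof.
move=> tg; have [_ [n ng]] := (iffLR (test2P g)) tg.
have [C [C0 hC]] := cutoff_dirichlet.
set b := int2 _; rewrite leNgt; apply/negP => b0.
(* The radius [n] of the support of [g] can serve as the first scale of the plateau, which then
   equals [j] on that support. *)
have nk : n%:R <= 4%:R ^+ n :> R.
  by rewrite -natrX ler_nat ltnW// ltn_expl.
(* Chosen so that [t * (K * C) <= b]: the plateau energy then absorbs at most half of
   [4 * j * t * b], and the other half stays below [2 * K * Dg] for every [j]. *)
pose t := b / (K * C + 1).
have KC1 : 0 < K * C + 1 by rewrite ltr_wpDl// mulr_ge0.
have t0 : 0 < t by rewrite divr_gt0.
pose Dg := dirichlet g.
have Dg0 : 0 <= Dg := dirichlet_ge0 g.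
have main j : (0 < j)%N -> 2 * j%:R * t * b <= 2 * K * Dg.
  move=> j0; have := polarized_bound t (plateau_test2 n j) tg.
  have -> : int2 (fun x => v x * (plateau n j x * g x)) = j%:R * b.
    rewrite /b -(int2Z _ (itg_loc2 Lv (test2_bcs tg))); apply: eq_int2 => x.
    have [->|/ng /ballN2P[x1 x2]] := eqVneq (g x) 0; first by rewrite !mulr0.
    rewrite plateauE; first by rewrite mulrCA.
    by apply: lt_le_trans nk; rewrite prod_normE gt_max x1.
  have h1 := plateau_dirichlet n j hC.
  have j0' : 0 < j%:R :> R by rewrite ltr0n.
  move: h1 j0'; rewrite -/Dg; move: (dirichlet (plateau n j)) (j%:R : R) => p q pq q0 h.
  have tKC : t * (K * C) <= b.
    by rewrite /t mulrAC ler_pdivrMr// ler_wpM2l ?lerDl// ltW.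
  have h2 : 2 * K * (t ^+ 2 * p) <= 2 * K * (t ^+ 2 * (q * C)).
    by apply: ler_wpM2l; [exact: mulr_ge0|apply: ler_wpM2l => //; exact: sqr_ge0].
  have h3 : 2 * K * (t ^+ 2 * (q * C)) <= 2 * q * t * b.
    rewrite (_ : 2 * K * _ = 2 * q * t * (t * (K * C))); last by ring.
    apply: ler_wpM2l; last exact: tKC.
    by apply: mulr_ge0; [apply: mulr_ge0 => //|]; exact: ltW.
  by move: h h2 h3; rewrite mulrDr (_ : 4 * t * (q * b) = 2 * (2 * q * t * b)); [lra|ring].
have tb0 : 0 < 2 * t * b by apply: mulr_gt0 => //; exact: mulr_gt0.
pose j := (Num.trunc (2 * K * Dg / (2 * t * b))).+1.
have := main j isT; apply/negP; rewrite -ltNge.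
rewrite (_ : 2 * j%:R * t * b = j%:R * (2 * t * b)); last by ring.
by rewrite -ltr_pdivrMr//; exact: truncnS_gt.
Qed.

Lemma int2_test_eq0 g : test2 g -> int2 (fun x => v x * g x) = 0.
Proof.
move=> tg; apply/eqP; rewrite eq_le (int2_test_le0 tg)/=.
have := int2_test_le0 (test2_scale (-1) tg).
rewrite (eq_int2 (g := fun x => - (v x * g x))); last by move=> x; rewrite mulN1r mulrN.
by rewrite (int2N (itg_loc2 Lv (test2_bcs tg))) oppr_le0.
Qed.

End Vanish.
End Cutoff.

(** * The two-dimensional case *)

Section Plane.
#[local] Opaque derive.
Context {R : realType}.
Local Notation T1 := (measurableTypeR R).
Local Notation T2 := (T1 * T1)%type.
Local Notation itg f := (leb2.-integrable setT (EFin \o (f : T2 -> R))).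
Implicit Types (k m n : nat) (h f g v : T2 -> R).

(** A bounded substitute for the sign: [t * clip t] is nonnegative and vanishes only at 0. *)
Definition clip (t : R) : R := Num.max (-1) (Num.min t 1).

Lemma clip_le1 t : `|clip t| <= 1.
Proof. by rewrite /clip ler_norml le_max lexx/= ge_max ge_min lexx orbT; lra. Qed.

Lemma mul_clip_ge0 t : 0 <= t * clip t.
Proof.
rewrite /clip; have [t0|t0] := leP 0 t.
  by rewrite mulr_ge0// le_max le_min t0 ler01 orbT.
by rewrite nmulr_rge0// ge_max ge_min (ltW t0) lerN10.
Qed.

Lemma mul_clip_eq0 t : t * clip t = 0 -> t = 0.
Proof.
move=> /eqP; rewrite mulf_eq0 => /orP[/eqP//|].
by rewrite /clip; case: (leP t 1) => t1; case: leP => t2 /eqP; lra.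
Qed.

(** Orthogonality passes from test functions to the clipped [v] on a box, by mollifying the latter.
    The product of [v] with it is nonnegative with zero integral, hence zero almost everywhere on
    each box. *)
Lemma vanish_of_tests v : loc2 v -> (forall g, test2 g -> int2 (fun x => v x * g x) = 0) ->
  {ae leb2, forall x, v x = 0}.
Proof.
move=> Lv Hv; have mv : measurable_fun setT v by case: Lv.
pose h n : T2 -> R := fun x => \1_(ballN2 n : set T2) x * clip (v x).
have mclip : measurable_fun setT (fun x => clip (v x)).
  by apply: measurable_maxr; [exact: measurable_cst|apply: measurable_minr; [exact: mv|exact: measurable_cst]].
have bclip : bdd (fun x => clip (v x)).
  by split; [exact: mclip|exists 1 => x; exact: clip_le1].
have bh n : bcs (h n) := bcsMl (bcs_indic n) bclip.
have h1 n x : `|h n x| <= 1.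
  rewrite /h normrM indicE ger0_norm ?ler0n//.
  by case: (_ \in _); rewrite ?mul1r ?mul0r ?clip_le1.
have nh n : supp_in n (h n).
  move=> x; rewrite /h mulf_eq0 negb_or indicE pnatr_eq0 eqb0 negbK => /andP[/set_mem//].
have ivh n : int2 (fun x => v x * h n x) = 0.
  apply/eqP; rewrite -normr_le0.
  pose g m x := convol (h n) (rho m) x - h n x.
  have bc m : bcs (convol (h n) (rho m)) by exact/test2_bcs/conv_test2/rho_test2.
  have bg m : bcs (g m) := bcsB (bc m) (bh n).
  have ng m : supp_in n.+1 (g m).
    move=> x; rewrite -addn1; apply: contra_neqP => nx.
    rewrite /g (supp_in0 (conv_supp (nh n) (rho_supp (R := R) (m := m))) nx).
    by rewrite (supp_in0 (supp_inW (leq_addr 1 n) (nh n)) nx) subr0.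
  apply: (@le_norm_of_cvg0 _ _ _ (fun m => int2 (fun x => v x * g m x)) (fun=> 0)).
  - move=> m; rewrite -(int2D (itg_loc2 Lv (bh n)) (itg_loc2 Lv (bg m))).
    rewrite (eq_int2 (g := fun x => v x * convol (h n) (rho m) x)); last first.
      by move=> x; rewrite /g -mulrDr addrC subrK.
    rewrite (Hv _ (conv_test2 (bh n) (rho_test2 m))) normr0 addr0; exact: lexx.
  - apply: (@loc2_cvg0 _ v g 2 n.+1 Lv bg _ ng).
      move=> m x; apply: le_trans (ler_normB _ _) _.
      have := conv_rho_le m x (bcs_bdd (bh n)) (h1 n); have := h1 n x; lra.
    rewrite (_ : (fun m => _) = (fun m => int2 (fun x =>
      \1_(ballN2 n.+1 : set T2) x * `|convol (h n) (rho m) x - h n x|))).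
      exact: (mollify_cvg n.+1 (bcs_bdd (bh n))).
    apply/funext => m; apply: eq_int2 => x; rewrite -/(g m x) indicE.
    have [->|/(ng m) xn] := eqVneq (g m x) 0; first by rewrite normr0 mulr0.
    by rewrite mem_set// mul1r.
  - exact: cvg_cst.
have aeh n : {ae leb2, forall x, v x * h n x = 0}.
  have iv := itg_loc2 Lv (bh n).
  have mvh : measurable_fun setT (fun x => (v x * h n x)%:E).
    by case/integrableP : iv.
  have /(ae_eq_integral_abs _ measurableT mvh) : (\int[leb2]_(x in setT) `|(v x * h n x)%:E| = 0)%E.
    rewrite (eq_integral (fun x => (v x * h n x)%:E)).
      by rewrite (int2E iv) ivh.
    move=> x _; rewrite abse_EFin ger0_norm// /h mulrCA mulr_ge0 ?mul_clip_ge0//.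
  apply: (@filterS _ _ (ae_filter_ringOfSetsType leb2)).
  by move=> x /(_ I)/= [].
have := ae_foralln aeh.
apply: (@filterS _ _ (ae_filter_ringOfSetsType leb2)) => x vh.
have [n xn] := box_exists x.
by have := vh n; rewrite /h indicE mem_set// mul1r; exact: mul_clip_eq0.
Qed.

Section Core.
Variables (Q V psi : T2 -> R) (E0 M : R).
Hypotheses (LQ : loc2 Q) (LV : loc2 V) (mpsi : measurable_fun setT psi).
Hypotheses (psiM : forall x, `|psi x| <= M) (psi0 : forall x, 0 < psi x).

Lemma form_ge_int2 W f : loc2 W -> test2 f -> form_ge leb2 test2 grad2_2 W E0 ->
  0 <= int2 (fun x => grad_dot f f x + (W x - E0) * f x ^+ 2).
Proof.
move=> LW tf /(_ f tf); have bf := bcs_sqr (test2_bcs tf).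
have bg := itg_bcs (grad_dot_bcs tf); have iW := itg_loc2 LW bf; have if2 := itg_bcs bf.
have bgW : itg (fun x => grad_dot f f x + W x * f x ^+ 2).
  exact: (integrableD measurableT bg iW).
have iE : itg (fun x => E0 * f x ^+ 2) := itg_bcs (bcsMr (bdd_cst E0) bf).
have -> : (\int[leb2]_x (grad2_2 f x + W x * f x ^+ 2)%:E =
    (int2 (fun x => grad_dot f f x + W x * f x ^+ 2))%:E)%E := int2E bgW.
rewrite (int2E if2) -EFinM lee_fin -(int2Z _ if2) => h.
rewrite (eq_int2 (g := fun x => (grad_dot f f x + W x * f x ^+ 2) - E0 * f x ^+ 2)).
  by rewrite (int2B bgW iE) subr_ge0.
by move=> x; rewrite mulrBl addrA.
Qed.

Hypothesis Fplus : form_ge leb2 test2 grad2_2 (Q \+ V) E0.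
Hypothesis Fminus : form_ge leb2 test2 grad2_2 (Q \- V) E0.
Hypothesis Hsol : dist_solution leb2 test2 lap2 Q E0 psi.

Let W x := Q x - E0.

Lemma vanishing_potential : {ae leb2, forall x, V x = 0}.
Proof.
have bpsi : bdd psi by split => //; exists M.
have LW : loc2 W := loc2D LQ (loc2_cst (- E0)).
have Hp f : test2 f -> 0 <= int2 (fun x => grad_dot f f x + (W x + V x) * f x ^+ 2).
  move=> tf; have := form_ge_int2 (loc2D LQ LV) tf Fplus.
  rewrite (eq_int2 (g := fun x => grad_dot f f x + (W x + V x) * f x ^+ 2))//.
  by move=> x; congr (_ + _ * _); rewrite /W addrAC.
have Hm f : test2 f -> 0 <= int2 (fun x => grad_dot f f x + (W x - V x) * f x ^+ 2).
  move=> tf; have := form_ge_int2 (loc2D LQ (loc2N LV)) tf Fminus.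
  rewrite (eq_int2 (g := fun x => grad_dot f f x + (W x - V x) * f x ^+ 2))//.
  by move=> x; congr (_ + _ * _); rewrite /W addrAC.
have Hd f : test2 f -> int2 (fun x => psi x * lap f x) = int2 (fun x => W x * (psi x * f x)).
  move=> tf; have := Hsol tf; have bf := test2_bcs tf.
  have bl := test2_bcs (test2_lap tf).
  have i1 := itg_bcs (bcsMr bpsi bl); have bpf := bcsMr bpsi bf.
  have i2 := itg_loc2 LQ bpf; have i3 := itg_bcs bpf.
  have i4 : itg (fun x => E0 * (psi x * f x)) := itg_bcs (bcsMr (bdd_cst E0) bpf).
  have i5 : itg (fun x => Q x * (psi x * f x) - psi x * lap f x).
    exact: (integrableB measurableT i2 i1).
  rewrite (eq_integral (fun x => (Q x * (psi x * f x) - psi x * lap f x)%:E)); last first.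
    by move=> x _; rewrite mulrN addrC mulrA.
  rewrite (int2E i5) (int2E i3) -EFinM => -[]; rewrite (int2B i2 i1) -(int2Z _ i3).
  have -> : int2 (fun x => W x * (psi x * f x)) =
      int2 (fun x => Q x * (psi x * f x)) - int2 (fun x => E0 * (psi x * f x)).
    by rewrite -(int2B i2 i4); apply: eq_int2 => x; rewrite /W mulrBl.
  by lra.
have pb := potential_bound LW LV bpsi psiM Hp Hm Hd.
have Lv : loc2 (fun x => V x * psi x ^+ 2) := loc2M LV (bdd_sqr bpsi).
have vb f : test2 f -> `|int2 (fun x => V x * psi x ^+ 2 * f x ^+ 2)| <= M ^+ 2 * dirichlet f.
  move=> /pb; congr (`|_| <= _); apply: eq_int2 => x; rewrite exprMn; ring.
have := vanish_of_tests Lv (int2_test_eq0 Lv (sqr_ge0 M) vb).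
apply: (@filterS _ _ (ae_filter_ringOfSetsType leb2)) => x /eqP.
by rewrite mulf_eq0 expf_eq0/= (gt_eqF (psi0 x)) orbF => /eqP.
Qed.

End Core.
End Plane.

(** * The one-dimensional case *)

Section Slices.
Context {R : realType}.
Local Notation T1 := (measurableTypeR R).
Local Notation T2 := (T1 * T1)%type.
Local Notation mu := (@lebesgue_measure R).
Local Notation itg f := (leb2.-integrable setT (EFin \o (f : T2 -> R))).
Implicit Types (f : R * R -> R).

(** The two difference quotients coincide as functions of the increment, so their limits coincide
    without any appeal to the chain rule. *)
Lemma derive_slice f (v t y : R) : 'D_v (fun s : R => f (s, y)) t = 'D_((v, 0) : R * R) f (t, y).
Proof.
have E : (fun h : R => h^-1 *: (((fun s : R => f (s, y)) \o shift t) (h *: v) - f (t, y))) =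
    (fun h => h^-1 *: ((f \o shift ((t, y) : R * R)) (h *: ((v, 0) : R * R)) - f (t, y))).
  apply/funext => h /=; congr (_ *: (f _ - _)).
  by apply: injective_projections => //=; rewrite scaler0 add0r.
exact: (congr1 (fun g : R -> R => lim (g @ (0 : R)^')) E).
Qed.

Lemma iter_derive_slice f s y :
  iter_deriv s (fun t : R => f (t, y)) =
  (fun t => iter_deriv [seq ((v, 0) : R * R) | v <- s] f (t, y)).
Proof.
elim: s => [//|v s IH] /=; apply/funext => t.
by rewrite -/(iter_deriv s _) IH derive_slice.
Qed.

Lemma smooth_slice f y : smooth f -> smooth (fun t : R => f (t, y)).
Proof.
move=> sf s x; rewrite iter_derive_slice; apply/derivable1_diffP.
have := is_derive_line (0, y) e1 x (sf [seq ((v, 0) : R * R) | v <- s]).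
by under eq_fun do rewrite line1E; case.
Qed.

Lemma test1_slice f y : test2 (f : T2 -> R) -> test1 (fun t : T1 => f (t, y)).
Proof.
move=> tf; have [sf [n nf]] := (iffLR (test2P f)) tf.
split; first exact: smooth_slice.
have cK := @segment_compact R (- n%:R) n%:R.
rewrite /compact_support; apply: (subclosed_compact (@closed_closure _ _) cK).
have -> : `[- n%:R, n%:R]%classic = closure (`[- n%:R, n%:R]%classic : set R).
  by apply/closure_id; exact: interval_closed.
apply: closure_subset => x /= /nf /ballN2P[/= x1 _].
by rewrite in_itv/= -ler_norml ltW.
Qed.

Lemma int2_slice1_ge0 h : itg h ->
  (forall y, 0 <= \int[mu]_x (h (x, y))%:E)%E -> 0 <= int2 h.
Proof.
move=> ih h0; rewrite /int2 /Rintegral -(integral21_prod_meas1 ih).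
by apply: fine_ge0; apply: integral_ge0 => y _; exact: h0.
Qed.

Lemma int2_slice1_eq0 h : itg h ->
  (forall y, \int[mu]_x (h (x, y))%:E = 0)%E -> int2 h = 0.
Proof.
move=> ih h0; rewrite /int2 /Rintegral -(integral21_prod_meas1 ih).
by rewrite [X in fine X](_ : _ = 0)//; apply: integral0_eq => y _; exact: h0.
Qed.

Lemma int2_slice2_eq0 h : itg h ->
  (forall x, \int[mu]_y (h (x, y))%:E = 0)%E -> int2 h = 0.
Proof.
move=> ih h0; rewrite /int2 /Rintegral -(integral12_prod_meas1 ih).
by rewrite [X in fine X](_ : _ = 0)//; apply: integral0_eq => x _; exact: h0.
Qed.

Lemma lebesgue_ballN1 n : (mu (ballN1 n) < +oo)%E.
Proof.
have -> : mu (ballN1 n) = (n%:R *+ 2)%:E by exact: lebesgue_measure_ball.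
exact: ltry.
Qed.

Lemma itg_slice (W : T1 -> R) (h : T2 -> R) y : Lploc mu ballN1 2 W -> bcs h ->
  mu.-integrable setT (EFin \o (fun x => W x * h (x, y))).
Proof.
move=> LW [[mh [B hB]] [n nh]].
apply: (@integrable_Lploc2M _ _ _ _ ballN1 _ _ _ _ n B) => //.
- by move=> k; exact: measurable_ball1.
- exact: lebesgue_ballN1.
- exact: measurableT_comp mh (measurable_pair2 y).
- by move=> x /nh [].
Qed.

Lemma itg_slice1 (h : T2 -> R) y : bcs h ->
  mu.-integrable setT (EFin \o (fun x => h (x, y))).
Proof.
move=> bh.
have L1 : Lploc mu ballN1 2 (fun=> 1).
  by apply: Lploc2_cst; [move=> n; exact: measurable_ball1|exact: lebesgue_ballN1].
have := itg_slice y L1 bh.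
by apply: eq_integrable => //= x _; rewrite mul1r.
Qed.

Definition cyl (W : T1 -> R) (x : T2) : R := W x.1.

Lemma measurable_cyl (W : T1 -> R) : measurable_fun setT W -> measurable_fun setT (cyl W).
Proof. by move=> mW; exact: measurableT_comp mW measurable_fst. Qed.

Lemma loc2_cyl (W : T1 -> R) : Lploc mu ballN1 2 W -> loc2 (cyl W).
Proof.
move=> [mW LW]; have mL := measurable_cyl mW; split => // n.
have mP : measurable_fun setT (fun x : T2 => (`|cyl W x| ^+ 2)%:E).
  by apply/measurable_EFinP; apply: measurable_funX; exact: measurableT_comp.
apply/integrableP; split; first exact: measurable_funS mP.
rewrite (eq_integral (fun x => (`|cyl W x| ^+ 2)%:E)); last first.
  by move=> x _; rewrite abse_EFin ger0_norm// exprn_ge0.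
rewrite (box_tonelli2 n mP); last by move=> x; rewrite lee_fin exprn_ge0.
have /integrableP[_ Woo] := LW n.
rewrite (eq_integral (cst (\int[mu]_(x in ballN1 n) (`|W x| ^+ 2)%:E)%E))//.
rewrite integral_cst; last exact: measurable_ball1.
apply: lte_mul_pinfty.
- by apply: integral_ge0 => x _; rewrite lee_fin exprn_ge0.
- rewrite ge0_fin_numE; last by apply: integral_ge0 => x _; rewrite lee_fin exprn_ge0.
  apply: le_lt_trans Woo; rewrite le_eqVlt; apply/orP; left; apply/eqP.
  by apply: eq_integral => x _; rewrite abse_EFin [in RHS]ger0_norm// exprn_ge0.
- exact: lebesgue_ballN1.
Qed.

Lemma lap1_slice f (x y : R) :
  lap1 (fun t : T1 => f (t, y)) x = 'D_e1 ('D_e1 f) (x, y).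
Proof.
have E : 'D_1 (fun t : R => f (t, y)) = fun t => 'D_e1 f (t, y).
  by apply/funext => t; exact: derive_slice.
exact: (etrans (congr1 (fun g => 'D_1 g x) E) (derive_slice ('D_e1 f) 1 x y)).
Qed.

Lemma form_ge_cyl (W : T1 -> R) (E0 : R) : Lploc mu ballN1 2 W -> form_ge mu test1 grad2_1 W E0 ->
  form_ge leb2 test2 grad2_2 (cyl W) E0.
Proof.
move=> LW Wge f tf.
have t1 := test2_derive e1 tf; have t2 := test2_derive e2 tf.
have bf := bcs_sqr (test2_bcs tf).
have b1 := bcs_sqr (test2_bcs t1); have b2 := bcs_sqr (test2_bcs t2).
have iW := itg_loc2 (loc2_cyl LW) bf.
have bE := bcsMr (bdd_cst E0) bf.
have i1 : itg (fun x => 'D_e1 f x ^+ 2 + cyl W x * f x ^+ 2).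
  exact: (integrableD measurableT (itg_bcs b1) iW).
have ih : itg (fun x => 'D_e1 f x ^+ 2 + cyl W x * f x ^+ 2 - E0 * f x ^+ 2).
  exact: (integrableB measurableT i1 (itg_bcs bE)).
have i12 : itg (fun x => 'D_e1 f x ^+ 2 + 'D_e2 f x ^+ 2).
  exact: (integrableD measurableT (itg_bcs b1) (itg_bcs b2)).
have ig : itg (fun x => 'D_e1 f x ^+ 2 + 'D_e2 f x ^+ 2 + cyl W x * f x ^+ 2).
  exact: (integrableD measurableT i12 iW).
have h0 : 0 <= int2 (fun x => 'D_e1 f x ^+ 2 + cyl W x * f x ^+ 2 - E0 * f x ^+ 2).
  apply: int2_slice1_ge0 => // y.
  have := Wge _ (test1_slice y tf).
  have jf := itg_slice1 y bf; have jW := itg_slice y LW bf.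
  have jD := itg_slice1 y b1; have jE := itg_slice1 y bE.
  have j1 : mu.-integrable setT (EFin \o (fun x => 'D_e1 f (x, y) ^+ 2 + W x * f (x, y) ^+ 2)).
    exact: (integrableD measurableT jD jW).
  have -> : (\int[mu]_x ((grad2_1 (fun t => f (t, y)) x + W x * f (x, y) ^+ 2)%R)%:E =
      \int[mu]_x ('D_e1 f (x, y) ^+ 2 + W x * f (x, y) ^+ 2)%:E)%E.
    by apply: eq_integral => x _; rewrite /grad2_1 derive_slice.
  rewrite -(integralZl measurableT jf) => hle.
  rewrite (_ : (\int[mu]_x _ = \int[mu]_x ('D_e1 f (x, y) ^+ 2 + W x * f (x, y) ^+ 2)%:E
      - \int[mu]_x (E0 * f (x, y) ^+ 2)%:E)%E); last first.
    exact: (integralB_EFin measurableT j1 jE).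
  rewrite sube_ge0//; apply/orP; left; apply: (integrable_fin_num measurableT jE).
have -> : (\int[leb2]_x ((grad2_2 f x + cyl W x * f x ^+ 2)%R)%:E =
    (int2 (fun x => 'D_e1 f x ^+ 2 + 'D_e2 f x ^+ 2 + cyl W x * f x ^+ 2))%:E)%E := int2E ig.
rewrite (int2E (itg_bcs bf)) -EFinM lee_fin -(int2Z _ (itg_bcs bf)).
move: h0; rewrite (int2B i1 (itg_bcs bE)) subr_ge0 => /le_trans; apply.
by apply: le_int2 => // x; rewrite lerD2r lerDl sqr_ge0.
Qed.

Lemma dist_solution_cyl (W psi : T1 -> R) (E0 : R) : Lploc mu ballN1 2 W ->
  measurable_fun setT psi -> (exists M : R, forall x, `|psi x| <= M) ->
  dist_solution mu test1 lap1 W E0 psi ->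
  dist_solution leb2 test2 lap2 (cyl W) E0 (cyl psi).
Proof.
move=> LW mpsi [M psiM] sol f tf.
have bpsi : bdd (cyl psi) by split; [exact: measurable_cyl|exists M => x; exact: psiM].
have bf := test2_bcs tf.
have t1 := test2_derive e1 (test2_derive e1 tf).
have t2 := test2_derive e2 (test2_derive e2 tf).
have bp := bcsMr bpsi bf.
have b1 := bcsN (bcsMr bpsi (test2_bcs t1)); have b2 := bcsMr bpsi (test2_bcs t2).
have iW := itg_loc2 (loc2_cyl LW) bp; have bE := bcsMr (bdd_cst E0) bp.
have i1 : itg (fun x => - (cyl psi x * 'D_e1 ('D_e1 f) x) + cyl W x * (cyl psi x * f x)).
  exact: (integrableD measurableT (itg_bcs b1) iW).
have ih : itg (fun x => - (cyl psi x * 'D_e1 ('D_e1 f) x) + cyl W x * (cyl psi x * f x)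
    - E0 * (cyl psi x * f x)).
  exact: (integrableB measurableT i1 (itg_bcs bE)).
have h1 : int2 (fun x => - (cyl psi x * 'D_e1 ('D_e1 f) x) + cyl W x * (cyl psi x * f x)
    - E0 * (cyl psi x * f x)) = 0.
  apply: int2_slice1_eq0 => // y.
  have := sol _ (test1_slice y tf).
  have jf := itg_slice1 y bp; have jW := itg_slice y LW bp.
  have jD := itg_slice1 y b1; have jE := itg_slice1 y bE.
  have j1 : mu.-integrable setT (EFin \o (fun x =>
      - (psi x * 'D_e1 ('D_e1 f) (x, y)) + W x * (psi x * f (x, y)))).
    exact: (integrableD measurableT jD jW).
  have -> : (\int[mu]_x (psi x * - lap1 (fun t => f (t, y)) x + W x * psi x * f (x, y))%:E =
      \int[mu]_x (- (psi x * 'D_e1 ('D_e1 f) (x, y)) + W x * (psi x * f (x, y)))%:E)%E.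
    by apply: eq_integral => x _; rewrite lap1_slice mulrN mulrA.
  rewrite -(integralZl measurableT jf) => heq.
  rewrite (_ : (\int[mu]_x _ = \int[mu]_x (- (psi x * 'D_e1 ('D_e1 f) (x, y)) +
      W x * (psi x * f (x, y)))%:E - \int[mu]_x (E0 * (psi x * f (x, y)))%:E)%E); last first.
    exact: (integralB_EFin measurableT j1 jE).
  rewrite heq subee//; exact: (integrable_fin_num measurableT jE).
have h2 : int2 (fun x => cyl psi x * 'D_e2 ('D_e2 f) x) = 0.
  apply: int2_slice2_eq0; first exact: itg_bcs.
  move=> x; rewrite /cyl/=.
  have tg := test2_derive e2 tf.
  have [sw [n nw]] := (iffLR (test2P _)) tg.
  have [sd [m md]] := (iffLR (test2P _)) t2.
  (* Along a vertical line [psi x] is a constant factor, so [psi x * 'D_e2 f (x, y)] is a primitive,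
     and it vanishes for large [|y|]. *)
  apply: (@integral_derive_eq0 _ (fun y => psi x * 'D_e2 f (x, y)) _ (maxn n m).+1%:R) => //.
  - move=> y; have := is_derive_line (x, 0) e2 y (smooth_diff sw).
    under eq_fun do rewrite line2E; rewrite line2E => hd.
    exact: (@is_deriveZ _ _ _ _ (psi x) _ _ _ hd).
  - move=> y; have := is_derive_line (x, 0) e2 y (smooth_diff sd).
    under eq_fun do rewrite line2E.
    move=> [dx _]; move/derivable1_diffP/differentiable_continuous: dx => dx.
    exact: cvgMr.
  - move=> y nmy; split.
      rewrite (supp_out nw) ?mulr0//; right; apply: le_trans nmy.
      by rewrite ler_nat leqW// leq_maxl.
    rewrite (supp_out md) ?mulr0//; right; apply: le_trans nmy.
    by rewrite ler_nat leqW// leq_maxr.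
have iT := integrableB measurableT i1 (itg_bcs b2).
have -> : (\int[leb2]_x (cyl psi x * - lap2 f x + cyl W x * cyl psi x * f x)%:E =
    (int2 (fun x => (- (cyl psi x * 'D_e1 ('D_e1 f) x) + cyl W x * (cyl psi x * f x)) -
      cyl psi x * 'D_e2 ('D_e2 f) x))%:E)%E.
  rewrite -(int2E iT); apply: eq_integral => x _; congr EFin; rewrite /lap2.
  by move: ('D_e1 ('D_e1 f) x) ('D_e2 ('D_e2 f) x) => a b; ring.
rewrite (int2E (itg_bcs bp)) -EFinM; congr EFin.
rewrite (int2B i1 (itg_bcs b2)) h2 subr0 -(int2Z _ (itg_bcs bp)).
by apply/eqP; rewrite -subr_eq0 -(int2B i1 (itg_bcs bE)); exact/eqP.
Qed.

(** The product of the set where [V] is nonzero with an interval of length 2 lies in a null set of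
    the plane; the product formula then forces the first factor to be null. *)
Lemma ae_cyl (V : T1 -> R) : measurable_fun setT V ->
  {ae leb2, forall x, cyl V x = 0} -> {ae mu, forall x, V x = 0}.
Proof.
move=> mV [N [mN N0 VN]].
pose A : set T1 := V @^-1` [set~ 0].
have mA : measurable A.
  rewrite -[A]setTI; apply: mV => //; apply: measurableC; exact: measurable_set1.
exists A; split => //.
have mB : measurable (ball (0 : R) 1 : set T1) by exact: measurable_ball1.
have AN : leb2 (A `*` ball (0 : R) 1) = 0%E.
  apply/eqP; rewrite eq_le measure_ge0 andbT -N0; apply: le_measure.
  - by rewrite inE; exact: measurableX.
  - by rewrite inE.
  - by move=> x [Vx _]; apply: VN.
have : (mu A * mu (ball (0 : R)%R 1%R) = 0)%E.
  by rewrite -AN; apply/esym; exact: product_measure1E.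
have -> : mu (ball (0 : R) 1) = (1 *+ 2)%:E by exact: lebesgue_measure_ball.
by move=> /eqP; rewrite mule_eq0 eqe pnatr_eq0 orbF => /eqP.
Qed.

End Slices.

(* d = 1 and d = 2 *)
Theorem theorem1p5 (R : realType) : @claim_d1 R /\ @claim_d2 R.
Proof.
have mW11 (d : measure_display) (T : measurableType d) (mu : {measure set T -> \bar R})
    K t p (psi : T -> R) : W11loc mu K t p psi -> measurable_fun setT psi.
  by case=> -[].
split=> Q E0 psi V LQ _ [[M psiM] [psi0 [/mW11 mpsi sol]]] LV Fp Fm.
  have mB n : measurable (ballN1 n : set (measurableTypeR R)).
    exact: measurable_ball1.
  apply: ae_cyl; first by case: LV.
  apply: (@vanishing_potential _ (cyl Q) (cyl V) (cyl psi) E0 M).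
  - exact: loc2_cyl.
  - exact: loc2_cyl.
  - exact: measurable_cyl.
  - by move=> x; exact: psiM.
  - by move=> x; exact: psi0.
  - by apply: form_ge_cyl Fp; exact: (Lploc2D mB).
  - by apply: form_ge_cyl Fm; exact: (Lploc2D mB LQ (Lploc2N mB LV)).
  - by apply: dist_solution_cyl => //; exists M.
exact: (vanishing_potential LQ LV mpsi psiM psi0 Fp Fm sol).
Qed.
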